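(* Let $m\geq 2$ and $n\geq m+1$ be integers. There exists a constant $C'_m\in(0,\infty)$, depending only on $m$, with the following property: if a Lebesgue-measurable set $A\subseteq\mathbb{R}^n$ satisfies $\bar{\delta}_n(A)>0$, then for every number $V>0$ there exists a right-angled $m$-dimensional simplex of $m$-volume $V$ with all $m+1$ vertices in $A$ and with the ratio of lengths of any two of its perpendicular edges being at most $\exp\big(C'_m\,\bar{\delta}_n(A)^{-9m^2}\big)$.
   Context: The upper Banach density of a measurable set $A\subseteq\mathbb{R}^n$ is $\bar{\delta}_n(A):=\limsup_{R\to\infty}\sup_{x\in\mathbb{R}^n}\frac{|A\cap(x+[0,R]^n)|}{R^n}$, where $|\cdot|$ is Lebesgue measure. A right-angled $m$-dimensional simplex is a (non-degenerate) simplex having a vertex such that the $m$ edges from that vertex are mutually perpendicular; these $m$ edges are its perpendicular edges, and its $m$-volume is the product of their lengths divided by $m!$. *)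

(* Defs.v *)
From mathcomp Require Import all_boot all_order all_algebra.
From mathcomp Require Import all_classical all_reals all_analysis.
From mathcomp Require Import measurable_realfun.

Set Implicit Arguments.
Unset Strict Implicit.
Unset Printing Implicit Defensive.

Import Order.TTheory GRing.Theory Num.Theory.
Import numFieldNormedType.Exports.

Local Open Scope classical_set_scope.
Local Open Scope ring_scope.

(* Lebesgue measure on the Borel sets of R^n, as the n-fold product of the
   one-dimensional measure: the unit mass on R^0, and R^(1+n) = R * R^n. *)
Fixpoint lebesgue_tuple (R : realType) (n : nat) :
    set (n.-tuple (measurableTypeR R)) -> \bar R :=
  match n with
  | 0 => @dirac _ (0.-tuple (measurableTypeR R)) [tuple] R
  | n'.+1 => pushforward (lebesgue_measure \x @lebesgue_tuple R n')%E
      (fun p : measurableTypeR R * n'.-tuple (measurableTypeR R) =>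
         [tuple of p.1 :: p.2])
  end.

Definition row_of_tuple (R : realType) (n : nat)
    (t : n.-tuple (measurableTypeR R)) : 'rV[R]_n :=
  \row_i tnth t i.

(* The sigma-algebra is completed: a Lebesgue measurable set is a Borel set up
   to a subset of a Borel null set. *)
Definition lebesgue_measurable (R : realType) (n : nat) (A : set 'rV[R]_n) :
    Prop :=
  completed_algebra_gen (@lebesgue_tuple R n) (@row_of_tuple R n @^-1` A).

(* The outer measure, which on Lebesgue measurable sets is the completed
   Lebesgue measure. *)
Definition vol (R : realType) (n : nat) (A : set 'rV[R]_n) : \bar R :=
  mu_ext (@lebesgue_tuple R n) (@row_of_tuple R n @^-1` A).

Definition cube (R : realType) (n : nat) (x : 'rV[R]_n) (r : R) :
    set 'rV[R]_n :=
  [set x + y | y in [set y : 'rV[R]_n | forall i, 0 <= y ord0 i <= r]].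

(* Its values lie in [0, 1]. *)
Definition upper_Banach_density (R : realType) (n : nat) (A : set 'rV[R]_n) :
    \bar R :=
  limf_esup
    (fun r : R => ereal_sup
       [set (vol (A `&` cube x r) * (r ^- n)%:E)%E | x in [set: 'rV[R]_n]])
    (+oo%R : set_system R).

(* The library norm on row vectors is the sup norm, hence the explicit
   Euclidean structure. *)
Definition dot (R : realType) (n : nat) (u v : 'rV[R]_n) : R :=
  \sum_(i < n) u ord0 i * v ord0 i.

Definition enorm (R : realType) (n : nat) (u : 'rV[R]_n) : R :=
  Num.sqrt (dot u u).

(* The [m.+1] points [v] are affinely independent. *)
Definition simplex (R : realType) (m n : nat) (v : 'I_m.+1 -> 'rV[R]_n) : Prop :=
  row_free (\matrix_(i < m) (v (lift ord0 i) - v ord0)).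

(* A right-angled simplex together with the vertex [k] at which its edges
   [v i - v k], [i != k], are mutually perpendicular. *)
Definition right_angled_simplex (R : realType) (m n : nat)
    (v : 'I_m.+1 -> 'rV[R]_n) (k : 'I_m.+1) : Prop :=
  simplex v /\
  forall i j : 'I_m.+1, i != k -> j != k -> i != j ->
    dot (v i - v k) (v j - v k) = 0.

Definition right_angled_volume (R : realType) (m n : nat)
    (v : 'I_m.+1 -> 'rV[R]_n) (k : 'I_m.+1) : R :=
  (\prod_(i < m.+1 | i != k) enorm (v i - v k)) / m`!%:R.

(* Main.v *)
(* Let [p = m - 1]. Look for an apex [x], legs [a_i e_i] along [p] coordinate axes,
   and a last leg [t u + Y v] in the plane of two further axes, with
   [t^2 + Y^2 = r^2], where [r] is such that the product of all the lengths is
   prescribed. Sampling [A] on a fine grid turns this into a counting problem for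
   a subset of positive density of [(Z/N)^n]. Differences [a_i] of two uniform
   points of an interval have a positive definite law, so ignoring the [v]-component
   of the last leg there are many stars. Replacing the indicator [f] of the set in the
   last factor by its average along [v] at a coarse scale makes that component
   harmless; passing from the coarse to a fine scale costs little for one out of
   [Q] scales, by pigeonhole on energies; and below the fine scale Cauchy--Schwarz
   in [t] leaves differences of two arcs [Y(t)], whose heights decrease at a nearly
   constant speed and hence equidistribute. Heights are rounded to the grid, an
   error absorbed by the continuity of translations in measure. All ratios of
   legs are bounded by [Q^(C Q)] with [Q] polynomial in the inverse density. *)
From HB Require Import structures.
Require Import Defs.
From mathcomp Require Import all_boot all_order all_algebra.
From mathcomp Require Import all_classical all_reals all_analysis.
From mathcomp Require Import measurable_realfun ring lra zify.
Import Order.TTheory GRing.Theory Num.Theory.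
Import numFieldNormedType.Exports.
Local Open Scope classical_set_scope.
Local Open Scope ring_scope.
Set Implicit Arguments.
Unset Strict Implicit.
Unset Printing Implicit Defensive.

(** * Averages over finite types *)

Section Averages.
Variable R : realFieldType.

(** The prescribed product couples the last leg to the others: its [v]-component depends on [t] and
    on all the [a_i], so positive definiteness, which treats the legs as independent, cannot reach
    it. Moreover, differences of rounded heights are known only up to 1, so they equidistribute only
    after adding windows of [Q] consecutive integers; the indicator must therefore change little
    under one grid step along [v], which holds once the mesh is fine. How fine depends on the set,
    so the mesh is [h1 / K] with [K] chosen last, and all lengths in grid units carry a factor [K]:
    the bounds on the actual lengths, their product and their ratios are then free of [K]. The
    losses are of order [p / Q] or its square root, against a main term [c] of order [d ^ (p + 2)];
    hence [Q] of order [d ^ (- 2 (p + 2))] suffices. The logarithm of the largest ratio is at most a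
    multiple of [Q ^ 2], and [4 (p + 2) <= 9 (p + 1) ^ 2]. *)

Definition avg (I : finType) (F : I -> R) : R := (\sum_i F i) / #|I|%:R.

Lemma eq_avg (I : finType) (F G : I -> R) : F =1 G -> avg F = avg G.
Proof. by move=> FG; rewrite /avg; congr (_ / _); apply: eq_bigr. Qed.

Lemma avgD (I : finType) (F G : I -> R) :
  avg (fun i => F i + G i) = avg F + avg G.
Proof. by rewrite /avg big_split mulrDl. Qed.

Lemma avgB (I : finType) (F G : I -> R) :
  avg (fun i => F i - G i) = avg F - avg G.
Proof. by rewrite /avg big_split sumrN mulrBl. Qed.

Lemma avgZ (I : finType) (c : R) (F : I -> R) :
  avg (fun i => c * F i) = c * avg F.
Proof. by rewrite /avg -mulr_sumr mulrA. Qed.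

Lemma avg_sum (I J : finType) (F : I -> J -> R) :
  avg (fun i => \sum_j F i j) = \sum_j avg (F ^~ j).
Proof. by rewrite /avg exchange_big /= mulr_suml. Qed.

Lemma exchange_avg (I J : finType) (F : I -> J -> R) :
  avg (fun i => avg (F i)) = avg (fun j => avg (F ^~ j)).
Proof.
by rewrite /avg -!mulr_suml exchange_big /= mulrAC.
Qed.

Lemma avg_pair (I J : finType) (F : I -> J -> R) :
  avg (fun i => avg (F i)) = avg (fun k : I * J => F k.1 k.2).
Proof.
by rewrite /avg -mulr_suml pair_big /= card_prod natrM -mulrA -invfM [X in _ / X]mulrC.
Qed.

Lemma reindex_avg (I : finType) (h : I -> I) (F : I -> R) :
  injective h -> avg (F \o h) = avg F.
Proof. by move=> hI; rewrite /avg [in RHS](reindex_inj hI). Qed.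

Lemma le_avg (I : finType) (F G : I -> R) :
  (forall i, F i <= G i) -> avg F <= avg G.
Proof. by move=> FG; rewrite ler_wpM2r ?invr_ge0// ler_sum. Qed.

Lemma avg_ge0 (I : finType) (F : I -> R) : (forall i, 0 <= F i) -> 0 <= avg F.
Proof. by move=> F0; rewrite divr_ge0// sumr_ge0. Qed.

Lemma avg_cst (I : finType) (c : R) : (0 < #|I|)%N -> avg (fun _ : I => c) = c.
Proof.
by move=> I0; rewrite /avg sumr_const -(mulr_natr c) mulfK// pnatr_eq0 -lt0n.
Qed.

Lemma avg_le_cst (I : finType) (F : I -> R) c :
  0 <= c -> (forall i, F i <= c) -> avg F <= c.
Proof.
move=> c0 Fc; case: (posnP #|I|) => [I0|I0].
  by rewrite /avg I0 invr0 mulr0.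
by rewrite -(avg_cst c I0); exact: le_avg.
Qed.

Lemma ler_norm_avg (I : finType) (F : I -> R) :
  `|avg F| <= avg (fun i => `|F i|).
Proof.
rewrite /avg normrM [X in _ * X]ger0_norm ?invr_ge0//.
by rewrite ler_wpM2r ?invr_ge0// ler_norm_sum.
Qed.

Lemma sqr_avg_le (I : finType) (F : I -> R) :
  avg F ^+ 2 <= avg (fun i => F i ^+ 2).
Proof.
case: (posnP #|I|) => [I0|I0].
  by rewrite /avg I0 invr0 !mulr0 expr0n.
have : 0 <= avg (fun i => (F i - avg F) ^+ 2) by apply: avg_ge0 => i; exact: sqr_ge0.
rewrite (eq_avg (G := fun i => F i ^+ 2 - (2 * avg F * F i - avg F ^+ 2))); last first.
  by move=> i; ring.
rewrite avgB avgB avgZ avg_cst//; nra.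
Qed.

Lemma avg_sqr (I : finType) (F : I -> R) :
  avg F ^+ 2 = avg (fun i => avg (fun j => F i * F j)).
Proof.
rewrite expr2 -avgZ; apply: eq_avg => i.
by rewrite mulrC -avgZ.
Qed.

Lemma avg_prod (I P : finType) (F : I -> P -> R) :
  avg (fun a : {ffun I -> P} => \prod_i F i (a i)) = \prod_i avg (F i).
Proof.
rewrite /avg [in RHS]big_split /= bigA_distr_bigA /=; congr (_ * _).
by rewrite card_ffun natrX prodr_const exprVn.
Qed.

Lemma avg_shift (T : finZmodType) (c : T) (F : T -> R) :
  avg (fun x => F (x + c)) = avg F.
Proof. exact: (reindex_avg F (addIr c)). Qed.

Lemma avg_bool (I : finType) (P : pred I) :
  avg (fun i => (P i)%:R) = #|P|%:R / #|I|%:R.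
Proof.
rewrite /avg -natr_sum -sum1_card [in RHS]big_mkcond /=; congr (_%:R / _).
Qed.

End Averages.

(** * Smoothing on finite abelian groups *)

Section FiniteCore.
Variable R : realType.

(** Convolution with the law of [z p - z q] for independent uniform [p] and [q]. It is an average of
    translations composed with its adjoint, hence a positive semidefinite contraction. *)
Definition smooth (T : zmodType) (P : finType) (z : P -> T) (F : T -> R) (x : T) : R :=
  avg (fun p => avg (fun q => F (x + (z p - z q)))).

Section Smooth.
Variables (T : finZmodType) (P : finType) (z : P -> T).
Hypothesis P0 : (0 < #|P|)%N.

Lemma avgM_smooth (F : T -> R) :
  avg (fun x => F x * smooth z F x) = avg (fun x => avg (fun p => F (x + z p)) ^+ 2).
Proof.
under eq_avg => x do rewrite -avgZ.
under eq_avg => x do under eq_avg => p do rewrite -avgZ.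
under [RHS]eq_avg => x do rewrite avg_sqr exchange_avg.
rewrite exchange_avg [RHS]exchange_avg; apply: eq_avg => p.
rewrite exchange_avg [RHS]exchange_avg; apply: eq_avg => q.
rewrite -[LHS](avg_shift (z q)); apply: eq_avg => x.
by rewrite -addrA [z q + _]addrCA subrr addr0.
Qed.

Lemma sqr_avg_le_avgM_smooth (F : T -> R) :
  avg F ^+ 2 <= avg (fun x => F x * smooth z F x).
Proof.
rewrite avgM_smooth; apply: le_trans (sqr_avg_le _).
rewrite exchange_avg.
by under [X in _ <= X ^+ 2]eq_avg => p do rewrite (avg_shift (z p) F); rewrite avg_cst.
Qed.

(** By [avgM_smooth] the right side is the squared norm of the average of [F] along [z]; the
    smoothing is a further average of translates of that function, which cannot increase the
    norm. *)
Lemma avg_sqr_smooth_le (F : T -> R) :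
  avg (fun x => smooth z F x ^+ 2) <= avg (fun x => F x * smooth z F x).
Proof.
rewrite avgM_smooth /smooth; under eq_avg => x do rewrite exchange_avg.
apply: (@le_trans _ _ (avg (fun x => avg (fun q =>
    avg (fun p => F (x + (z p - z q))) ^+ 2)))).
  by apply: le_avg => x; exact: sqr_avg_le.
rewrite exchange_avg -[X in _ <= X](avg_cst _ P0); apply: le_avg => q.
rewrite -(avg_shift (z q)); apply: le_avg => x.
rewrite le_eqVlt; apply/orP; left; apply/eqP; congr (_ ^+ 2).
by apply: eq_avg => p; rewrite -addrA [z q + _]addrCA subrr addr0.
Qed.

(** In the expanded square, [avg_sqr_smooth_le] turns the cross term into minus twice the energy of
    the smoothing. *)
Lemma avg_sqr_sub_smooth (F : T -> R) :
  avg (fun x => (F x - smooth z F x) ^+ 2) <=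
  avg (fun x => F x ^+ 2) - avg (fun x => smooth z F x ^+ 2).
Proof.
under eq_avg => x do rewrite sqrrB.
rewrite avgD avgB; under [X in _ - X]eq_avg => x do rewrite mulr2n.
rewrite avgD; have := avg_sqr_smooth_le F; lra.
Qed.

End Smooth.

Lemma smooth_ge0 (T : zmodType) (P : finType) (z : P -> T) F x :
  (forall x, 0 <= F x) -> 0 <= smooth z F x.
Proof. by move=> F0; apply: avg_ge0 => p; apply: avg_ge0. Qed.

Lemma smooth_le1 (T : zmodType) (P : finType) (z : P -> T) F x :
  (forall x, F x <= 1) -> smooth z F x <= 1.
Proof. by move=> F0; apply: avg_le_cst => // p; apply: avg_le_cst. Qed.

(* Cauchy--Schwarz makes the kernel "difference of two uniform points of [z]"
   positive definite, so a set cannot see itself with density less than its own. *)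
Lemma low_degree_density (T : finZmodType) (P : finType) (z : P -> T)
    (A B : {set T}) (eta : R) :
  (0 < #|P|)%N -> 0 <= eta -> B \subset A ->
  (forall x, x \in B ->
     smooth z (fun y => (y \in A)%:R) x <= eta) ->
  avg (fun x => (x \in B)%:R : R) <= eta.
Proof.
move=> P0 eta0 /fintype.subsetP BA Beta.
set b := avg _; have b0 : 0 <= b by apply: avg_ge0.
have : b ^+ 2 <= eta * b.
  apply: le_trans (sqr_avg_le_avgM_smooth z P0 _) _.
  rewrite /b -avgZ; apply: le_avg => x; rewrite mulrC.
  case: (boolP (x \in B)) => [xB|]; last by rewrite !mulr0.
  rewrite !mulr1; apply: le_trans (Beta x xB).
  apply: le_avg => p; apply: le_avg => q; rewrite ler_nat.
  by case: (boolP (_ \in B)) => // /BA ->.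
nra.
Qed.

(** Discard the points of [A] where some smoothing is at most [eta = d / (2 #|I|)]. By
    [low_degree_density] each index discards density at most [eta], so density at least [d / 2] is
    left, and there every factor exceeds [eta]. *)
Lemma star_count_ge (T : finZmodType) (I : finType) (P : I -> finType)
    (z : forall i, P i -> T) (A : {set T}) (d : R) :
  (forall i, (0 < #|P i|)%N) -> (0 < #|I|)%N -> 0 <= d ->
  d <= avg (fun x => (x \in A)%:R) ->
  d / 2 * (d / (2 * #|I|%:R)) ^+ #|I| <=
  avg (fun x => (x \in A)%:R *
     \prod_i smooth (z i) (fun y => (y \in A)%:R) x).
Proof.
move=> P0 I0 d0 dA; set eta := d / (2 * _).
have I0' : (0 : R) < #|I|%:R by rewrite ltr0n.
have eta0 : 0 <= eta by rewrite divr_ge0// mulr_ge0// ltW.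
pose D i x := smooth (z i) (fun y => (y \in A)%:R) x.
pose B i := [set x in A | D i x <= eta].
have Beta i : avg (fun x => (x \in B i)%:R : R) <= eta.
  apply: (@low_degree_density _ _ (z i) A) => //.
    by apply/fintype.subsetP => x; rewrite inE => /andP[].
  by move=> x; rewrite inE => /andP[].
have DN i x : 0 <= D i x by exact: smooth_ge0.
have key x : eta ^+ #|I| * ((x \in A)%:R - \sum_i (x \in B i)%:R) <=
             (x \in A)%:R * \prod_i D i x.
  case: (boolP (x \in A)) => [xA|]; last first.
    move=> _; rewrite mul0r sub0r mulrN oppr_le0 mulr_ge0 ?exprn_ge0//.
    by apply: sumr_ge0.
  rewrite mul1r; case: (boolP [exists i, x \in B i]) => [/existsP[i xBi]|].
    apply: (@le_trans _ _ 0); last by apply: prodr_ge0.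
    rewrite mulr_ge0_le0 ?exprn_ge0// (bigD1 i)//= xBi opprD addrA subrr sub0r.
    by rewrite oppr_le0 sumr_ge0.
  rewrite negb_exists => /forallP nB; rewrite big1 ?subr0 ?mulr1; last first.
    by move=> i _; rewrite (negbTE (nB i)).
  rewrite -prodr_const; apply: ler_prod => i _; rewrite eta0/=.
  by have := nB i; rewrite inE xA/= -ltNge => /ltW.
apply: (@le_trans _ _ (avg (fun x => eta ^+ #|I| * ((x \in A)%:R - \sum_i (x \in B i)%:R)))); last first.
  exact: le_avg.
rewrite avgZ mulrC ler_wpM2l ?exprn_ge0// avgB avg_sum.
have : \sum_i avg (fun x => (x \in B i)%:R : R) <= \sum_(i : I) eta by apply: ler_sum.
have -> : \sum_(i : I) eta = d / 2.
  by rewrite sumr_const -(mulr_natr eta) /eta invfM mulrA mulfVK ?gt_eqF.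
lra.
Qed.

Lemma ler_sum_shift (F : int -> R) (L : nat) (k : int) :
  (forall l, 0 <= F l <= 1) ->
  `|\sum_(i < L) F (i%:Z + k) - \sum_(i < L) F i%:Z| <= `|k|%:~R.
Proof.
have nat_case (G : int -> R) (n : nat) : (forall l, 0 <= G l <= 1) ->
    `|\sum_(i < L) G (i%:Z + n%:Z) - \sum_(i < L) G i%:Z| <= n%:R.
  move=> G01; elim: n => [|n IH].
    by under eq_bigr do rewrite addr0; rewrite subrr normr0.
  have step : \sum_(i < L) G (i%:Z + n.+1%:Z) - \sum_(i < L) G (i%:Z + n%:Z) =
      G (L%:Z + n%:Z) - G n%:Z.
    rewrite -sumrB -(big_mkord predT (fun i => G (i%:Z + n.+1%:Z) - G (i%:Z + n%:Z))).
    have E (i : nat) : i%:Z + n.+1%:Z = i.+1%:Z + n%:Z by lia.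
    under eq_bigr => i _ do rewrite E.
    by rewrite (telescope_sumr (fun i : nat => G (i%:Z + n%:Z))) ?add0r.
  have := G01 (L%:Z + n%:Z); have := G01 n%:Z.
  rewrite -natr1; move: IH step; rewrite !ler_norml; lra.
move=> F01; case: (intP k) => [|n|n].
- exact: (nat_case F 0).
- exact: nat_case.
rewrite normrN; have := nat_case (fun l => F (l - n.+1%:Z)) n.+1 (fun l => F01 _).
by rewrite distrC; under [X in _ - X]eq_bigr do rewrite addrK.
Qed.

Lemma ler_avg_shift (F : int -> R) (L : nat) (k : int) :
  (forall l, 0 <= F l <= 1) ->
  `|avg (fun i : 'I_L => F (i%:Z + k)) - avg (fun i : 'I_L => F i%:Z)|
    <= `|k|%:~R / L%:R.
Proof.
move=> F01; rewrite /avg card_ord -mulrBl normrM [X in _ * X]ger0_norm ?invr_ge0//.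
by rewrite ler_wpM2r ?invr_ge0// ler_sum_shift.
Qed.

(** Convolution with the triangular (Fejér) kernel of length [L] along the multiples of [v]. *)
Definition vsmooth (T : zmodType) (v : T) (L : nat) (F : T -> R) : T -> R :=
  smooth (fun i : 'I_L => v *+ i) F.

Lemma vsmooth_shift (T : zmodType) (v : T) (L : nat) (F : T -> R) x (k : int) :
  (forall y, 0 <= F y <= 1) ->
  `|vsmooth v L F (x + v *~ k) - vsmooth v L F x| <= `|k|%:~R / L%:R.
Proof.
move=> F01; rewrite /vsmooth /smooth exchange_avg [X in _ - X]exchange_avg -avgB.
apply: le_trans (ler_norm_avg _) _; apply: avg_le_cst => [|q].
  by rewrite divr_ge0// ler0z.
apply: le_trans (ler_avg_shift L k (fun l => F01 (x - v *+ q + v *~ l))).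
rewrite le_eqVlt; apply/orP; left; apply/eqP; congr (`| _ - _ |).
  by apply: eq_avg => p; congr F; rewrite mulrzDr pmulrn -!addrA; congr (_ + _); rewrite addrC addrCA addrA [v *~ p + _]addrC.
by apply: eq_avg => p; congr F; rewrite pmulrn -!addrA; congr (_ + _); rewrite addrC.
Qed.

Lemma smooth_smooth (T : zmodType) (P S : finType) (z : P -> T) (w : S -> T)
    (F : T -> R) x :
  smooth z (smooth w F) x =
  avg (fun p => avg (fun q => smooth z F (x + (w p - w q)))).
Proof.
rewrite /smooth; under eq_avg => p do rewrite exchange_avg.
rewrite exchange_avg; apply: eq_avg => p'.
under eq_avg => p do rewrite exchange_avg.
rewrite exchange_avg; apply: eq_avg => q'; apply: eq_avg => p; apply: eq_avg => q.
by rewrite addrAC.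
Qed.

Lemma dist_ord (L : nat) (p q : 'I_L) : `|p%:Z - q%:Z| <= L%:Z.
Proof. by have := ltn_ord p; have := ltn_ord q; lia. Qed.

(** The two smoothings commute, so the inner one merely averages translates of [vsmooth v L' F] by
    multiples of [v] up to [L], and [vsmooth_shift] bounds the effect of each. *)
Lemma vsmooth_vsmooth (T : zmodType) (v : T) (L L' : nat) (F : T -> R) x :
  (0 < L)%N -> (forall y, 0 <= F y <= 1) ->
  `|vsmooth v L' (vsmooth v L F) x - vsmooth v L' F x| <= L%:R / L'%:R.
Proof.
move=> L0 F01; rewrite {1}/vsmooth smooth_smooth -/(vsmooth v L' F).
have L0' : (0 < #|'I_L|)%N by rewrite card_ord.
rewrite -[X in _ - X](avg_cst _ L0') -avgB.
apply: le_trans (ler_norm_avg _) _; apply: avg_le_cst => [|p]; first by rewrite divr_ge0.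
rewrite -[X in _ - X](avg_cst _ L0') -avgB.
apply: le_trans (ler_norm_avg _) _; apply: avg_le_cst => [|q]; first by rewrite divr_ge0.
rewrite !pmulrn -mulrzBr; apply: le_trans (vsmooth_shift _ _ _ _ F01) _.
rewrite ler_wpM2r ?invr_ge0// ler_int.
exact: dist_ord.
Qed.

(** The lengths [l j] decrease, so [l j.+1] is the finer scale. The energies lie in [[0, 1]] and
    their [J] increments telescope, so one increment is at most [1 / J]. *)
Lemma energy_pigeonhole (T : finZmodType) (v : T) (F : T -> R) (l : nat -> nat)
    (J : nat) (mu s : R) :
  (0 < J)%N -> (forall x, 0 <= F x <= 1) ->
  (forall j, 0 < l j)%N -> (forall j, (j < J)%N -> (l j.+1)%:R <= mu * (l j)%:R) ->
  0 <= s -> J%:R^-1 + 2 * mu <= s ^+ 2 ->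
  exists2 j, (j < J)%N &
    avg (fun x => `|vsmooth v (l j.+1) F x - vsmooth v (l j) F x|) <= s + mu.
Proof.
move=> J0 F01 l0 lmu s0 hs.
pose E j := avg (fun x => vsmooth v (l j) F x ^+ 2).
have T0 : (0 < #|T|)%N by apply/card_gt0P; exists 0.
have S01 j x : 0 <= vsmooth v (l j) F x <= 1.
  by apply/andP; split; [apply: smooth_ge0|apply: smooth_le1] => y; case/andP: (F01 y).
have E01 j : 0 <= E j <= 1.
  apply/andP; split; first by apply: avg_ge0 => x; exact: sqr_ge0.
  by apply: avg_le_cst => // x; rewrite expr_le1//; case/andP: (S01 j x).
have [j jJ Ej] : exists2 j, (j < J)%N & E j.+1 - E j <= J%:R^-1.
  apply: contrapT => H.
  have {}H j : (j < J)%N -> J%:R^-1 < E j.+1 - E j.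
    by move=> jJ; rewrite ltNge; apply/negP => le; apply: H; exists j.
  have : \sum_(i < J) J%:R^-1 < \sum_(i < J) (E i.+1 - E i).
    by apply: ltr_sum => [|i _]; [apply/hasP; exists (Ordinal J0); rewrite ?mem_index_enum|exact: H].
  rewrite -(big_mkord predT (fun i => E i.+1 - E i)) telescope_sumr//.
  rewrite sumr_const card_ord -(mulr_natr J%:R^-1) mulVf ?pnatr_eq0 -?lt0n//.
  have := E01 J; have := E01 0; lra.
exists j => //.
set g2 := vsmooth v (l j.+1) F; set g1 := vsmooth v (l j) F.
(* [g], the coarse smoothing of the fine function, mediates: it is uniformly within [mu] of [g1],
   and [avg_sqr_sub_smooth] bounds its distance to [g2] by a difference of energies. *)
pose g := vsmooth v (l j) g2.
have mu_ge x : `|g x - g1 x| <= mu.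
  apply: le_trans (vsmooth_vsmooth _ _ _ _ _) _ => //.
  by rewrite ler_pdivrMr ?ltr0n// lmu.
have mu0 : 0 <= mu by apply: le_trans (mu_ge 0).
have g01 x : 0 <= g x <= 1.
  by apply/andP; split; [apply: smooth_ge0|apply: smooth_le1] => y; case/andP: (S01 j.+1 y).
have Eg : E j - 2 * mu <= avg (fun x => g x ^+ 2).
  rewrite lerBlDr -[2 * mu](avg_cst _ T0) -avgD; apply: le_avg => x.
  have := mu_ge x; have := g01 x; have := S01 j x; rewrite -/(g1 x) ler_norml.
  move: (g x) (g1 x) => a b; nra.
have key : avg (fun x => (g2 x - g x) ^+ 2) <= s ^+ 2.
  apply: le_trans (avg_sqr_sub_smooth _ _ _) _; first by rewrite card_ord.
  rewrite -/(E j.+1) -/g; lra.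
have key2 : avg (fun x => `|g2 x - g x|) <= s.
  rewrite -ler_sqr ?nnegrE//; last by apply: avg_ge0.
  apply: le_trans (sqr_avg_le _) _; apply: le_trans key; apply: le_avg => x.
  by rewrite real_normK ?num_real.
apply: (@le_trans _ _ (avg (fun x => `|g2 x - g x| + mu))).
  apply: le_avg => x; rewrite -[g2 x - g1 x](subrKA (g x)).
  by apply: le_trans (ler_normD _ _) _; rewrite lerD2l.
by rewrite avgD avg_cst// lerD2r.
Qed.

Lemma card_le_diameter (W k : nat) (S : {set 'I_W}) :
  (forall i j, i \in S -> j \in S -> (j <= i + k)%N) -> (#|S| <= k.+1)%N.
Proof.
move=> hS; case: (set_0Vmem S) => [->|[x xS]]; first by rewrite cards0.
have [i0 i0S i0min] := arg_minnP (fun i : 'I_W => i : nat) xS.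
have {}i0min j : j \in S -> (i0 <= j <= i0 + k)%N.
  by move=> jS; rewrite hS// andbT; exact: i0min.
rewrite -[X in (_ <= X)%N]card_ord -(card_in_imset (f := fun i : 'I_W => inord (i - i0) : 'I_k.+1)).
  exact: max_card.
move=> i j /i0min/andP[i1 i2] /i0min/andP[j1 j2] /(congr1 val) /=.
by rewrite !inordK; [move=> ?; apply: val_inj => /=; lia|lia|lia].
Qed.

(* The values [psi i + c] are counted by [N s]; the upper bound [N s <= U] and
   the total mass [b * W] alone force [N] to be nearly constant. *)
Lemma equidistribution (b W : nat) (psi : nat -> int) (y : nat -> R) (c1 c2 : R) :
  (0 < b)%N -> (0 < W)%N -> 0 < c1 -> 0 <= c2 ->
  (forall i, (i < W)%N -> `|(psi i)%:~R - y i| <= 1) ->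
  (forall i, (i.+1 < W)%N -> c1 <= y i - y i.+1 <= c2) ->
  exists (l0 : int) (n : nat), n%:R <= c2 * W%:R + b%:R + 4 /\
  forall F : int -> R, (forall l, 0 <= F l <= 1) ->
    `| avg (fun i : 'I_W => avg (fun c : 'I_b => F (psi i + c%:Z))) -
       ((b%:R + 1) / c1 + 1) / (b%:R * W%:R) * \sum_(s < n) F (s%:Z + l0) |
    <= n%:R * ((b%:R + 1) / c1 + 1) / (b%:R * W%:R) - 1.
Proof.
move=> b0 W0 c10 c20 psiy ystep; set U := _ / c1 + 1.
(* [y] drops by at most [c2 * W] in all, and [psi] is within 1 of [y], so all values [psi i + c]
   fall among the [n] integers from [l0] on. *)
exists (Num.floor (y 0%N - c2 * W%:R - 1)), (Num.truncn (c2 * W%:R + b%:R + 2)).+1.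
set l0 := Num.floor _; set n := _.+1.
have ymono i k : (i + k < W)%N -> c1 * k%:R <= y i - y (i + k)%N <= c2 * k%:R.
  elim: k => [|k IH]; first by rewrite addn0 subrr !mulr0 lexx.
  rewrite addnS => ikW; have := ystep _ ikW; have := IH (ltnW ikW).
  rewrite -natr1; lra.
have X0 : 0 <= c2 * W%:R + b%:R + 2 by rewrite !addr_ge0// mulr_ge0.
split.
  by have /andP[+ _] := truncn_itv X0; rewrite /n -natr1; lra.
have b0' : 0 < b%:R :> R by rewrite ltr0n.
have W0' : 0 < W%:R :> R by rewrite ltr0n.
have psi_ge i : (i < W)%N -> l0 <= psi i.
  move=> iW; rewrite -ltzD1 -(ltr_int R).
  have := ymono 0%N i iW; have := psiy _ iW; rewrite add0n ler_norml.
  have : c2 * i%:R <= c2 * W%:R by rewrite ler_wpM2l// ler_nat ltnW.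
  have := floor_le (y 0%N - c2 * W%:R - 1); rewrite -/l0 intrD; lra.
have psi_lt i c : (i < W)%N -> (c < b)%N -> psi i + c%:Z < l0 + n%:Z.
  move=> iW cb; rewrite -(ltr_int R) !intrD.
  have := ymono 0%N i iW; have := psiy _ iW; rewrite add0n ler_norml.
  have : 0 <= c1 * i%:R by rewrite mulr_ge0// ltW.
  have /andP[_] := floor_itv (y 0%N - c2 * W%:R - 1); rewrite -/l0 intrD.
  have /andP[_] := truncn_itv X0; rewrite -/n.
  have : c.+1%:R <= b%:R :> R by rewrite ler_nat.
  rewrite -natr1 -!pmulrn; lra.
pose N (s : 'I_n) : R := \sum_(i < W) \sum_(c < b) (psi i + c%:Z == s%:Z + l0)%:R.
have sumN (F : int -> R) : \sum_(i < W) \sum_(c < b) F (psi i + c%:Z) =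
    \sum_(s < n) N s * F (s%:Z + l0).
  under [RHS]eq_bigr => s _ do rewrite /N mulr_suml.
  rewrite [RHS]exchange_big /=; apply: eq_bigr => i _.
  under [RHS]eq_bigr => s _ do rewrite mulr_suml.
  rewrite [RHS]exchange_big /=; apply: eq_bigr => c _.
  have := psi_ge i (ltn_ord i); have := psi_lt i c (ltn_ord i) (ltn_ord c) => lt1 ge1.
  have sn : (absz (psi i + c%:Z - l0)%R < n)%N by lia.
  rewrite (bigD1 (Ordinal sn))//= big1 ?addr0 => [|s].
    have -> : (absz (psi i + c%:Z - l0)%R)%:Z + l0 = psi i + c%:Z by lia.
    by rewrite eqxx mul1r.
  rewrite -val_eqE /= => /eqP ns; case: eqP => [e|]; last by rewrite mul0r.
  by exfalso; apply: ns; lia.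
(* Each [i] hits [s] for at most one [c]. If [i < j] both hit [s], then [psi i - psi j <= b - 1], so
   [y i - y j <= b + 1]; it is also at least [c1 * (j - i)]. *)
have N_le s : N s <= U.
  pose S := [set i : 'I_W | [exists c : 'I_b, psi i + c%:Z == s%:Z + l0]]%SET.
  have NS : N s <= #|S|%:R.
    rewrite -sum1_card natr_sum big_mkcond /=; apply: ler_sum => i _.
    case: ifPn => [|iS].
      rewrite inE => /existsP[c0 /eqP hc]; rewrite (bigD1 c0)//= hc eqxx big1 ?addr0//.
      move=> c; rewrite -val_eqE /= => /eqP nc; case: eqP => // h.
      by exfalso; apply: nc; lia.
    rewrite big1// => c _; case: eqP => // h.
    by exfalso; move/negP: iS; apply; rewrite inE; apply/existsP; exists c; apply/eqP.
  apply: le_trans NS _.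
  have Z0 : 0 <= (b%:R + 1) / c1 by rewrite divr_ge0 ?addr_ge0// ltW.
  have /andP[tr _] := truncn_itv Z0.
  apply: (@le_trans _ _ (Num.truncn ((b%:R + 1) / c1)).+1%:R); last by rewrite -natr1 lerD2r.
  rewrite ler_nat; apply: card_le_diameter => i j.
  rewrite !inE => /existsP[ci /eqP hi] /existsP[cj /eqP hj].
  case: (leqP j i) => [ji|ij]; first exact: leq_trans ji (leq_addr _ _).
  rewrite -leq_subLR truncn_ge_nat// ler_pdivlMr// mulrC.
  have ijW : (i + (j - i) < W)%N by rewrite subnKC ?ltn_ord// ltnW.
  have := ymono i (j - i)%N ijW; rewrite subnKC ?(ltnW ij)//.
  have := psiy i (ltn_ord i); have := psiy j (ltn_ord j); rewrite !ler_norml.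
  have : psi i - psi j <= b%:Z - 1 by have := ltn_ord ci; have := ltn_ord cj; lia.
  rewrite -(ler_int R) !intrB -!pmulrn; lra.
have totN : \sum_(s < n) N s = b%:R * W%:R.
  have := sumN (fun _ => 1); under [X in _ = X -> _]eq_bigr do rewrite mulr1.
  move=> <-; under eq_bigr do rewrite sumr_const card_ord.
  by rewrite sumr_const card_ord -mulrnA natrM.
move=> F F01.
have -> : avg (fun i : 'I_W => avg (fun c : 'I_b => F (psi i + c%:Z))) =
    (\sum_(s < n) N s * F (s%:Z + l0)) / (b%:R * W%:R).
  by rewrite -sumN /avg !card_ord -mulr_suml -mulrA -invfM.
rewrite mulrAC -mulrBl mulr_sumr -sumrB normrM [X in _ * X]ger0_norm; last first.
  by rewrite invr_ge0 mulr_ge0// ltW.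
rewrite ler_pdivrMr ?mulr_gt0// mulrBl mul1r mulfVK ?mulf_neq0 ?gt_eqF//.
apply: le_trans (ler_norm_sum _ _ _) _.
(* As [N s] never exceeds [U], the sum of the deviations is exactly [n * U - b * W], and a weight in
   [[0, 1]] only lowers it. *)
have -> : n%:R * U = \sum_(s < n) U by rewrite sumr_const card_ord mulr_natl.
rewrite -totN -sumrB.
apply: ler_sum => s _; rewrite -mulrBl normrM ler0_norm ?subr_le0// opprB.
by case/andP: (F01 (s%:Z + l0)) => F0 F1; rewrite ger0_norm// ler_piMr// subr_ge0.
Qed.

(** By [equidistribution] each average is within [5 * rho] of [U / (b * W)] times a sum of [F] over
    [n] consecutive integers. These two intervals differ by the shift [k], which costs at most
    [2 * rho]. *)
Lemma window_shift (b W : nat) (psi : nat -> int) (y : nat -> R) (c1 c2 rho : R)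
    (F : int -> R) (k : int) :
  (0 < b)%N -> (0 < W)%N -> 0 < c1 <= 1 -> 0 <= c2 <= (1 + rho) * c1 ->
  0 <= rho <= 1 -> 2 <= rho * b%:R -> b%:R + 4 <= rho * (c1 * W%:R) ->
  `|k|%:~R <= rho * (c1 * W%:R) ->
  (forall i, (i < W)%N -> `|(psi i)%:~R - y i| <= 1) ->
  (forall i, (i.+1 < W)%N -> c1 <= y i - y i.+1 <= c2) ->
  (forall l, 0 <= F l <= 1) ->
  `| avg (fun i : 'I_W => avg (fun c : 'I_b => F (psi i + c%:Z))) -
     avg (fun i : 'I_W => avg (fun c : 'I_b => F (psi i + k + c%:Z))) | <= 12 * rho.
Proof.
move=> b0 W0 /andP[c10 c11] /andP[c20 c2le] /andP[rho0 rho1] b2 bW kW psiy ystep F01.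
have [l0 [n [nle eqd]]] := equidistribution b0 W0 c10 c20 psiy ystep.
have := eqd F F01; have := eqd (fun l => F (l + k)) (fun l => F01 _).
have := ler_sum_shift n k (fun l => F01 (l + l0)).
have -> : avg (fun i : 'I_W => avg (fun c : 'I_b => F (psi i + k + c%:Z))) =
   avg (fun i : 'I_W => avg (fun c : 'I_b => F (psi i + c%:Z + k))).
  by apply: eq_avg => i; apply: eq_avg => c; rewrite addrAC.
have -> : \sum_(i < n) F (i%:Z + k + l0) = \sum_(s < n) F (s%:Z + l0 + k).
  by apply: eq_bigr => i _; rewrite addrAC.
set S1 := \sum_(i < n) _; set S2 := \sum_(i < n) _.
set A1 := avg _; set A2 := avg _.
have b0' : 0 < b%:R :> R by rewrite ltr0n.
have W0' : 0 < W%:R :> R by rewrite ltr0n.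
set U := _ / c1 + 1; set D := b%:R * W%:R.
have D0 : 0 < D by rewrite mulr_gt0.
have Uc : U * c1 <= (1 + rho) * b%:R.
  rewrite /U mulrDl mulfVK ?gt_eqF//; lra.
have U0 : 0 < U by rewrite addr_gt0// divr_gt0// addr_gt0.
have nU : n%:R * U / D <= 1 + 5 * rho.
  rewrite ler_pdivrMr//.
  have h1 : n%:R <= (1 + 2 * rho) * (c1 * W%:R).
    apply: le_trans nle _; rewrite -addrA.
    have : c2 * W%:R <= (1 + rho) * c1 * W%:R by rewrite ler_wpM2r// ltW.
    lra.
  apply: (@le_trans _ _ ((1 + 2 * rho) * (c1 * W%:R) * U)).
    by rewrite ler_wpM2r// ltW.
  have -> : (1 + 2 * rho) * (c1 * W%:R) * U = (1 + 2 * rho) * W%:R * (U * c1) by ring.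
  apply: (@le_trans _ _ ((1 + 2 * rho) * W%:R * ((1 + rho) * b%:R))).
    by rewrite ler_wpM2l// mulr_ge0 ?ltW//; lra.
  have -> : (1 + 2 * rho) * W%:R * ((1 + rho) * b%:R) = (1 + 3 * rho + 2 * rho ^+ 2) * D.
    by rewrite /D; ring.
  rewrite ler_wpM2r ?(ltW D0)//; nra.
have kU : U / D * `|k|%:~R <= 2 * rho.
  rewrite mulrAC ler_pdivrMr//.
  apply: (@le_trans _ _ (U * (rho * (c1 * W%:R)))); first by rewrite ler_wpM2l// ltW.
  have -> : U * (rho * (c1 * W%:R)) = rho * W%:R * (U * c1) by ring.
  apply: (@le_trans _ _ (rho * W%:R * ((1 + rho) * b%:R))).
    by rewrite ler_wpM2l// mulr_ge0 // ltW.
  have -> : rho * W%:R * ((1 + rho) * b%:R) = (rho + rho ^+ 2) * D by rewrite /D; ring.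
  rewrite ler_wpM2r ?(ltW D0)//; nra.
move=> h1 h2 h3.
have h4 : `|U / D * (S2 - S1)| <= 2 * rho.
  have UD0 : 0 <= U / D by rewrite divr_ge0 ?(ltW U0) ?(ltW D0).
  by apply: le_trans kU; rewrite normrM [X in X * _]ger0_norm// ler_wpM2l// distrC.
move: h2 h3 h4; rewrite mulrBr !ler_norml.
move: (U / D * S1) (U / D * S2) => a1 a2; lra.
Qed.

Lemma avg_norm_shift (T : finZmodType) (v : T) (f : T -> R) (kappa : R) (c : nat) :
  avg (fun x => `|f (x + v) - f x|) <= kappa ->
  avg (fun x => `|f (x + v *+ c) - f x|) <= c%:R * kappa.
Proof.
move=> fk; elim: c => [|c IH].
  rewrite mul0r le_eqVlt; apply/orP; left; apply/eqP.
  by under eq_avg do rewrite mulr0n addr0 subrr normr0; rewrite /avg big1// mul0r.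
rewrite -natr1 mulrDl mul1r; apply: le_trans (lerD IH fk).
rewrite -[X in _ <= _ + X](avg_shift (v *+ c)) -avgD; apply: le_avg => x.
rewrite mulrSr addrA [X in _ <= X]addrC.
by rewrite -[X in `|X| <= _](subrKA (f (x + v *+ c))) ler_normD.
Qed.

(** Replacing [f] by its average [M] over [b] steps along [v] costs [b * kappa], once for each of
    two terms. For [M], [window_shift] shows that the average along [psi] hardly changes under
    shifts by at most [L] steps, and [vsmooth v L] is an average of such shifts. *)
Lemma smooth_error_le (T : finZmodType) (v : T) (f : T -> R) (kappa : R)
    (b W L : nat) (psi : nat -> int) (y : nat -> R) (c1 c2 rho : R) :
  (0 < L)%N -> (forall x, 0 <= f x <= 1) ->
  avg (fun x => `|f (x + v) - f x|) <= kappa ->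
  (0 < b)%N -> (0 < W)%N -> 0 < c1 <= 1 -> 0 <= c2 <= (1 + rho) * c1 ->
  0 <= rho <= 1 -> 2 <= rho * b%:R -> b%:R + 4 <= rho * (c1 * W%:R) ->
  L%:R <= rho * (c1 * W%:R) ->
  (forall i, (i < W)%N -> `|(psi i)%:~R - y i| <= 1) ->
  (forall i, (i.+1 < W)%N -> c1 <= y i - y i.+1 <= c2) ->
  avg (fun x => `|avg (fun i : 'I_W =>
     f (x + v *~ psi i) - vsmooth v L f (x + v *~ psi i))|)
  <= 2 * (b%:R * kappa) + 12 * rho.
Proof.
move=> L0 f01 fk b0 W0 c1h c2h rhoh b2 bW LW psiy ystep.
have T0 : (0 < #|T|)%N by apply/card_gt0P; exists 0.
have W0' : (0 < #|'I_W|)%N by rewrite card_ord.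
have b0' : (0 < #|'I_b|)%N by rewrite card_ord.
have L0' : (0 < #|'I_L|)%N by rewrite card_ord.
have k0 : 0 <= kappa by apply: le_trans fk; apply: avg_ge0.
pose M x := avg (fun c : 'I_b => f (x + v *+ c)).
have fM : avg (fun x => `|f x - M x|) <= b%:R * kappa.
  apply: (@le_trans _ _ (avg (fun x => avg (fun c : 'I_b => `|f (x + v *+ c) - f x|)))).
    apply: le_avg => x; rewrite distrC -[X in `|_ - X| <= _](avg_cst _ b0') -avgB; exact: ler_norm_avg.
  rewrite exchange_avg; apply: avg_le_cst => [|c]; first by rewrite mulr_ge0.
  by apply: le_trans (avg_norm_shift c fk) _; rewrite ler_wpM2r// ler_nat ltnW.
have fMpsi (g : nat -> int) : avg (fun x => `|avg (fun i : 'I_W =>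
    f (x + v *~ g i) - M (x + v *~ g i))|) <= b%:R * kappa.
  apply: (@le_trans _ _ (avg (fun x => avg (fun i : 'I_W =>
      `|f (x + v *~ g i) - M (x + v *~ g i)|)))).
    by apply: le_avg => x; exact: ler_norm_avg.
  rewrite exchange_avg; apply: avg_le_cst => [|i]; first by rewrite mulr_ge0.
  by rewrite (avg_shift (v *~ g i) (fun x => `|f x - M x|)).
have shift (k : int) : `|k|%:~R <= L%:R :> R ->
    avg (fun x => `|avg (fun i : 'I_W => f (x + v *~ psi i) - f (x + v *~ (psi i + k)))|)
    <= 2 * (b%:R * kappa) + 12 * rho.
  move=> kL.
  have Mk x : `|avg (fun i : 'I_W => M (x + v *~ psi i) - M (x + v *~ (psi i + k)))| <= 12 * rho.
    rewrite avgB.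
    have := window_shift b0 W0 c1h c2h rhoh b2 bW (le_trans kL LW) psiy ystep
      (fun l => f01 (x + v *~ l)).
    congr (`| _ - _ | <= _); apply: eq_avg => i; apply: eq_avg => c; congr f.
      by rewrite mulrzDr addrA pmulrn.
    by rewrite [in LHS]mulrzDr addrA pmulrn.
  apply: (@le_trans _ _ (avg (fun x =>
      `|avg (fun i : 'I_W => f (x + v *~ psi i) - M (x + v *~ psi i))| +
      `|avg (fun i : 'I_W => f (x + v *~ (psi i + k)) - M (x + v *~ (psi i + k)))| + 12 * rho))).
    apply: le_avg => x; have := Mk x; rewrite !avgB.
    set a1 := avg _; set a2 := avg _; set a3 := avg _; set a4 := avg _ => h.
    have -> : a3 - a4 = (a3 - a1) - (a4 - a2) + (a1 - a2) by ring.
    by apply: le_trans (ler_normD _ _) (lerD _ h); exact: ler_normB.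
  rewrite !avgD avg_cst// lerD2r mulr2n mulrDl mul1r.
  exact: lerD (fMpsi _) (fMpsi (fun i => psi i + k)).
pose H x p q := avg (fun i : 'I_W =>
  f (x + v *~ psi i) - f (x + v *~ (psi i + (p%:Z - q%:Z)))).
have -> : (fun x => `|avg (fun i : 'I_W =>
     f (x + v *~ psi i) - vsmooth v L f (x + v *~ psi i))|) =
   (fun x => `|avg (fun p : 'I_L => avg (fun q : 'I_L => H x p q))|).
  apply: funext => x; congr (`| _ |); rewrite /H /vsmooth /smooth.
  under [RHS]eq_avg => p do rewrite exchange_avg.
  rewrite [RHS]exchange_avg; apply: eq_avg => i.
  rewrite -[X in X - _ = _](avg_cst _ L0') -avgB; apply: eq_avg => p.
  rewrite -[X in X - _ = _](avg_cst _ L0') -avgB; apply: eq_avg => q.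
  by rewrite !mulrzDr mulrNz -!addrA !pmulrn.
have e0 : 0 <= 2 * (b%:R * kappa) + 12 * rho.
  by rewrite addr_ge0// mulr_ge0// ?mulr_ge0//; case/andP: rhoh.
apply: (@le_trans _ _ (avg (fun x => avg (fun p : 'I_L => avg (fun q : 'I_L => `|H x p q|))))).
  apply: le_avg => x; apply: le_trans (ler_norm_avg _) _; apply: le_avg => p.
  exact: ler_norm_avg.
rewrite exchange_avg; apply: avg_le_cst => // p.
rewrite exchange_avg; apply: avg_le_cst => // q.
apply: shift; rewrite (_ : L%:R = L%:~R :> R) ?pmulrn// ler_int.
exact: dist_ord.
Qed.

(** * Circular arcs *)

Definition arc (r s : R) : R := Num.sqrt (r ^+ 2 - s ^+ 2).

Lemma sqr_arc (r s : R) : `|s| <= r -> arc r s ^+ 2 = r ^+ 2 - s ^+ 2.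
Proof.
move=> sr; rewrite sqr_sqrtr// subr_ge0 -(real_normK (num_real s)).
by rewrite lerXn2r// nnegrE// (le_trans _ sr).
Qed.

Lemma arc_bounds (r s : R) : 0 < r -> `|s| <= r / 4 -> 9 / 10 * r <= arc r s <= r.
Proof.
move=> r0 sr; have sr' : `|s| <= r by apply: le_trans sr _; lra.
have := sqr_arc sr'; have : 0 <= arc r s by exact: sqrtr_ge0.
move: sr; rewrite ler_norml; move: (arc r s) => Y sr Y0 Y2; apply/andP; split; nra.
Qed.

(** The heights [A], [B] satisfy [(A - B) * (A + B) = (b - a) * (a + b)], where [A + B >= 9 / 5 * r]
    and [|a + b| <= r / 2]. *)
Lemma arc_lipschitz (r a b : R) : 0 < r -> `|a| <= r / 4 -> `|b| <= r / 4 -> a <= b ->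
  `|arc r a - arc r b| <= 3 / 10 * (b - a).
Proof.
move=> r0 ar br ab; have := arc_bounds r0 ar; have := arc_bounds r0 br.
have := @sqr_arc r a; have := @sqr_arc r b.
move=> /(_ (le_trans br _)) -/(_ ltac:(lra)) Hb /(_ (le_trans ar _)) -/(_ ltac:(lra)) Ha.
move: ar br Ha Hb; rewrite !ler_norml; move: (arc r a) (arc r b) => A B ar br Ha Hb hB hA.
have e : (A - B) * (A + B) = (b - a) * (a + b).
  by transitivity (A ^+ 2 - B ^+ 2); [ring|rewrite Ha Hb; ring].
have up : (b - a) * (a + b) <= (b - a) * (r / 2) by rewrite ler_wpM2l; lra.
have lo : - ((b - a) * (r / 2)) <= (b - a) * (a + b) by rewrite -mulrN ler_wpM2l; lra.
apply/andP; split.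
- rewrite leNgt; apply/negP => h.
  have : (A - B) * (A + B) < - (3 / 10 * (b - a)) * (A + B) by rewrite ltr_pM2r//; lra.
  have : - (3 / 10 * (b - a)) * (A + B) <= - (3 / 10 * (b - a)) * (9 / 5 * r).
    by rewrite ler_wnM2l; lra.
  have : 0 <= (b - a) * r by rewrite mulr_ge0; lra.
  lra.
- rewrite leNgt; apply/negP => h.
  have : (3 / 10 * (b - a)) * (A + B) < (A - B) * (A + B) by rewrite ltr_pM2r//; lra.
  have : (3 / 10 * (b - a)) * (9 / 5 * r) <= (3 / 10 * (b - a)) * (A + B).
    by rewrite ler_wpM2l; lra.
  have : 0 <= (b - a) * r by rewrite mulr_ge0; lra.
  lra.
Qed.

(** The second difference of an arc of radius [r] is of order [1 / r]. The lower bound keeps the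
    slope of a difference of two arcs away from 0; the upper bound makes that slope nearly constant
    on short ranges. *)
Lemma arc_drop_bounds (r a b : R) : 0 < r -> - (r / 4) <= a -> a <= b -> b + 1 <= r / 4 ->
  (b - a) / (2 * r) <=
    (arc r b - arc r (b + 1)) - (arc r a - arc r (a + 1)) <= 2 * (b - a) / r.
Proof.
move=> r0 ra ab br.
have ha : `|a| <= r / 4 by rewrite ler_norml; lra.
have ha1 : `|a + 1| <= r / 4 by rewrite ler_norml; lra.
have hb : `|b| <= r / 4 by rewrite ler_norml; lra.
have hb1 : `|b + 1| <= r / 4 by rewrite ler_norml; lra.
have := arc_lipschitz r0 ha hb ab.
have := arc_lipschitz r0 ha1 hb1 ltac:(lra).
have := arc_lipschitz r0 ha ha1 ltac:(lra).
have := arc_bounds r0 hb; have := arc_bounds r0 hb1.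
have r4 : r / 4 <= r by lra.
have := sqr_arc (le_trans ha r4); have := sqr_arc (le_trans ha1 r4).
have := sqr_arc (le_trans hb r4); have := sqr_arc (le_trans hb1 r4).
move: (arc r a) (arc r b) (arc r (a + 1)) (arc r (b + 1)) => A B A1 B1.
move=> qB1 qB qA1 qA bB1 bB; rewrite !ler_norml => lA lA1 lB.
have eA : (A - A1) * (A + A1) = 2 * a + 1.
  by transitivity (A ^+ 2 - A1 ^+ 2); [ring|rewrite qA qA1; ring].
have eB : (B - B1) * (B + B1) = 2 * b + 1.
  by transitivity (B ^+ 2 - B1 ^+ 2); [ring|rewrite qB qB1; ring].
set X := (B - B1) - (A - A1).
(* The unit drops satisfy [(A - A1) * (A + A1) = 2 * a + 1], and likewise at [b]. Subtracting leaves
   [2 * (b - a)] and a correction that [arc_lipschitz] bounds by [0.18 * (b - a)]. *)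
have key : X * (B + B1) = 2 * (b - a) - (A - A1) * ((B + B1) - (A + A1)).
  transitivity ((B - B1) * (B + B1) - (A - A1) * (A + A1)
                - (A - A1) * ((B + B1) - (A + A1))); first by rewrite /X; ring.
  by rewrite eB eA; ring.
have small : `|(A - A1) * ((B + B1) - (A + A1))| <= 3 / 10 * (6 / 10 * (b - a)).
  by rewrite normrM; apply: ler_pM => //; rewrite ler_norml; lra.
move: small; rewrite ler_norml => small.
rewrite ler_pdivrMr ?ler_pdivlMr//; last by lra.
have X0 : 0 <= X.
  have : 0 <= X * (B + B1) by rewrite key; lra.
  by rewrite pmulr_lge0//; lra.
have : X * (9 / 5 * r) <= X * (B + B1) by rewrite ler_wpM2l//; lra.
have : X * (B + B1) <= X * (2 * r) by rewrite ler_wpM2l//; lra.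
lra.
Qed.

End FiniteCore.

(** * Counting stars on one scale and on several scales *)

Section OneScale.
Variable R : realType.

(** The step [y i - y i.+1] is the unit drop of the arc at [s2 + i] minus that at [s1 + i]. At
    [i = 0] it is at least [Xi / (2 * r)], and over the range [W] it changes by at most [2 * W / r],
    which the hypothesis on [16 * W] makes relatively small. *)
Lemma arc_smooth_error (T : finZmodType) (v : T) (f : T -> R) (kappa : R)
    (b W L Xi : nat) (r rho : R) (s1 s2 : int) :
  (0 < L)%N -> (forall x, 0 <= f x <= 1) ->
  avg (fun x => `|f (x + v) - f x|) <= kappa ->
  (0 < b)%N -> (0 < W)%N -> (0 < Xi)%N -> 0 <= rho <= 1 -> 2 <= rho * b%:R ->
  (b + 4 <= L)%N -> 0 < r ->
  16 * W%:R <= rho * Xi%:R -> 4 * r * L%:R <= rho * (Xi%:R * W%:R) ->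
  - (r / 4) <= s1%:~R -> s1 + Xi%:Z <= s2 -> (s2 + W%:Z)%:~R + 1 <= r / 4 ->
  avg (fun x => `|avg (fun i : 'I_W =>
     let psi := Num.floor (arc r (s2 + i%:Z)%:~R) - Num.floor (arc r (s1 + i%:Z)%:~R) in
     f (x + v *~ psi) - vsmooth v L f (x + v *~ psi))|)
  <= 2 * (b%:R * kappa) + 12 * rho.
Proof.
move=> L0 f01 fk b0 W0 Xi0 rhoh b2 bL r0 WXi LXi s1r s12 s2r.
pose E (s : R) := arc r s - arc r (s + 1).
pose s (k : int) (i : nat) : R := (k + i%:Z)%:~R.
have sE k i : s k i = k%:~R + i%:R by rewrite /s intrD.
have s12' : s1%:~R + Xi%:R <= s2%:~R :> R by rewrite -[Xi%:R]/(Xi%:~R) -intrD ler_int.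
have Xi0' : 0 < Xi%:R :> R by rewrite ltr0n.
have W0' : 0 < W%:R :> R by rewrite ltr0n.
have s2r' : s2%:~R + W%:R + 1 <= r / 4 by move: s2r; rewrite intrD.
have /andP[rho0 rho1] := rhoh.
have drop p q : - (r / 4) <= p -> p <= q -> q + 1 <= r / 4 ->
    (q - p) / (2 * r) <= E q - E p <= 2 * (q - p) / r by exact: arc_drop_bounds.
pose e0 := E s2%:~R - E s1%:~R.
pose c1 := e0 - 2 * W%:R / r; pose c2 := e0 + 2 * W%:R / r.
have e0b : Xi%:R / (2 * r) <= e0 <= 1.
  have := drop s1%:~R s2%:~R s1r ltac:(lra) ltac:(lra); rewrite -/e0 => /andP[h1 h2].
  apply/andP; split.
    apply: le_trans h1; rewrite ler_wpM2r ?invr_ge0//; lra.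
  apply: le_trans h2 _; rewrite ler_pdivrMr//; lra.
have WXi8 : 2 * W%:R / r <= Xi%:R / (8 * r).
  rewrite ler_pdivlMr; last by lra.
  rewrite mulrAC ler_pdivrMr//.
  have : rho * Xi%:R <= Xi%:R by rewrite ler_piMl// ltW.
  nra.
have Xir : Xi%:R / (2 * r) = 4 * (Xi%:R / (8 * r)).
  by field; rewrite gt_eqF.
have Xi8 : 0 < Xi%:R / (8 * r) by rewrite divr_gt0//; lra.
have c1b : 0 < c1 <= 1.
  have : 0 <= 2 * W%:R / r by rewrite divr_ge0 ?(ltW r0)// mulr_ge0.
  by rewrite /c1; lra.
have c1lo : 2 * (Xi%:R / (8 * r)) <= c1 by rewrite /c1; lra.
have Wr0 : 0 <= 2 * W%:R / r by rewrite divr_ge0 ?(ltW r0)// mulr_ge0.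
have c2b : 0 <= c2 <= (1 + rho) * c1.
  apply/andP; split; first by rewrite /c2; lra.
  have : 2 * (2 * W%:R / r) <= rho * c1.
    apply: (@le_trans _ _ (rho * (2 * (Xi%:R / (8 * r))))); last by rewrite ler_wpM2l.
    have -> : rho * (2 * (Xi%:R / (8 * r))) = (rho * Xi%:R) / (4 * r) by field; rewrite gt_eqF.
    have -> : 2 * (2 * W%:R / r) = (16 * W%:R) / (4 * r) by field; rewrite gt_eqF.
    by rewrite ler_wpM2r// invr_ge0; lra.
  by rewrite /c2 /c1; lra.
have LW : L%:R <= rho * (c1 * W%:R).
  apply: (@le_trans _ _ (rho * ((Xi%:R / (4 * r)) * W%:R))); last first.
    rewrite ler_wpM2l// ler_wpM2r ?(ltW W0')//; apply: le_trans c1lo.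
    by rewrite le_eqVlt; apply/orP; left; apply/eqP; field; rewrite gt_eqF.
  have -> : rho * (Xi%:R / (4 * r) * W%:R) = rho * (Xi%:R * W%:R) / (4 * r).
    by field; rewrite gt_eqF.
  by rewrite ler_pdivlMr; lra.
have bW : b%:R + 4 <= rho * (c1 * W%:R).
  by apply: le_trans LW; rewrite -(natrD _ b 4) ler_nat.
pose psi (i : nat) := Num.floor (arc r (s s2 i)) - Num.floor (arc r (s s1 i)).
pose y (i : nat) := arc r (s s2 i) - arc r (s s1 i).
apply: (smooth_error_le (psi := psi) (y := y) L0 f01 fk b0 W0 c1b c2b rhoh b2 bW LW).
- move=> i _; rewrite /psi /y intrB ler_norml.
  have := floor_itv (arc r (s s2 i)); have := floor_itv (arc r (s s1 i)).
  rewrite !intrD; lra.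
- move=> i iW.
  have iW' : i%:R + 1 <= W%:R :> R by rewrite natr1 ler_nat ltnW.
  have i0 : 0 <= i%:R :> R by [].
  have -> : y i - y i.+1 = E (s s2 i) - E (s s1 i).
    by rewrite /y /E !sE -natr1 !addrA; ring.
  have := drop s1%:~R (s s1 i) s1r; rewrite sE => /(_ ltac:(lra) ltac:(lra)).
  have := drop s2%:~R (s s2 i); rewrite sE => /(_ ltac:(lra) ltac:(lra) ltac:(lra)).
  rewrite ![_ + i%:R - _]addrAC !subrr !add0r -/(s s1 i).
  have h : 2 * i%:R / r <= 2 * W%:R / r.
    by rewrite ler_wpM2r ?invr_ge0 ?(ltW r0)//; lra.
  have h' : 0 <= i%:R / (2 * r) by rewrite divr_ge0//; lra.
  by rewrite /c1 /c2 /e0; lra.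
Qed.

Lemma near_diagonal_density (n k : nat) : (0 < k)%N ->
  avg (fun p : 'I_n => avg (fun q : 'I_n => ((p < q + k) && (q < p + k))%N%:R : R))
  <= 2 * k%:R / n%:R.
Proof.
move=> k0; apply: avg_le_cst => [|p]; first by rewrite divr_ge0// mulr_ge0.
rewrite (avg_bool R (fun q : 'I_n => (p < q + k) && (q < p + k))%N) card_ord.
rewrite ler_wpM2r ?invr_ge0// -natrM ler_nat -cardsE.
apply: leq_trans (card_le_diameter (k := (2 * k).-2) _) _; last by lia.
by move=> i j; rewrite !inE => /andP[? ?] /andP[? ?]; lia.
Qed.

(** The expanded square is a sum over pairs [d1], [d2]. After translating the first point to [x],
    the [u]-part of the second displacement is [d2 - d1], free of [i], so the average over [i] moves
    along [v] only. Pairs closer than [Xi] are rare and bounded by 1. *)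
Lemma shear_correlation_le (T : finZmodType) (u v : T) (g : T -> R) (D W Xi : nat)
    (phi : int -> int) (o : int) (eps : R) :
  (0 < D)%N -> (0 < W)%N -> (0 < Xi)%N -> 0 <= eps -> (forall x, `|g x| <= 1) ->
  (forall d1 d2 : nat, (d1 + Xi <= d2)%N -> (d2 < D)%N ->
    avg (fun x => `|avg (fun i : 'I_W =>
      g (x + v *~ (phi (d2%:Z - o + i%:Z) - phi (d1%:Z - o + i%:Z))))|) <= eps) ->
  avg (fun i : 'I_W => avg (fun x =>
    avg (fun d : 'I_D => g (x + (u *~ (d%:Z - o + i%:Z) + v *~ phi (d%:Z - o + i%:Z)))) ^+ 2))
  <= 2 * Xi%:R / D%:R + eps.
Proof.
move=> D0 W0 Xi0 eps0 g1 Heps.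
pose G (d : nat) (i : nat) x :=
  g (x + (u *~ (d%:Z - o + i%:Z) + v *~ phi (d%:Z - o + i%:Z))).
pose Q (d1 d2 : nat) := avg (fun i : 'I_W => avg (fun x => G d1 i x * G d2 i x)).
have -> : avg (fun i : 'I_W => avg (fun x => avg (fun d : 'I_D => G d i x) ^+ 2)) =
    avg (fun d1 : 'I_D => avg (fun d2 : 'I_D => Q d1 d2)).
  under eq_avg => i do under eq_avg => x do rewrite avg_sqr.
  under eq_avg => i do rewrite exchange_avg.
  rewrite exchange_avg; apply: eq_avg => d1.
  under eq_avg => i do rewrite exchange_avg.
  by rewrite exchange_avg.
have Qsym d1 d2 : Q d1 d2 = Q d2 d1.
  by apply: eq_avg => i; apply: eq_avg => x; rewrite mulrC.
have Qfar d1 d2 : (d1 + Xi <= d2)%N -> (d2 < D)%N -> Q d1 d2 <= eps.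
  move=> d12 d2D; apply: le_trans (Heps d1 d2 d12 d2D).
  pose w := u *~ (d2%:Z - d1%:Z).
  pose psi (i : nat) := phi (d2%:Z - o + i%:Z) - phi (d1%:Z - o + i%:Z).
  have -> : Q d1 d2 = avg (fun x => g x * avg (fun i : 'I_W => g (x + w + v *~ psi i))).
    under [RHS]eq_avg => x do rewrite -avgZ.
    rewrite [RHS]exchange_avg; apply: eq_avg => i.
    rewrite -[RHS](avg_shift (u *~ (d1%:Z - o + i%:Z) + v *~ phi (d1%:Z - o + i%:Z))).
    apply: eq_avg => x; rewrite /G; congr (_ * g _).
    have -> : w = u *~ (d2%:Z - o + i%:Z) - u *~ (d1%:Z - o + i%:Z).
      by rewrite -mulrzBr; congr (_ *~ _); ring.
    rewrite /psi mulrzBr; move: (u *~ _) (u *~ _) (v *~ _) (v *~ _) => a1 a2 b1 b2.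
    rewrite -(addrA x) -(addrA x); congr (x + _).
    by rewrite -addrA addrACA [a1 + _]addrC subrK [b1 + _]addrC subrK.
  apply: (@le_trans _ _ (avg (fun x => `|avg (fun i : 'I_W => g (x + w + v *~ psi i))|))).
    apply: le_avg => x; apply: le_trans (ler_norm _) _; rewrite normrM ler_piMl//.
  by rewrite (avg_shift w (fun x => `|avg (fun i : 'I_W => g (x + v *~ psi i))|)) lexx.
have Q1 d1 d2 : Q d1 d2 <= 1.
  apply: avg_le_cst => // i; apply: avg_le_cst => // x.
  by apply: le_trans (ler_norm _) _; rewrite normrM; apply: mulr_ile1 => //; exact: g1.
apply: (@le_trans _ _ (avg (fun p : 'I_D => avg (fun q : 'I_D =>
    ((p < q + Xi) && (q < p + Xi))%N%:R + eps)))).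
  apply: le_avg => p; apply: le_avg => q.
  case: ltnP => pq /=; last by rewrite add0r Qsym Qfar.
  case: ltnP => qp /=; last by rewrite add0r Qfar.
  by apply: le_trans (Q1 _ _) _; rewrite lerDl.
have D0' : (0 < #|'I_D|)%N by rewrite card_ord.
under eq_avg => p do rewrite avgD avg_cst//.
by rewrite avgD avg_cst// lerD2r near_diagonal_density.
Qed.

Lemma prod_option (I : finType) (F : option I -> R) :
  \prod_i F i = F None * \prod_i F (Some i).
Proof.
rewrite (bigD1 None)//= (reindex_omap Some id) => [|[]//].
by under eq_bigl => i do rewrite eqxx.
Qed.

Section Scale.
Variables (T : finZmodType) (p : nat) (e : 'I_p -> T) (u v : T) (A : {set T}).
Variables (al D W L L' : nat).

Definition leg (a : {ffun 'I_p -> 'I_al * 'I_al}) (i : 'I_p) : int :=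
  (a i).1%:Z - (a i).2%:Z.

(** A difference of two independent copies of [d + i], so that its law is positive definite. Of the
    two summands, [d] is the variable correlated by Cauchy--Schwarz, and [i] runs over a range so
    short that the arcs are nearly linear on it. *)
Definition tval (w : ('I_D * 'I_W) * ('I_D * 'I_W)) : int :=
  (w.1.1 + w.1.2)%N%:Z - (w.2.1 + w.2.2)%N%:Z.

Lemma normr_tval (w : ('I_D * 'I_W) * ('I_D * 'I_W)) : `|tval w| <= (D + W)%N%:Z.
Proof.
case: w => [[a b] [c d]]; rewrite /tval /=.
by move: (ltn_ord a) (ltn_ord b) (ltn_ord c) (ltn_ord d); lia.
Qed.

Hypotheses (al0 : (0 < al)%N) (D0 : (0 < D)%N) (W0 : (0 < W)%N).
Hypothesis L'0 : (0 < L')%N.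

Definition star (a : {ffun 'I_p -> 'I_al * 'I_al}) (x : T) : R :=
  (x \in A)%:R * \prod_i (x + e i *~ leg a i \in A)%:R.

Lemma star01 a x : 0 <= star a x <= 1.
Proof.
apply/andP; split; first by rewrite mulr_ge0// prodr_ge0.
apply: mulr_ile1 => //; [exact: prodr_ge0|by rewrite lern1 leq_b1|].
by apply: prodr_ile1 => i _; rewrite ler0n lern1 leq_b1.
Qed.

Let f x : R := (x \in A)%:R.

Let f01 x : 0 <= f x <= 1.
Proof. by rewrite /f ler0n lern1 leq_b1. Qed.

(** This is [star_count_ge] with [p + 1] kernels. The last one is carried by the points
    [u (d + i) + v l]; its smoothing is the law of [tval] along [u] combined with [vsmooth v L']
    along [v]. *)
Lemma star_vsmooth_ge (d : R) : 0 <= d -> d <= avg f ->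
  d / 2 * (d / (2 * p.+1%:R)) ^+ p.+1 <=
  avg (fun a => avg (fun w => avg (fun x =>
    star a x * vsmooth v L' f (x + u *~ tval w)))).
Proof.
move=> d0 dA.
pose P (i : option 'I_p) : finType :=
  if i is Some _ then 'I_al else (('I_D * 'I_W) * 'I_L')%type.
pose z (i : option 'I_p) : P i -> T :=
  match i return P i -> T with
  | Some i => fun k : 'I_al => e i *+ k
  | None => fun k : ('I_D * 'I_W) * 'I_L' => u *+ (k.1.1 + k.1.2) + v *+ k.2
  end.
have P0 i : (0 < #|P i|)%N by case: i => [i|] /=; rewrite ?card_prod !card_ord ?muln_gt0 ?D0 ?W0.
have := @star_count_ge _ _ _ P z A d P0 _ d0 dA.
rewrite card_option card_ord => /(_ isT) h; apply: le_trans h _.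
rewrite le_eqVlt; apply/orP; left; apply/eqP.
under [RHS]eq_avg => a do rewrite exchange_avg.
rewrite [RHS]exchange_avg; apply: eq_avg => x.
under [RHS]eq_avg => a do rewrite avgZ mulrC.
rewrite avgZ avgZ prod_option mulrCA; congr (_ * (_ * _)); last first.
  rewrite (avg_prod (fun i (k : 'I_al * 'I_al) => (x + e i *~ (k.1%:Z - k.2%:Z) \in A)%:R)).
  apply: eq_bigr => i _; rewrite /smooth.
  rewrite (avg_pair (fun k l => (x + (z (Some i) k - z (Some i) l) \in A)%:R)).
  by apply: eq_avg => k; rewrite /leg mulrzBr !pmulrn.
rewrite /vsmooth /smooth -[RHS](avg_pair (fun k k' : 'I_D * 'I_W => avg (fun l : 'I_L' => avg (fun l' : 'I_L' =>
  f (x + u *~ ((k.1 + k.2)%N%:Z - (k'.1 + k'.2)%N%:Z) + (v *+ l - v *+ l')))))).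
rewrite -(avg_pair (fun k l => avg (fun q => f (x + (z None (k, l) - z None q))))).
apply: eq_avg => k; rewrite [RHS]exchange_avg; apply: eq_avg => l.
rewrite -(avg_pair (fun k' l' => f (x + (z None (k, l) - z None (k', l'))))).
apply: eq_avg => k'; apply: eq_avg => l'; congr f; rewrite /z /=.
by rewrite mulrzBr -!pmulrn opprD addrACA !addrA.
Qed.

Variables (good : pred {ffun 'I_p -> 'I_al * 'I_al}).
Variable phi : {ffun 'I_p -> 'I_al * 'I_al} -> int -> int.

Definition star_form (g : T -> R) : R :=
  avg (fun a => avg (fun w => avg (fun x =>
    (good a)%:R * star a x * g (x + (u *~ tval w + v *~ phi a (tval w)))))).

Lemma star_formD (g h : T -> R) :
  star_form (fun x => g x + h x) = star_form g + star_form h.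
Proof.
rewrite /star_form -avgD; apply: eq_avg => a; rewrite -avgD; apply: eq_avg => w.
by rewrite -avgD; apply: eq_avg => x; rewrite mulrDr.
Qed.

Let gstar01 a x : 0 <= (good a)%:R * star a x <= 1.
Proof.
have /andP[s0 s1] := star01 a x; case: (good a); last by rewrite mul0r lexx ler01.
by rewrite mul1r s0.
Qed.

Lemma star_form_norm_le (g : T -> R) : `|star_form g| <= avg (fun x => `|g x|).
Proof.
have g0 : 0 <= avg (fun x => `|g x|) by apply: avg_ge0.
apply: le_trans (ler_norm_avg _) _; apply: avg_le_cst => // a.
apply: le_trans (ler_norm_avg _) _; apply: avg_le_cst => // w.
apply: le_trans (ler_norm_avg _) _.
rewrite -(avg_shift (u *~ tval w + v *~ phi a (tval w)) (fun x => `|g x|)).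
apply: le_avg => x; rewrite normrM; have /andP[s0 s1] := gstar01 a x.
by rewrite ger0_norm// ler_piMl.
Qed.

(** For fixed [a], [k'], [i], [x] the weight does not involve [d], so Cauchy--Schwarz in these
    variables drops it and leaves the average over [d] inside the square. *)
Lemma star_form_sqr_le (g : T -> R) (Xi : nat) (eps : R) :
  (0 < Xi)%N -> 0 <= eps -> (forall x, `|g x| <= 1) ->
  (forall a, good a -> forall k' : 'I_D * 'I_W, forall d1 d2 : nat,
    let o := (k'.1 + k'.2)%N%:Z in
    (d1 + Xi <= d2)%N -> (d2 < D)%N ->
    avg (fun x => `|avg (fun i : 'I_W =>
      g (x + v *~ (phi a (d2%:Z - o + i%:Z) - phi a (d1%:Z - o + i%:Z))))|) <= eps) ->
  star_form g ^+ 2 <= 2 * Xi%:R / D%:R + eps.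
Proof.
move=> Xi0 eps0 g1 Heps.
pose t (k' : 'I_D * 'I_W) (i : 'I_W) (d : 'I_D) := d%:Z - (k'.1 + k'.2)%N%:Z + i%:Z.
have -> : star_form g = avg (fun a => avg (fun k' => avg (fun i => avg (fun x =>
    (good a)%:R * star a x *
      avg (fun d => g (x + (u *~ t k' i d + v *~ phi a (t k' i d)))))))).
  apply: eq_avg => a.
  rewrite -(avg_pair (fun k k' => avg (fun x => (good a)%:R * star a x *
     g (x + (u *~ tval (k, k') + v *~ phi a (tval (k, k'))))))).
  rewrite exchange_avg; apply: eq_avg => k'.
  rewrite -(avg_pair (fun d i => avg (fun x => (good a)%:R * star a x *
     g (x + (u *~ tval ((d, i), k') + v *~ phi a (tval ((d, i), k'))))))).
  rewrite exchange_avg; apply: eq_avg => i; rewrite exchange_avg; apply: eq_avg => x.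
  rewrite -avgZ; apply: eq_avg => d.
  have -> : tval ((d, i), k') = t k' i d; last by [].
  by rewrite /tval /t /= PoszD addrAC.
apply: le_trans (sqr_avg_le _) _.
have e0 : 0 <= 2 * Xi%:R / D%:R + eps by rewrite addr_ge0// divr_ge0// mulr_ge0.
apply: avg_le_cst => // a; apply: le_trans (sqr_avg_le _) _; apply: avg_le_cst => // k'.
apply: le_trans (sqr_avg_le _) _.
case: (boolP (good a)) => [ga|_]; last first.
  apply: avg_le_cst => // i; rewrite (eq_avg (G := fun=> 0)) => [|x]; last first.
    by rewrite mul0r mul0r.
  by rewrite /avg big1// mul0r expr0n.
apply: le_trans (shear_correlation_le u D0 W0 Xi0 eps0 g1 (Heps a ga k')).
apply: le_avg => i; apply: le_trans (sqr_avg_le _) _; apply: le_avg => x.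
rewrite mul1r exprMn ler_piMl ?sqr_ge0//; have /andP[s0 s1] := star01 a x.
by rewrite expr_le1.
Qed.

(** The losses: [beta] for the excluded [a], [Phi / L'] for erasing the [v]-displacement under the
    coarse smoothing, [eps1] for fine minus coarse, and [s] for [f] minus fine. *)
Lemma one_scale (d beta Phi eps1 eps s : R) (Xi : nat) :
  0 <= d -> d <= avg f ->
  avg (fun a => (~~ good a)%:R) <= beta ->
  (forall a, good a -> forall w, `|phi a (tval w)|%:~R <= Phi) ->
  avg (fun x => `|vsmooth v L f x - vsmooth v L' f x|) <= eps1 ->
  (0 < Xi)%N -> 0 <= eps -> 0 <= Phi -> 0 <= s -> 2 * Xi%:R / D%:R + eps <= s ^+ 2 ->
  (forall a, good a -> forall k' : 'I_D * 'I_W, forall d1 d2 : nat,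
    let o := (k'.1 + k'.2)%N%:Z in
    (d1 + Xi <= d2)%N -> (d2 < D)%N ->
    avg (fun x => `|avg (fun i : 'I_W =>
      let psi := phi a (d2%:Z - o + i%:Z) - phi a (d1%:Z - o + i%:Z) in
      f (x + v *~ psi) - vsmooth v L f (x + v *~ psi))|) <= eps) ->
  d / 2 * (d / (2 * p.+1%:R)) ^+ p.+1 - beta - Phi / L'%:R - eps1 - s <= star_form f.
Proof.
move=> d0 dA hbeta hPhi hmid Xi0 eps0 Phi0 s0 hs hfine.
pose g1 := vsmooth v L' f; pose g2 := vsmooth v L f.
have g01 K x : 0 <= vsmooth v K f x <= 1.
  by apply/andP; split; [apply: smooth_ge0|apply: smooth_le1] => y; case/andP: (f01 y).
have -> : star_form f =
    star_form g1 + (star_form (fun x => g2 x - g1 x) + star_form (fun x => f x - g2 x)).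
  rewrite -!star_formD; congr star_form; apply: funext => x.
  by ring.
have h2 : `|star_form (fun x => g2 x - g1 x)| <= eps1.
  by apply: le_trans (star_form_norm_le _) _.
have h3 : `|star_form (fun x => f x - g2 x)| <= s.
  rewrite -ler_sqr ?nnegrE// real_normK ?num_real//; apply: le_trans hs.
  apply: star_form_sqr_le => // x; rewrite ler_norml.
  by have := f01 x; have := g01 L x; rewrite -/(g2 x); lra.
have h1 : d / 2 * (d / (2 * p.+1%:R)) ^+ p.+1 - beta - Phi / L'%:R <= star_form g1.
  rewrite lerBlDr lerBlDr; apply: le_trans (star_vsmooth_ge d0 dA) _.
  have T0 : (0 < #|T|)%N by apply/card_gt0P; exists 0.
  have w0 : (0 < #|{: ('I_D * 'I_W) * ('I_D * 'I_W)}|)%N.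
    by rewrite !card_prod !card_ord !muln_gt0 D0 W0.
  have a0 : (0 < #|{: {ffun 'I_p -> 'I_al * 'I_al}}|)%N.
    by rewrite card_ffun card_prod card_ord expn_gt0 muln_gt0 al0.
  have PL0 : 0 <= Phi / L'%:R by rewrite divr_ge0.
  apply: (@le_trans _ _ (star_form g1 + Phi / L'%:R + avg (fun a => (~~ good a)%:R))); last first.
    by rewrite lerD2l.
  rewrite /star_form -(avg_cst (Phi / L'%:R) a0) -!avgD; apply: le_avg => a.
  rewrite -[X in _ + X + _](avg_cst _ w0) -[X in _ <= _ + X](avg_cst _ w0) -!avgD.
  apply: le_avg => w.
  rewrite -[X in _ + X + _](avg_cst _ T0) -[X in _ <= _ + X](avg_cst _ T0) -!avgD.
  apply: le_avg => x; have /andP[s1 s2] := star01 a x.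
  have /andP[v1 v2] := g01 L' (x + u *~ tval w).
  case: (boolP (good a)) => ga /=; last first.
    rewrite mul0r mul0r add0r; apply: le_trans (_ : 1 <= _); last by rewrite lerDr.
    by rewrite -[1]mulr1 ler_pM.
  rewrite mul1r addr0 -lerBlDl -mulrBr.
  apply: (@le_trans _ _ (`|vsmooth v L' f (x + u *~ tval w) -
                            g1 (x + (u *~ tval w + v *~ phi a (tval w)))|)).
    by apply: le_trans (ler_norm _) _; rewrite normrM (ger0_norm s1) ler_piMl.
  rewrite distrC addrA; apply: le_trans (vsmooth_shift _ _ _ _ f01) _.
  by rewrite ler_wpM2r ?invr_ge0// hPhi.
move: h1 h2 h3; rewrite !ler_norml; lra.
Qed.

End Scale.
End OneScale.

(** * The sequence of scales and the choice of one of them *)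

Section MultiScale.
Variable R : realType.
Variables (p Q K : nat).

(* At scale [j] the axis-parallel legs have length about [side j], which grows with
   [j], and the last leg about [8 * depth j], which shrinks so that the product
   [8 * depth j * side j ^ p] is the same at every scale (total_volE). The lengths
   [fine_len j.+1], [width j], [depth j], [fine_len j] are widely separated: the arc
   is linear on [width j] steps, moves little over [depth j] steps compared with
   [fine_len j], and its slope varies enough to equidistribute mod [fine_len j.+1]. *)
Definition ratio_base : nat := (Q ^ (p + 2))%N.
Definition scale_base : nat := (ratio_base ^ 6)%N.
Definition side (j : nat) : nat := (K * Q * scale_base ^ j)%N.
Definition fine_len (j : nat) : nat := (K * scale_base ^ (p * (Q - j)))%N.
Definition depth (j : nat) : nat := (fine_len j.+1 * ratio_base ^ 4)%N.
Definition width (j : nat) : nat := (fine_len j.+1 * ratio_base ^ 2)%N.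
Definition total_vol : nat :=
  (8 * K ^ p.+1 * Q ^ p * ratio_base ^ 4 * scale_base ^ (p * Q.-1))%N.

Definition radius (j : nat) (a : {ffun 'I_p -> 'I_(side j) * 'I_(side j)}) : R :=
  total_vol%:R / \prod_i `|leg a i|%:~R.

(** The threshold is [side j / Q]: a proportion at most [2 * p / Q] of the [a] fails it, and it
    confines the radius to a range of ratio [Q ^ p]. *)
Definition long_legs (j : nat) (a : {ffun 'I_p -> 'I_(side j) * 'I_(side j)}) : bool :=
  [forall i, (K * scale_base ^ j <= `|leg a i|)%N].

Definition height (j : nat) (a : {ffun 'I_p -> 'I_(side j) * 'I_(side j)}) (t : int) : int :=
  Num.floor (arc (radius a) t%:~R).

Lemma total_volE j : (j < Q)%N -> total_vol = (8 * depth j * side j ^ p)%N.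
Proof.
move=> jQ; rewrite /total_vol /depth /side /fine_len !expnMn -expnM.
have -> : (p * Q.-1 = p * (Q - j.+1) + j * p)%N.
  by rewrite [(j * p)%N]mulnC -mulnDr; congr (_ * _)%N; lia.
rewrite expnD expnS; ring.
Qed.

Hypotheses (Q0 : (0 < Q)%N) (K0 : (0 < K)%N).

Lemma ratio_base_gt0 : (0 < ratio_base)%N. Proof. by rewrite expn_gt0 Q0. Qed.
Lemma scale_base_gt0 : (0 < scale_base)%N.
Proof. by rewrite expn_gt0 ratio_base_gt0. Qed.

Lemma leg_le j (a : {ffun 'I_p -> 'I_(side j) * 'I_(side j)}) i :
  (`|leg a i| <= side j)%N.
Proof. by rewrite /leg; have := ltn_ord (a i).1; have := ltn_ord (a i).2; lia. Qed.

Lemma radius_bounds j (a : {ffun 'I_p -> 'I_(side j) * 'I_(side j)}) :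
  (j < Q)%N -> long_legs a ->
  8 * (depth j)%:R <= radius a <= 8 * (depth j)%:R * Q%:R ^+ p.
Proof.
move=> jQ /forallP la.
have lo : ((K * scale_base ^ j) ^ p)%:R <= \prod_i `|leg a i|%:~R :> R.
  rewrite natrX -[X in _ ^+ X]card_ord -prodr_const; apply: ler_prod => i _.
  by rewrite ler0n /= pmulrn ler_int; have := la i; lia.
have up : \prod_i `|leg a i|%:~R <= ((side j) ^ p)%:R :> R.
  rewrite natrX -[X in _ ^+ X]card_ord -prodr_const; apply: ler_prod => i _.
  by rewrite ler0z normr_ge0/= pmulrn ler_int; have := leg_le a i; lia.
have lo0 : 0 < ((K * scale_base ^ j) ^ p)%:R :> R.
  by rewrite ltr0n expn_gt0 muln_gt0 K0 expn_gt0 scale_base_gt0.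
have P0 : 0 < \prod_i `|leg a i|%:~R :> R by apply: lt_le_trans lo.
rewrite /radius (total_volE jQ) natrM natrM; apply/andP; split.
  by rewrite ler_pdivlMr// ler_wpM2l ?mulr_ge0.
rewrite ler_pdivrMr// -[X in _ <= X]mulrA ler_wpM2l ?mulr_ge0//.
apply: (@le_trans _ _ (Q%:R ^+ p * ((K * scale_base ^ j) ^ p)%:R)).
  by rewrite -natrX -natrM ler_nat -expnMn /side mulnCA mulnA.
by rewrite ler_wpM2l// exprn_ge0.
Qed.

Lemma short_legs_density j :
  avg (fun a : {ffun 'I_p -> 'I_(side j) * 'I_(side j)} => (~~ long_legs a)%:R : R)
  <= (2 * p)%:R / Q%:R.
Proof.
set k := (K * scale_base ^ j)%N.
have k0 : (0 < k)%N by rewrite muln_gt0 K0 expn_gt0 scale_base_gt0.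
pose near (c : 'I_(side j) * 'I_(side j)) : R :=
  ((c.1 < c.2 + k) && (c.2 < c.1 + k))%N%:R.
have side0 : (0 < side j)%N by rewrite /side -mulnA mulnCA muln_gt0 Q0.
apply: (@le_trans _ _ (avg (fun a : {ffun 'I_p -> 'I_(side j) * 'I_(side j)} =>
    \sum_i near (a i)))).
  apply: le_avg => a; case: (boolP (long_legs a)) => /= [_|].
    by apply: sumr_ge0 => i _; rewrite /near.
  rewrite negb_forall => /existsP[i hi]; rewrite (bigD1 i)//=.
  have -> : near (a i) = 1.
    rewrite /near; suff -> : ((a i).1 < (a i).2 + k)%N && ((a i).2 < (a i).1 + k)%N by [].
    move: hi; rewrite -/k -ltnNge /leg; clear -k0; move: (k) (a i) => k' [[c1 h1] [c2 h2]] /=; lia.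
  by rewrite lerDl sumr_ge0// => l _; rewrite /near.
rewrite avg_sum.
have -> : (2 * p)%:R / Q%:R = \sum_(i < p) (2 / Q%:R) :> R.
  by rewrite sumr_const card_ord -[RHS]mulr_natl natrM [2 * _]mulrC mulrA.
apply: ler_sum => i _.
have -> : avg (fun a : {ffun 'I_p -> 'I_(side j) * 'I_(side j)} => near (a i)) = avg near.
  have := avg_prod (fun l c => if l == i then near c else 1).
  rewrite (bigD1 i)//= eqxx big1 ?mulr1 => [<-|l /negbTE ->].
    apply: eq_avg => a; rewrite (bigD1 i)//= eqxx big1 ?mulr1// => l /negbTE -> //.
  by rewrite avg_cst// card_prod card_ord muln_gt0 side0.
rewrite -(avg_pair (fun c1 c2 : 'I_(side j) => ((c1 < c2 + k) && (c2 < c1 + k))%N%:R)).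
apply: le_trans (near_diagonal_density _ _ k0) _.
rewrite ler_pdivrMr ?ltr0n// mulrAC ler_pdivlMr ?ltr0n// -!natrM ler_nat.
by rewrite /side -/k /k; lia.
Qed.

Variables (T : finZmodType) (e : 'I_p -> T) (u v : T) (A : {set T}).

Definition scale_form (j : nat) : R :=
  star_form e u v A (depth j) (width j) (@long_legs j) (@height j)
    (fun x => (x \in A)%:R).

Lemma multi_scale (d c : R) :
  (0 < p)%N -> (16 <= Q)%N -> (Q + 4 <= K)%N ->
  0 <= d -> d <= avg (fun x => (x \in A)%:R : R) ->
  c = d / 2 * (d / (2 * p.+1%:R)) ^+ p.+1 -> 0 < c <= 1 ->
  p.+1%:R / Q%:R <= c ^+ 2 / 512 ->
  avg (fun x => `|(x + v \in A)%:R - (x \in A)%:R| : R) <= (Q%:R ^+ 2)^-1 ->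
  exists2 j, (j < Q)%N & c / 4 <= scale_form j.
Proof.
move=> p0 Q16 QK d0 dA cE /andP[c0 c1] Qc hkappa.
have [N NE] : {N | ratio_base = N} by exists ratio_base.
have [M ME] : {M | scale_base = M} by exists scale_base.
have M6 : (M = N ^ 6)%N by rewrite -ME -NE.
pose f x : R := (x \in A)%:R.
have f01 x : 0 <= f x <= 1 by rewrite /f ler0n lern1 leq_b1.
have Qr : 0 < Q%:R :> R by rewrite ltr0n.
have N0 : (0 < N)%N by rewrite -NE ratio_base_gt0.
have M0 : (0 < M)%N by rewrite -ME scale_base_gt0.
have Qp2N : (Q * (Q * Q ^ p) = N)%N by rewrite -NE /ratio_base addn2 !expnS.
have Qp0 : (0 < Q ^ p)%N by rewrite expn_gt0 Q0.
have QN : (Q <= N)%N by rewrite -Qp2N leq_pmulr// muln_gt0 Q0.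
have NM : (N <= M)%N by rewrite M6 -[X in (X <= _)%N]expn1 leq_pexp2l.
have l0 j : (0 < fine_len j)%N by rewrite /fine_len ME muln_gt0 K0 expn_gt0 M0.
have fineS j : (j < Q)%N -> fine_len j = (fine_len j.+1 * M ^ p)%N.
  move=> jQ; rewrite /fine_len ME -mulnA -expnD; congr (_ * M ^ _)%N.
  by rewrite -mulnSr; congr (_ * _)%N; lia.
have Qi : (Q%:R : R) * Q%:R^-1 = 1 by rewrite divff ?gt_eqF.
have Q16r : 16 <= Q%:R :> R by rewrite ler_nat.
have Vr : 0 < Q%:R^-1 :> R by rewrite invr_gt0.
have Vmu : Q%:R^-1 <= c ^+ 2 / 512 :> R.
  by apply: le_trans Qc; rewrite ler_peMl ?(ltW Vr)// ler1n.
have c2c : c ^+ 2 <= c by rewrite expr2 ler_piMr// ltW.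
have hmu j : (j < Q)%N -> (fine_len j.+1)%:R <= Q%:R^-1 * (fine_len j)%:R :> R.
  move=> jQ; rewrite (fineS _ jQ) mulrC ler_pdivlMr// -natrM ler_nat leq_mul2l.
  apply/orP; right; apply: leq_trans QN _; apply: leq_trans NM _.
  by rewrite -[X in (X <= _)%N]expn1 leq_pexp2l.
have [||j jQ hmid] := @energy_pigeonhole R T v f fine_len Q Q%:R^-1 (c / 4) Q0 f01 l0 hmu.
- by lra.
- by lra.
exists j => //.
have [L LE] : {L | fine_len j.+1 = L} by exists (fine_len j.+1).
rewrite LE in hmid.
set L' := fine_len j.
have LK : (Q + 4 <= L)%N.
  by apply: leq_trans QK _; rewrite -LE /fine_len ME leq_pmulr// expn_gt0 M0.
have L0 : (0 < L)%N by rewrite -LE l0.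
have D0 : (0 < depth j)%N by rewrite /depth NE muln_gt0 l0 expn_gt0 N0.
have W0 : (0 < width j)%N by rewrite /width NE muln_gt0 l0 expn_gt0 N0.
have side0 : (0 < side j)%N by rewrite /side ME !muln_gt0 Q0 K0 expn_gt0 M0.
(* The geometric mean of [width j] and [depth j]: pairs closer than [Xi] are rare in a range of
   length [depth j], while [width j] is short compared with [Xi]. *)
pose Xi := (L * N ^ 3)%N.
have Xi0 : (0 < Xi)%N by rewrite muln_gt0 L0 expn_gt0 N0.
pose Phi : R := 8 * (depth j)%:R * Q%:R ^+ p.
have Phi0 : 0 <= Phi by rewrite !mulr_ge0// exprn_ge0.
(* The smallest value allowed by [2 <= rho * b] for windows of length [b = Q]. With [kappa = Q ^ -2]
   it gives [eps = 26 / Q]. *)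
pose rho : R := 2 / Q%:R.
pose eps : R := 2 * (Q%:R * (Q%:R ^+ 2)^-1) + 12 * rho.
have epsE : eps = 26 / Q%:R by rewrite /eps /rho; field; rewrite gt_eqF.
have Dr : 0 < (depth j)%:R :> R by rewrite ltr0n.
have rad0 (a : {ffun 'I_p -> 'I_(side j) * 'I_(side j)}) : long_legs a -> 0 < radius a :> R.
  move=> la; have /andP[+ _] := radius_bounds jQ la.
  apply: lt_le_trans; exact: mulr_gt0 (ltr0n R 8) Dr.
have N16 : (16 * Q <= N)%N.
  rewrite -Qp2N mulnC; apply: leq_mul => //.
  apply: leq_trans Q16 _.
  exact: leq_pmulr.
have Nr : 16 * Q%:R <= N%:R :> R by move: N16; rewrite -(ler_nat R) natrM.
have N0r : 0 < N%:R :> R by rewrite ltr0n.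
have hPhi (a : {ffun 'I_p -> 'I_(side j) * 'I_(side j)}) : long_legs a -> forall w : ('I_(depth j) * 'I_(width j)) * ('I_(depth j) * 'I_(width j)),
    `|height a (tval w)|%:~R <= Phi.
  move=> la w; have r0 := rad0 a la; have /andP[_ rP] := radius_bounds jQ la.
  apply: le_trans rP; rewrite /height.
  have arc0 : 0 <= arc (radius a) (tval w)%:~R by exact: sqrtr_ge0.
  rewrite ger0_norm ?floor_ge0//; apply: le_trans (floor_le _) _.
  rewrite -[X in _ <= X](ger0_norm (ltW r0)) -sqrtr_sqr /arc ler_wsqrtr//.
  by rewrite lerBlDr lerDl sqr_ge0.
have hPhiL : Phi / L'%:R <= 8 / Q%:R.
  have L'r : 0 < L'%:R :> R by rewrite ltr0n l0.
  rewrite (ler_pdivrMr _ _ L'r) [X in _ <= X]mulrAC (ler_pdivlMr _ _ Qr) /Phi -natrX -!natrM ler_nat.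
  (* The exponent 6 in [scale_base] enters here: consecutive scales must be further apart than
     [N ^ 5]. *)
  have h : (N ^ 4 * (Q * Q ^ p) <= M ^ p)%N.
    apply: (@leq_trans (N ^ 4 * N)).
      by rewrite leq_mul2l -[in (_ <= N)%N]Qp2N leq_pmull// orbT.
    apply: (@leq_trans M); last by rewrite -[X in (X <= _)%N]expn1 leq_pexp2l.
    by rewrite -expnSr M6 leq_pexp2l.
  rewrite /L' (fineS j jQ) /depth LE NE.
  have -> : (8 * (L * N ^ 4) * Q ^ p * Q = 8 * L * (N ^ 4 * (Q * Q ^ p)))%N by ring.
  by rewrite (mulnA 8 L (M ^ p)%N); apply: leq_mul.
have hfine (a : {ffun 'I_p -> 'I_(side j) * 'I_(side j)}) : long_legs a -> forall k' : 'I_(depth j) * 'I_(width j), forall d1 d2 : nat,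
    let o := (k'.1 + k'.2)%N%:Z in
    (d1 + Xi <= d2)%N -> (d2 < depth j)%N ->
    avg (fun x => `|avg (fun i : 'I_(width j) =>
      let psi := height a (d2%:Z - o + i%:Z) - height a (d1%:Z - o + i%:Z) in
      f (x + v *~ psi) - vsmooth v L f (x + v *~ psi))|) <= eps.
  move=> la [k1 k2] d1 d2 o d12 d2D; have /andP[rlo rhi] := radius_bounds jQ la.
  have r0 := rad0 a la.
  have WD : (width j + 1 <= depth j)%N.
    rewrite /width /depth LE NE.
    have -> : (L * N ^ 4 = L * N ^ 2 * N ^ 2)%N by rewrite -mulnA -expnD.
    have N2 : (1 < N)%N.
      by apply: leq_trans N16; apply: (@leq_trans (16 * 1)) => //; rewrite leq_mul2l Q0 orbT.
    have X0 : (0 < L * N ^ 2)%N by rewrite muln_gt0 L0 expn_gt0 N0.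
    apply: (@leq_trans (L * N ^ 2 * 2)); first by rewrite muln2 -addnn leq_add2l.
    rewrite leq_mul2l; apply/orP; right; apply: leq_trans N2 _.
    by rewrite -[X in (X <= _)%N]expn1 leq_pexp2l.
  have WDr : (width j)%:R + 1 <= (depth j)%:R :> R by rewrite natr1 ler_nat -addn1.
  have o_le : o%:~R <= (depth j)%:R + (width j)%:R :> R.
    by rewrite /o -pmulrn -natrD ler_nat leq_add// ltnW.
  have o_ge : 0 <= o%:~R :> R by rewrite ler0z.
  have d2r : d2%:R + 1 <= (depth j)%:R :> R by rewrite natr1 ler_nat.
  have XiW : Xi%:R * Q%:R = (L * Q * N ^ 3)%:R :> R by rewrite -natrM mulnAC.
  apply: (arc_smooth_error (Xi := Xi)) => //.
  - by rewrite /rho divr_ge0//= ler_pdivrMr//; lra.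
  - by rewrite /rho divfK// gt_eqF.
  - rewrite /rho mulrAC ler_pdivlMr// -!natrM ler_nat /width /Xi LE NE.
    have -> : (16 * (L * N ^ 2) * Q = L * N ^ 2 * (16 * Q))%N by ring.
    have -> : (2 * (L * N ^ 3) = L * N ^ 2 * (2 * N))%N by ring.
    rewrite leq_mul2l; apply/orP; right; apply: leq_trans N16 _.
    by rewrite mul2n -addnn leq_addr.
  (* This separation dictates [ratio_base]: it amounts to [16 * Q ^ (p + 1) <= N], true since
     [16 <= Q]. *)
  - apply: (@le_trans _ _ (4 * (8 * (depth j)%:R * Q%:R ^+ p) * L%:R)).
      by rewrite ler_wpM2r// ler_wpM2l.
    rewrite /rho [X in _ <= X]mulrAC (ler_pdivlMr _ _ Qr) -natrX -!natrM ler_nat.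
    rewrite /depth /Xi /width LE NE.
    have -> : (4 * (8 * (L * N ^ 4) * Q ^ p) * L * Q = 2 * (L * L * N ^ 4) * (16 * (Q * Q ^ p)))%N by ring.
    have -> : (2 * (L * N ^ 3 * (L * N ^ 2)) = 2 * (L * L * N ^ 4) * N)%N by ring.
    apply: leq_mul => //; rewrite -Qp2N; exact: leq_mul.
  - rewrite intrB -pmulrn; have : 0 <= d1%:R :> R by [].
    lra.
  - by rewrite addrAC lerD2r -PoszD lez_nat.
  - by rewrite intrD intrB -!pmulrn; lra.
(* The left side is at most [27 / Q], and [27 * 16 <= 512]. *)
have heps : 2 * Xi%:R / (depth j)%:R + eps <= (c / 4) ^+ 2.
  have -> : 2 * Xi%:R / (depth j)%:R = 2 / N%:R :> R.
    have -> : (depth j)%:R = Xi%:R * N%:R :> R.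
      by rewrite -natrM /Xi /depth LE NE -mulnA -expnSr.
    have Xir : 0 < Xi%:R :> R by rewrite ltr0n.
    by field; rewrite (gt_eqF Xir) (gt_eqF N0r).
  have : 2 / N%:R <= 1 / Q%:R :> R.
    by rewrite ler_pdivrMr// mulrAC mul1r ler_pdivlMr//; lra.
  rewrite epsE mul1r expr_div_n (_ : 4 ^+ 2 = 16); last by ring.
  lra.
have eps0 : 0 <= eps by rewrite epsE divr_ge0// ltW.
have c40 : 0 <= c / 4 by lra.
(* What remains of [c] is at least [c - 2 * p / Q - 8 / Q - (c / 4 + 1 / Q) - c / 4], and the terms
   in [1 / Q] add up to at most [9 * c / 512]. *)
have := one_scale e u side0 D0 W0 (l0 j) d0 dA
   (short_legs_density j) hPhi hmid Xi0 eps0 Phi0 c40 heps hfine.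
apply: le_trans; rewrite -cE.
have := Qc; rewrite -natr1 mulrDl mul1r natrM => hp.
have : 0 <= p%:R / Q%:R :> R by rewrite divr_ge0.
move: hPhiL; rewrite -/L'; lra.
Qed.
End MultiScale.

(** * Lebesgue measure on tuples *)

Section TupleMeasure.
Variable R : realType.
Local Notation mR := (measurableTypeR R).

Definition tbox (n : nat) (a : 'I_n -> R) (r : R) : set (n.-tuple mR) :=
  [set t | forall i, a i <= tnth t i <= a i + r].

Definition ttrans (n : nat) (v : 'I_n -> R) (t : n.-tuple mR) : n.-tuple mR :=
  [tuple (tnth t i + v i : mR) | i < n].

Definition tcons (n : nat) (q : mR * n.-tuple mR) : n.+1.-tuple mR :=
  [tuple of q.1 :: q.2].

Lemma measurable_tcons n : measurable_fun setT (@tcons n).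
Proof. by apply: measurable_cons; [exact: measurable_fst|exact: measurable_snd]. Qed.

Lemma measurable_ttrans n (v : 'I_n -> R) : measurable_fun setT (ttrans v).
Proof.
apply/measurable_fun_tnthP => i.
rewrite (_ : _ \o _ = fun t : n.-tuple mR => (tnth t i + v i : mR)); last first.
  by apply: funext => t /=; rewrite tnth_mktuple.
apply: measurable_funD => //; exact: measurable_tnth.
Qed.

Lemma measurable_tbox n (a : 'I_n -> R) r : measurable (tbox a r).
Proof.
rewrite (_ : tbox a r = \bigcap_(i in [set: 'I_n])
  ((fun t : n.-tuple mR => tnth t i) @^-1` `[a i, a i + r]%classic)); last first.
  apply/seteqP; split => t /= h i; first by move=> _ /=; rewrite in_itv/= h.
  by have := h i Logic.I; rewrite /= in_itv.
apply: fin_bigcap_measurable => [|i _]; first exact: finite_finset.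
rewrite -[X in measurable X]setTI.
by apply: measurable_tnth => //; exact: measurable_itv.
Qed.

Definition rshift (s : R) (x : mR) : mR := x + s.

Lemma measurable_rshift (s : R) : measurable_fun setT (rshift s).
Proof. by apply: measurable_funD. Qed.

Lemma lebesgue_translation (c : R) (A : set mR) : measurable A ->
  lebesgue_measure (rshift c @^-1` A) = lebesgue_measure A.
Proof.
move=> mA; pose F := @mfun_Sub _ _ mR mR (rshift c) (mem_set (measurable_rshift c)).
apply/esym; apply: (lebesgue_measure_unique (mu := pushforward lebesgue_measure F)) => //.
move=> _ [[a b]] _ <-.
transitivity (lebesgue_measure (`](a - c), (b - c)]%classic : set mR)).
  by rewrite !lebesgue_measure_itv /= !lte_fin ltrD2r -!EFinB; case: ifP => // _; congr _%:E; ring.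
congr lebesgue_measure; apply/seteqP.
by split => x /=; rewrite /rshift !in_itv/= ltrBlDr lerBrDr.
Qed.

Lemma pushforward_tcons_measure n (mu : {sigma_finite_measure set (n.-tuple mR) -> \bar R}) :
  exists nu : {measure set (n.+1.-tuple mR) -> \bar R},
    nu = pushforward (@lebesgue_measure R \x mu)%E (@tcons n) :> (set _ -> \bar R).
Proof.
pose pm : {measure set (mR * n.-tuple mR) -> \bar R} := (@lebesgue_measure R \x mu)%E.
pose nu : {measure set (n.+1.-tuple mR) -> \bar R} := pushforward pm (@tcons n).
by exists (nu (@measurable_tcons n)).
Qed.

Lemma ge0_integral_translation (c : R) (G : mR -> \bar R) :
  measurable_fun setT G -> (forall x, 0 <= G x)%E ->
  (\int[@lebesgue_measure R]_x G (x + c)%R = \int[@lebesgue_measure R]_x G x)%E.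
Proof.
move=> mG G0.
have := @ge0_integral_pushforward _ _ mR mR R _ (measurable_rshift c)
  (@lebesgue_measure R) setT G measurableT mG (fun y _ => G0 y).
rewrite preimage_setT => <-.
apply: eq_measure_integral => [|mf A mA _]; first exact: measurable_rshift.
exact: lebesgue_translation.
Qed.

Lemma tuple_sigma_finite n (mu : {measure set (n.-tuple mR) -> \bar R}) :
  (forall a r, 0 <= r -> mu (tbox a r) = (r ^+ n)%:E) -> sigma_finite setT mu.
Proof.
move=> mubox; exists (fun k => tbox (fun=> - k%:R) (k%:R + k%:R)).
  apply/seteqP; split => // t _; exists (Num.truncn (\sum_(i < n) `|tnth t i : R|)).+1 => //= i.
  have := truncnS_gt (\sum_(i < n) `|tnth t i : R|); set k := _.+1.
  rewrite (bigD1 i)//= => h.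
  have : 0 <= \sum_(l < n | l != i) `|tnth t l : R| by apply: sumr_ge0.
  have := ler_norm (tnth t i : R); have := lerNnormlW (lexx `|tnth t i : R|).
  by move: h; lra.
move=> k; split; first exact: measurable_tbox.
by rewrite mubox ?addr_ge0// ltry.
Qed.

Lemma sigma_finite_measure_pack d (T : measurableType d) (nu : {measure set T -> \bar R}) :
  sigma_finite setT nu -> exists mu : {sigma_finite_measure set T -> \bar R},
    mu = nu :> (set T -> \bar R).
Proof.
case: nu => f c h.
pose sf := Measure_isSigmaFinite.Build _ _ _ _ h.
pose nu' := HB.pack_for {sigma_finite_measure set T -> \bar R} f c sf.
by exists nu'.
Qed.

Lemma ttrans_tcons n (v : 'I_n.+1 -> R) (x : mR) (t : n.-tuple mR) :
  ttrans v (tcons (x, t)) = tcons (x + v ord0, ttrans (v \o lift ord0) t).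
Proof.
apply: eq_from_tnth => i; rewrite tnth_mktuple.
by case: (unliftP ord0 i) => [l ->|->]; rewrite ?tnthS ?tnth_mktuple ?tnth0.
Qed.

(** The induction carries all three facts at once: the next product needs a sigma-finite factor,
    which the box formula provides, and a translation acts on the sections by the induction
    hypothesis and on the first coordinate by [ge0_integral_translation]. *)
Lemma lebesgue_tupleP n : exists mu : {sigma_finite_measure set (n.-tuple mR) -> \bar R},
  [/\ mu = @lebesgue_tuple R n :> (set _ -> \bar R),
      forall a r, 0 <= r -> mu (tbox a r) = (r ^+ n)%:E &
      forall v E, measurable E -> mu (ttrans v @^-1` E) = mu E].
Proof.
elim: n => [|n [mu [muE mubox mutr]]].
  pose nu : {measure set (0.-tuple mR) -> \bar R} := @dirac _ (0.-tuple mR) [tuple] R.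
  have nubox a r : 0 <= r -> nu (tbox a r) = (r ^+ 0)%:E.
    by move=> _; rewrite /nu/= diracE mem_set// => -[].
  have [nu' nu'E] := sigma_finite_measure_pack (tuple_sigma_finite nubox).
  exists nu'; rewrite nu'E; split => // v E _; congr (nu _).
  by apply/seteqP; split => t /=; rewrite (tuple0 t) (tuple0 (ttrans _ _)).
have [nu nuE] := pushforward_tcons_measure mu.
have nubox a r : 0 <= r -> nu (tbox a r) = (r ^+ n.+1)%:E.
  move=> r0; rewrite nuE /pushforward.
  rewrite (_ : _ @^-1` _ = `[a ord0, a ord0 + r]%classic `*` tbox (a \o lift ord0) r); last first.
    apply/seteqP; split => -[x t] /=.
      move=> h; split=> /=; first by have := h ord0; rewrite in_itv/= (tnth_nth 0).
      by move=> i /=; have := h (lift ord0 i); rewrite tnthS.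
    rewrite in_itv/= => -[h0 h] i; case: (unliftP ord0 i) => [l ->|->].
      by rewrite tnthS; exact: h.
    by rewrite tnth0.
  rewrite product_measure1E//; last exact: measurable_tbox.
  rewrite mubox// exprS EFinM; congr (_ * _)%E.
  rewrite [LHS](lebesgue_measure_itv `[a ord0, a ord0 + r]) /= lte_fin ltrDl.
  case: ifPn => [_|]; first by rewrite -EFinB addrAC subrr add0r.
  by rewrite -leNgt => r0'; congr _%:E; apply/eqP; rewrite eq_le r0 r0'.
have [nu' nu'E] := sigma_finite_measure_pack (tuple_sigma_finite nubox).
exists nu'; rewrite nu'E; split => //.
  by rewrite nuE /= muE.
move=> v E mE; rewrite nuE /pushforward /product_measure1 /=.
have mtE : measurable (@tcons n @^-1` E).
  by rewrite -[X in measurable X]setTI; exact: measurable_tcons.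
pose G x := mu (xsection (@tcons n @^-1` E) x).
rewrite -[RHS](ge0_integral_translation (v ord0) (G := G)) //; last first.
  exact: measurable_fun_xsection.
apply: eq_integral => x _ /=; rewrite /G -(mutr (v \o lift ord0)); last first.
  exact: measurable_xsection.
by congr (mu _); apply/seteqP; split => t; rewrite /= /xsection /= !inE /= ttrans_tcons.
Qed.

Definition sdiff (T : Type) (A B : set T) : set T := (A `\` B) `|` (B `\` A).

Lemma near_translate_subset (K U : set R) : compact K -> open U -> K `<=` U ->
  \forall s \near 0, K `<=` (fun x => U (x + s)).
Proof.
move=> cK oU KU; move/compact_near_coveringP : cK.
move=> /(_ R (nbhs (0 : R)) (fun s x => U (x + s)) _); apply => x Kx; have Ux := KU x Kx.
have : (fun z : R * R => z.1 + z.2) @ (x, 0) --> x + 0.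
  by apply: cvgD; [exact: cvg_fst|exact: cvg_snd].
rewrite addr0 => /(_ U); apply.
by rewrite nbhsE; exists U.
Qed.

(** Take [K] compact and [U] open with [K <= D <= U], each within [eps / 4]. A small shift keeps [K]
    inside [U], so what [D] loses is covered by [D] minus [K] and a translate of [U] minus [D]. The
    other half of the symmetric difference is a translate of the same situation for [- s]. *)
Lemma lebesgue_translation_cts (D : set mR) (eps : R) :
  measurable D -> (lebesgue_measure D < +oo)%E -> 0 < eps ->
  \forall s \near (0 : R), (lebesgue_measure (sdiff (rshift s @^-1` D) D) <= eps%:E)%E.
Proof.
move=> mD Doo eps0; have e40 : 0 < eps / 4 by rewrite divr_gt0.
have [U [oU DU UD]] := lebesgue_regularity_outer mD Doo e40.
have [K [cK KD DK]] := lebesgue_regularity_inner mD Doo e40.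
have mU : measurable (U : set mR) by exact: open_measurable.
have mK : measurable (K : set mR) by apply: compact_measurable.
have mtr (s : R) (A : set mR) : measurable A -> measurable (rshift s @^-1` A).
  by move=> mA; rewrite -[X in measurable X]setTI; exact: measurable_rshift.
have half (s : R) : (K `<=` (fun x => U (x + s))) ->
    (lebesgue_measure (D `\` (rshift s @^-1` D)) <= (eps / 2)%:E)%E.
  move=> Ks; apply: (@le_trans _ _ (lebesgue_measure ((D `\` K) `|`
     (rshift s @^-1` (U `\` D))))).
    apply: le_measure; rewrite ?inE.
    - by apply: measurableD => //; exact: mtr.
    - by apply: measurableU; [exact: measurableD|apply: mtr; exact: measurableD].
    - move=> x [Dx nDx]; have [Kx|nKx] := pselect (K x); last by left.
      by right; split => //; exact: Ks.
  apply: (le_trans (measureU2 _ _ _)) => //.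
  - exact: measurableD.
  - by apply: mtr; exact: measurableD.
  rewrite (_ : eps / 2 = eps / 4 + eps / 4); last by field.
  rewrite EFinD; apply: leeD; first exact: ltW.
  rewrite [X in (X <= _)%E](lebesgue_translation s (measurableD mU mD)); exact: ltW.
have Ks := near_translate_subset cK oU (subset_trans KD DU).
have KsN : \forall s \near (0 : R), K `<=` (fun x => U (x - s)).
  have : (fun s : R => - s) @ (0 : R) --> - (0 : R) by exact: (@opp_continuous R^o).
  by rewrite oppr0 => /(_ _ Ks).
near=> s.
apply: (le_trans (measureU2 _ _ _)).
- by apply: measurableD => //; exact: mtr.
- by apply: measurableD => //; exact: mtr.
rewrite (_ : eps = eps / 2 + eps / 2); last by field.
rewrite EFinD; apply: leeD; last by apply: half; near: s.
have -> : rshift s @^-1` D `\` D =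
   rshift s @^-1` (D `\` rshift (- s) @^-1` D).
  by apply/seteqP; split => x /= [h1 h2]; split => //; move: h2; rewrite /rshift /= addrK.
have mDs : measurable (D `\` rshift (- s) @^-1` D).
  by apply: measurableD => //; exact: mtr.
rewrite [X in (X <= _)%E](lebesgue_translation s mDs).
by apply: half; near: s.
Unshelve. all: by end_near. Qed.

Definition shift0 (n : nat) (s : R) (i : 'I_n.+1) : R := if i == ord0 then s else 0.

Lemma ttrans_shift0_tcons n s (x : mR) (t : n.-tuple mR) :
  ttrans (shift0 s) (tcons (x, t)) = tcons (rshift s x, t).
Proof.
rewrite ttrans_tcons /= /shift0 eqxx; congr (tcons (_, _)).
by apply: eq_from_tnth => i; rewrite tnth_mktuple /= addr0.
Qed.

Lemma measurable_sdiff d (T : measurableType d) (A B : set T) :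
  measurable A -> measurable B -> measurable (sdiff A B).
Proof. by move=> mA mB; apply: measurableU; exact: measurableD. Qed.

Lemma lebesgue_tuple_ysection n (F : set (n.+1.-tuple mR))
    (mu : {sigma_finite_measure set (n.-tuple mR) -> \bar R}) :
  mu = @lebesgue_tuple R n :> (set _ -> \bar R) -> measurable F ->
  (@lebesgue_tuple R n.+1 F =
   \int[mu]_t (@lebesgue_measure R (ysection (@tcons n @^-1` F) t)))%E.
Proof.
move=> muE mF.
have mtF : measurable (@tcons n @^-1` F).
  by rewrite -[X in measurable X]setTI; exact: measurable_tcons.
rewrite /= -muE /pushforward /product_measure1 /=.
pose leb : {sigma_finite_measure set mR -> \bar R} := @lebesgue_measure R.
have := indic_fubini_tonelli leb mu mtF.
by rewrite (indic_fubini_tonelli_FE mu mtF) (indic_fubini_tonelli_GE leb mtF).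
Qed.

(** Heights are rounded along the first axis, so this is the direction translated. It acts on each
    one-dimensional section separately; [lebesgue_translation_cts] gives pointwise convergence, and
    twice the measure of the section dominates. *)
Lemma tuple_translation_cts n (E : set (n.+1.-tuple mR)) a r (eps : R) :
  measurable E -> E `<=` tbox a r -> 0 < eps ->
  exists2 del, 0 < del & forall s, `|s| < del ->
    (@lebesgue_tuple R n.+1 (sdiff (ttrans (shift0 s) @^-1` E) E) <= eps%:E)%E.
Proof.
move=> mE Ebox eps0; apply: contrapT => nex.
have [mu [muE mubox mutr]] := lebesgue_tupleP n.
have {nex} bad k : exists s, `|s| < k.+1%:R^-1 /\
    (eps%:E < @lebesgue_tuple R n.+1 (sdiff (ttrans (shift0 s) @^-1` E) E))%E.
  apply: contrapT => nb; apply: nex; exists k.+1%:R^-1; first by rewrite invr_gt0.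
  move=> s sk; rewrite leNgt; apply/negP => lt; apply: nb; by exists s.
pose s k := projT1 (cid (bad k)).
have sk k : `|s k| < k.+1%:R^-1 by have [] := projT2 (cid (bad k)).
have sbad k : (eps%:E < @lebesgue_tuple R n.+1 (sdiff (ttrans (shift0 (s k)) @^-1` E) E))%E.
  by have [] := projT2 (cid (bad k)).
have s0 : s @ \oo --> (0 : R).
  apply/norm_cvg0P; apply: (squeeze_cvgr _ (cvg_cst 0) (@cvg_harmonic R)).
  by apply: nearW => k; rewrite normr_ge0/= ltW// sk.
pose D t := ysection (@tcons n @^-1` E) t.
pose f k t := (@lebesgue_measure R (sdiff (rshift (s k) @^-1` (D t)) (D t)))%E.
have mtE : measurable (@tcons n @^-1` E).
  by rewrite -[X in measurable X]setTI; exact: measurable_tcons.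
have mD t : measurable (D t) by exact: measurable_ysection.
have Dfin t : (lebesgue_measure (D t) < +oo)%E.
  apply: (@le_lt_trans _ _ (lebesgue_measure (`[a ord0, a ord0 + r]%classic : set mR))).
    apply: le_measure; rewrite ?inE//=.
    move=> x; rewrite /D /ysection /= inE => /Ebox /(_ ord0).
    by rewrite tnth0 in_itv.
  by rewrite lebesgue_measure_itv /=; case: ifP => _; rewrite ?ltry// -EFinB ltry.
have mtr k : measurable (ttrans (shift0 (s k)) @^-1` E).
  by rewrite -[X in measurable X]setTI; exact: measurable_ttrans.
have fE k : f k = fun t => @lebesgue_measure R (ysection (@tcons n @^-1`
    (sdiff (ttrans (shift0 (s k)) @^-1` E) E)) t).
  apply: funext => t; rewrite /f; congr lebesgue_measure.
  by apply/seteqP; split => x; rewrite /D /ysection /sdiff /= !in_setE /= ttrans_shift0_tcons.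
have intf k : (\int[mu]_t f k t =
    @lebesgue_tuple R n.+1 (sdiff (ttrans (shift0 (s k)) @^-1` E) E))%E.
  by rewrite fE (lebesgue_tuple_ysection muE)//; exact: measurable_sdiff.
have [mu1 [mu1E mu1box _]] := lebesgue_tupleP n.+1.
have mh : measurable_fun setT (fun t => lebesgue_measure (D t)).
  exact: (@measurable_fun_ysection _ _ _ _ R (@lebesgue_measure R)).
have ih : mu.-integrable setT (fun t => lebesgue_measure (D t)).
  apply/integrableP; split => //.
  under eq_integral => t _ do rewrite gee0_abs//.
  rewrite -(lebesgue_tuple_ysection muE)// -mu1E.
  apply: (@le_lt_trans _ _ (mu1 (tbox a `|r|))).
    apply: le_measure; rewrite ?inE//; first exact: measurable_tbox.
    apply: (subset_trans Ebox) => t h i; have /andP[h1 h2] := h i.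
    by rewrite h1/= (le_trans h2)// lerD2l ler_norm.
  by rewrite mu1box// ltry.
have mf k : measurable_fun setT (f k).
  rewrite fE; apply: (@measurable_fun_ysection _ _ _ _ R (@lebesgue_measure R)).
  rewrite -[X in measurable X]setTI; apply: measurable_tcons => //.
  exact: measurable_sdiff.
have f0 k t : (0 <= f k t)%E by exact: measure_ge0.
have mrs k t : measurable (rshift (s k) @^-1` D t).
  by rewrite -[X in measurable X]setTI; exact: measurable_rshift.
have fcvg t : f ^~ t @ \oo --> 0%E.
  have small e : 0 < e -> \forall k \near \oo, (f k t <= e%:E)%E.
    by move=> e0; exact: (s0 _ (lebesgue_translation_cts (mD t) (Dfin t) e0)).
  apply/fine_cvgP; split.
    near=> k; rewrite ge0_fin_numE//.
    by apply: (@le_lt_trans _ _ 1%:E); [near: k; exact: small|exact: ltry].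
  apply/cvgrPdist_le => e e0; near=> k.
  have fke : (f k t <= e%:E)%E by near: k; exact: small.
  have ffin : f k t \is a fin_num by rewrite ge0_fin_numE// (le_lt_trans fke)// ltry.
  by rewrite sub0r normrN /= ger0_norm ?fine_ge0// -lee_fin fineK.
have fdom k t : (`|f k t| <= lebesgue_measure (D t) + lebesgue_measure (D t))%E.
  rewrite gee0_abs//; apply: (le_trans (measureU2 _ _ _)).
  - by apply: measurableD.
  - by apply: measurableD.
  apply: leeD.
    rewrite -[X in (_ <= X)%E](lebesgue_translation (s k) (mD t)).
    by apply: le_measure; rewrite ?inE//; try exact: subDsetl; exact: measurableD.
  by apply: le_measure; rewrite ?inE//; try exact: subDsetl; exact: measurableD.
have [_ _ cvI] := @dominated_convergence _ _ R mu setT measurableT f (cst 0%E)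
  (fun t => lebesgue_measure (D t) + lebesgue_measure (D t))%E mf (measurable_cst _)
  (aeW _ (fun t _ => fcvg t)) (integrableD measurableT ih ih)
  (aeW _ (fun t k _ => fdom k t)).
rewrite integral0 in cvI.
have : (eps%:E <= lim ((\int[mu]_t f k t)%E @[k --> \oo]))%E.
  apply: lime_ge; first by apply/cvg_ex; exists 0%E.
  by apply: nearW => k; rewrite intf ltW.
by rewrite (cvg_lim _ cvI)// lee_fin leNgt eps0.
Unshelve. all: by end_near. Qed.

End TupleMeasure.

(** * Sampling on a grid *)

Section HasIntegral.
Context d (X : measurableType d) (R : realType).
Variables (mu : {measure set X -> \bar R}) (C : set X).
Hypotheses (mC : measurable C) (Cfin : (mu C < +oo)%E).

(** Integrability and value travel together, so that an inequality between finite combinations of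
    counts can be integrated over the cell term by term. *)
Definition has_integral (g : X -> R) (c : R) : Prop :=
  mu.-integrable C (EFin \o g) /\ \int[mu]_(x in C) g x = c.

Lemma has_integral_indic (F : set X) : measurable F ->
  has_integral (fun x => (x \in F)%:R) (fine (mu (F `&` C))).
Proof.
move=> mF; have h : mu.-integrable C (EFin \o \1_F).
  apply/integrableP; split.
    by apply/measurable_EFinP; exact: measurable_indic.
  under eq_integral => x _ do rewrite gee0_abs ?lee_fin//.
  rewrite integral_indic//; apply: le_lt_trans Cfin.
  by apply: le_measure; rewrite ?inE//; exact: measurableI.
rewrite (_ : (fun x => (x \in F)%:R) = \1_F :> (X -> R)); last first.
  by apply: funext => x; rewrite indicE.
by split => //; rewrite /Rintegral integral_indic.
Qed.

Lemma has_integralD g h c e : has_integral g c -> has_integral h e ->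
  has_integral (fun x => g x + h x) (c + e).
Proof.
move=> [ig <-] [ih <-]; split; last by rewrite RintegralD.
exact: (integrableD mC ig ih).
Qed.

Lemma has_integralZ k g c : has_integral g c -> has_integral (fun x => k * g x) (k * c).
Proof.
move=> [ig <-]; split; last by rewrite RintegralZl.
exact: (integrableZl mC k ig).
Qed.

Lemma has_integral_cst k : has_integral (fun=> k) (k * fine (mu C)).
Proof.
split; last by rewrite Rintegral_cst.
apply/integrableP; split; first exact: measurable_cst.
rewrite /= integral_cst//; apply: lte_mul_pinfty => //.
Qed.

Lemma has_integral_sum (I : Type) (r : seq I) (g : I -> X -> R) (c : I -> R) :
  (forall i, has_integral (g i) (c i)) ->
  has_integral (fun x => \sum_(i <- r) g i x) (\sum_(i <- r) c i).
Proof.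
move=> h; elim: r => [|i r IH].
  rewrite big_nil -[X in has_integral _ X](mul0r (fine (mu C))).
  rewrite (_ : (fun _ => _) = fun=> 0); first exact: has_integral_cst.
  by apply: funext => x; rewrite big_nil.
rewrite big_cons (_ : (fun _ => _) = fun x => g i x + \sum_(j <- r) g j x).
  exact: has_integralD.
by apply: funext => x; rewrite big_cons.
Qed.

Lemma has_integral_avg (I : finType) (g : I -> X -> R) (c : I -> R) :
  (forall i, has_integral (g i) (c i)) ->
  has_integral (fun x => avg (g ^~ x)) (avg c).
Proof.
move=> h; rewrite /avg mulrC (_ : (fun _ => _) = fun x => #|I|%:R^-1 * \sum_i g i x).
  by apply: has_integralZ; exact: has_integral_sum.
by apply: funext => x; rewrite mulrC.
Qed.

Lemma le_has_integral g h c e : has_integral g c -> has_integral h e ->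
  (forall x, C x -> g x <= h x) -> c <= e.
Proof. by move=> [ig <-] [ih <-] gh; exact: le_Rintegral. Qed.

End HasIntegral.

Section Grid.
Variable R : realType.
Local Notation mR := (measurableTypeR R).
Variables (n Nt : nat) (h : R).
Hypothesis h0 : 0 < h.

Definition gvec (k : 'rV['I_Nt.+1]_n) (i : 'I_n) : R := h * (k ord0 i)%:R.

Definition cell : set (n.-tuple mR) := [set t | forall i, 0 <= (tnth t i : R) < h].

Definition grid_box : set (n.-tuple mR) :=
  [set t | forall i, 0 <= (tnth t i : R) < h * Nt.+1%:R].

Definition gcell (k : 'rV['I_Nt.+1]_n) : set (n.-tuple mR) :=
  [set t | forall i, gvec k i <= (tnth t i : R) < gvec k i + h].

Lemma measurable_obox (a : 'I_n -> R) (r : R) :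
  measurable [set t : n.-tuple mR | forall i, a i <= (tnth t i : R) < a i + r].
Proof.
rewrite (_ : [set t | _] = \bigcap_(i in [set: 'I_n])
  ((fun t : n.-tuple mR => tnth t i) @^-1` `[a i, a i + r[%classic)); last first.
  apply/seteqP; split => t /= ht i; first by move=> _ /=; rewrite in_itv/= ht.
  by have := ht i Logic.I; rewrite /= in_itv.
apply: fin_bigcap_measurable => [|i _]; first exact: finite_finset.
rewrite -[X in measurable X]setTI.
by apply: measurable_tnth => //; exact: measurable_itv.
Qed.

Lemma measurable_cell : measurable cell.
Proof.
rewrite (_ : cell = [set t : n.-tuple mR | forall i, (fun=> 0) i <= (tnth t i : R) < (fun=> 0) i + h]).
  exact: measurable_obox.
by apply/seteqP; split => t ht i; have := ht i; rewrite /= add0r.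
Qed.

Lemma preimage_gcell k : ttrans (gvec k) @^-1` gcell k = cell.
Proof.
apply/seteqP; split => t ht i; have := ht i; rewrite tnth_mktuple.
  by rewrite lerDr addrC ltrD2l.
by move=> ht'; rewrite lerDr addrC ltrD2l.
Qed.

Lemma gcell_trivIset : trivIset setT gcell.
Proof.
move=> k l _ _ [t [tk tl]]; apply/rowP => i; apply/val_inj => /=.
have := tk i; have := tl i; rewrite /gvec => /andP[l1 l2] /andP[k1 k2].
have cmp (p q : nat) : h * p%:R <= (tnth t i : R) -> (tnth t i : R) < h * q%:R + h -> (p <= q)%N.
  move=> hp hq; rewrite -ltnS -(ltr_nat R) -(ltr_pM2l h0).
  by apply: le_lt_trans hp _; rewrite -natr1 mulrDr mulr1.
by apply/eqP; rewrite eqn_leq !cmp.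
Qed.

Lemma grid_box_cover : grid_box `<=` \bigcup_k gcell k.
Proof.
move=> t ht.
have hi i : (Num.truncn ((tnth t i : R) / h) < Nt.+1)%N.
  have /andP[t0 t1] := ht i; rewrite truncn_lt_nat ?divr_ge0 ?(ltW h0)//.
  by rewrite ltr_pdivrMr// mulrC.
exists (\row_i Ordinal (hi i)) => // i; rewrite /gvec mxE /=.
have /andP[t0 t1] := ht i; have th0 : 0 <= (tnth t i : R) / h by rewrite divr_ge0 ?(ltW h0).
have /andP[] := truncn_itv th0; rewrite ler_pdivlMr// ltr_pdivrMr// -natr1 mulrDl mul1r.
by rewrite ![_ * h]mulrC => -> ->.
Qed.

Variable mu : {measure set (n.-tuple mR) -> \bar R}.
Hypothesis mutr : forall v E, measurable E -> mu (ttrans v @^-1` E) = mu E.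

Lemma mu_cell_gcell k F : measurable F ->
  mu (ttrans (gvec k) @^-1` F `&` cell) = mu (F `&` gcell k).
Proof.
move=> mF; rewrite -(preimage_gcell k) -preimage_setI mutr//.
by apply: measurableI => //; exact: measurable_obox.
Qed.

Lemma sum_mu_gcell F : measurable F ->
  (\sum_k mu (F `&` gcell k) = mu (F `&` \bigcup_k gcell k))%E.
Proof.
move=> mF; rewrite setI_bigcupr measure_fin_bigcup.
- rewrite fsbig_seq ?index_enum_uniq//; apply: eq_fsbigl => /=.
  by apply/seteqP; split => k //= _; rewrite mem_index_enum.
- exact: finite_finset.
- by apply: trivIset_setIl; exact: gcell_trivIset.
- by move=> k _; apply: measurableI => //; exact: measurable_obox.
Qed.

Definition point (x : n.-tuple mR) (k : 'rV['I_Nt.+1]_n) : n.-tuple mR :=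
  ttrans (gvec k) x.

Definition grid_mass (F : set (n.-tuple mR)) : R :=
  avg (fun k => fine (mu (F `&` gcell k))).

Hypothesis cell_fin : (mu cell < +oo)%E.

(** The translates of the cell by the grid vectors are the disjoint sets [gcell k]; averaging over
    the position [x] of the grid therefore turns counting into measuring. *)
Lemma has_integral_count F : measurable F ->
  has_integral mu cell (fun x => avg (fun k => (point x k \in F)%:R)) (grid_mass F).
Proof.
move=> mF; apply: (has_integral_avg measurable_cell cell_fin) => k.
rewrite -mu_cell_gcell//.
have mtF : measurable (ttrans (gvec k) @^-1` F).
  by rewrite -[X in measurable X]setTI; exact: measurable_ttrans.
exact: (has_integral_indic measurable_cell cell_fin mtF).
Qed.

Lemma grid_massE F : measurable F -> (mu F < +oo)%E ->
  grid_mass F = fine (mu (F `&` \bigcup_k gcell k)) / #|{: 'rV['I_Nt.+1]_n}|%:R.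
Proof.
move=> mF Fin; rewrite /grid_mass /avg -sum_mu_gcell// sum_fine// => k _.
rewrite ge0_fin_numE//; apply: le_lt_trans Fin; apply: le_measure; rewrite ?inE//.
by apply: measurableI => //; exact: measurable_obox.
Qed.

Lemma grid_mass_le F : measurable F -> (mu F < +oo)%E ->
  grid_mass F <= fine (mu F) / #|{: 'rV['I_Nt.+1]_n}|%:R.
Proof.
move=> mF Fin; rewrite grid_massE// ler_wpM2r ?invr_ge0//.
have mU : measurable (\bigcup_k gcell k).
  by apply: fin_bigcup_measurable => [|k _]; [exact: finite_finset|exact: measurable_obox].
have le : (mu (F `&` \bigcup_k gcell k) <= mu F)%E.
  by apply: le_measure; rewrite ?inE//; exact: measurableI.
by rewrite fine_le// ge0_fin_numE// (le_lt_trans le).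
Qed.

Lemma grid_mass_box F : measurable F -> (mu F < +oo)%E -> F `<=` grid_box ->
  grid_mass F = fine (mu F) / #|{: 'rV['I_Nt.+1]_n}|%:R.
Proof.
move=> mF Fin FG; rewrite grid_massE// setIidl//.
exact: subset_trans FG grid_box_cover.
Qed.
End Grid.

(** * Steps on the cyclic grid that do not wrap around *)

Section ZpStep.
Variable N : nat.

Lemma Zp_step_nat (z : 'I_N.+1) (c : nat) : (z + c <= N)%N ->
  val (z + inord 1 *+ c) = (z + c)%N.
Proof.
elim: c => [|c IH] zc; first by rewrite mulr0n addr0 addn0.
rewrite mulrSr addrA.
transitivity ((val (z + inord 1 *+ c)%R + val (inord 1 : 'I_N.+1)) %% N.+1)%N => //.
rewrite IH /=; last by apply: leq_trans zc; rewrite addnS.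
by rewrite inordK ?modn_small//; move: zc; rewrite addnS; lia.
Qed.

Lemma Zp_step (z : 'I_N.+1) (c : int) : 0 <= z%:Z + c <= N%:Z ->
  (val (z + inord 1 *~ c))%:Z = z%:Z + c.
Proof.
case: (intP c) => [|m|m] zc.
- by rewrite mulr0z !addr0.
- by rewrite -pmulrn Zp_step_nat ?PoszD//; lia.
rewrite mulrNz -pmulrn.
have mz : (m.+1 <= z)%N by lia.
pose w : 'I_N.+1 := inord (z - m.+1).
have wE : (w : nat) = (z - m.+1)%N by rewrite inordK//; have := ltn_ord z; lia.
have zE : z = w + inord 1 *+ m.+1.
  by apply/val_inj; rewrite Zp_step_nat wE subnK// -ltnS.
rewrite {1}zE addrK /= wE; lia.
Qed.
End ZpStep.

Section Sampling.
Variable R : realType.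
Local Notation mR := (measurableTypeR R).
Variables (n Nt : nat) (h : R).
Hypothesis h0 : 0 < h.

(** [inord 1] is a generator of the cyclic group; for [Nt = 0] it is the default value 0. *)
Definition gunit (i : 'I_n) : 'rV['I_Nt.+1]_n :=
  \row_l (if l == i then inord 1 else 0).

Lemma gunit_stepE (k : 'rV['I_Nt.+1]_n) i (c : int) l :
  (k + gunit i *~ c) ord0 l = if l == i then k ord0 l + inord 1 *~ c else k ord0 l.
Proof.
have E : (gunit i *~ c) ord0 l = gunit i ord0 l *~ c.
  by case: (intP c) => [|m|m]; rewrite ?mulr0z ?mulrNz -?pmulrn !mxE ?mulmxnE ?mxE.
rewrite mxE E mxE; case: eqP => // _.
by rewrite mul0rz addr0.
Qed.

Lemma tnth_point (x : n.-tuple mR) (k : 'rV['I_Nt.+1]_n) l :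
  tnth (point h x k) l = (tnth x l : R) + h * (k ord0 l)%:R.
Proof. by rewrite tnth_mktuple. Qed.

Lemma point_step (x : n.-tuple mR) (k : 'rV['I_Nt.+1]_n) i (c : int) (mg hi : R) :
  @cell R n h x -> mg <= (tnth (point h x k) i : R) < hi ->
  `|c|%:~R * h <= mg -> hi + mg <= h * Nt.+1%:R ->
  forall l, (tnth (point h x (k + gunit i *~ c)) l : R) =
    tnth (point h x k) l + (if l == i then h * c%:~R else 0).
Proof.
move=> xc pk cm hm l; rewrite !tnth_point gunit_stepE.
case: eqP => [->|_]; last by rewrite addr0.
have /andP[x0 x1] := xc i; move: pk; rewrite tnth_point => /andP[p1 p2].
have cR : - (`|c|%:~R) <= c%:~R :> R /\ c%:~R <= `|c|%:~R :> R.
  by rewrite -mulrNz !ler_int; split; lia.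
have [c1 c2] := cR.
have c1h : - (`|c|%:~R * h) <= c%:~R * h by rewrite -mulNr ler_wpM2r// ltW.
have c2h : c%:~R * h <= `|c|%:~R * h by rewrite ler_wpM2r// ltW.
have bnd : 0 <= (k ord0 i)%:Z + c <= Nt%:Z.
  apply/andP; split.
    rewrite -ltzD1 -(ltr_int R) -(ltr_pM2l h0) !intrD -!pmulrn mulr0.
    by rewrite !mulrDr mulr1 [h * c%:~R]mulrC; lra.
  rewrite -ltzD1 -(ltr_int R) -(ltr_pM2l h0) !intrD -!pmulrn -natr1 in hm *.
  by move: hm; rewrite !mulrDr mulr1 [h * c%:~R]mulrC; lra.
have := Zp_step bnd => /(congr1 (fun z : int => z%:~R : R)); rewrite intrD -!pmulrn => ->.
by rewrite mulrDr addrA.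
Qed.
End Sampling.

(** * Finding a pattern by averaging over the position of the grid *)

Section Pattern.
Variable R : realType.
Local Notation mR := (measurableTypeR R).
Variables (n Nt p Q K : nat) (h : R).
Hypotheses (h0 : 0 < h) (p0 : (0 < p)%N) (Q16 : (16 <= Q)%N) (QK : (Q + 4 <= K)%N).
Variable ie : 'I_p -> 'I_n.+1.
Variable iu : 'I_n.+1.

Let T := 'rV['I_Nt.+1]_n.+1.

(* The exact height of the last leg is not on the grid of mesh [h]: its endpoint
   is a grid point translated by [offset], which lies in [0, h]. *)
Definition offset (j : nat) (a : {ffun 'I_p -> 'I_(side p Q K j) * 'I_(side p Q K j)}) (t : int) : R :=
  h * (arc (radius R a) t%:~R - (height R a t)%:~R).

Definition pattern_in (E : set (n.+1.-tuple mR)) : Prop :=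
  exists x : n.+1.-tuple mR, exists k : T, exists j : nat,
  exists a : {ffun 'I_p -> 'I_(side p Q K j) * 'I_(side p Q K j)},
  exists w : ('I_(depth p Q K j) * 'I_(width p Q K j)) * ('I_(depth p Q K j) * 'I_(width p Q K j)),
  [/\ @cell R n.+1 h x, (j < Q)%N /\ long_legs a, E (point h x k),
    forall i, E (point h x (k + gunit Nt (ie i) *~ leg a i)) &
    E (ttrans (shift0 (offset a (tval w)))
      (point h x (k + (gunit Nt iu *~ tval w + gunit Nt ord0 *~ height R a (tval w)))))].

Lemma offset_itv j (a : {ffun 'I_p -> 'I_(side p Q K j) * 'I_(side p Q K j)}) t :
  0 <= offset a t <= h.
Proof.
rewrite /offset /height; have := floor_itv (arc (radius R a) t%:~R).
rewrite intrD => /andP[f1 f2]; apply/andP; split; first by rewrite mulr_ge0 ?(ltW h0)// subr_ge0.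
by rewrite ler_piMr ?(ltW h0)//; lra.
Qed.

(** If there is no pattern, then at every position [x] the grid density of [E] is at most [d] plus
    two error terms measuring how much [E] changes under translations by at most [h]. Integrated
    over the cell, this contradicts the last hypothesis. *)
Lemma sampled_pattern (mu : {measure set (n.+1.-tuple mR) -> \bar R})
    (E : set (n.+1.-tuple mR)) (d c omega : R) :
  (forall v F, measurable F -> mu (ttrans v @^-1` F) = mu F) ->
  (mu (@cell R n.+1 h) < +oo)%E -> measurable E -> (mu E < +oo)%E ->
  E `<=` @grid_box R n.+1 Nt h -> (forall t, E t -> h <= (tnth t ord0 : R)) ->
  0 <= d -> c = d / 2 * (d / (2 * p.+1%:R)) ^+ p.+1 -> 0 < c <= 1 ->
  p.+1%:R / Q%:R <= c ^+ 2 / 512 ->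
  (forall s, 0 <= s <= h -> fine (mu (sdiff (ttrans (shift0 s) @^-1` E) E)) <= omega) ->
  d * fine (mu (@cell R n.+1 h)) * #|{: T}|%:R + (Q%:R ^+ 2 + 4 / c * Q%:R) * omega
    < fine (mu E) ->
  pattern_in E.
Proof.
move=> mutr cfin mE Efin EG Eh d0 cE c01 Qc Hom main; apply: contrapT => nopat.
have /andP[c0 c1] := c01.
have Q0 : (0 < Q)%N by apply: leq_trans Q16.
have K0 : (0 < K)%N by apply: leq_trans QK; rewrite addn4.
have Qr : 0 < Q%:R :> R by rewrite ltr0n.
have T0 : (0 < #|{: T}|)%N by apply/card_gt0P; exists 0.
pose F s := sdiff (ttrans (shift0 s) @^-1` E) E.
have mtr s : measurable (ttrans (shift0 s) @^-1` E).
  by rewrite -[X in measurable X]setTI; exact: measurable_ttrans.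
have mF s : measurable (F s) by exact: measurable_sdiff.
have Ffin s : (mu (F s) < +oo)%E.
  apply: (@le_lt_trans _ _ (mu E + mu E)%E); last by rewrite lte_add_pinfty.
  apply: (le_trans (measureU2 _ _ _)); [exact: measurableD|exact: measurableD|].
  rewrite -{1}(mutr (shift0 s) E mE).
  by apply: leeD; apply: le_measure; rewrite ?inE//; try exact: subDsetl; exact: measurableD.
pose f (x : n.+1.-tuple mR) (k : T) : R := (point h x k \in E)%:R.
pose D s x := avg (fun k : T => (point h x k \in F s)%:R : R).
pose err x := \sum_(j < Q) avg (fun a : {ffun 'I_p -> 'I_(side p Q K j) * 'I_(side p Q K j)} => avg (fun w :
  ('I_(depth p Q K j) * 'I_(width p Q K j)) * ('I_(depth p Q K j) * 'I_(width p Q K j)) =>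
    D (offset a (tval w)) x)).
have D0 s x : 0 <= D s x by apply: avg_ge0.
have err0 x : 0 <= err x.
  by apply: sumr_ge0 => j _; apply: avg_ge0 => a; apply: avg_ge0 => w; exact: D0.
have pointwise x : @cell R n.+1 h x ->
    avg (f x) <= d + (Q%:R ^+ 2 * D h x + 4 / c * err x).
  move=> xc.
  have f1 : avg (f x) <= 1 by apply: avg_le_cst => // k; rewrite lern1 leq_b1.
  have c4 : 0 < 4 / c by rewrite divr_gt0.
  have Q2D : 0 <= Q%:R ^+ 2 * D h x by rewrite mulr_ge0// exprn_ge0.
  have cerr : 0 <= 4 / c * err x by rewrite mulr_ge0// ltW.
  have [lt|df] := ltP (avg (f x)) d; first by lra.
  (* If a shift by [h] changes more than [Q ^ -2] of the grid points, the first error term alone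
     exceeds 1. *)
  have [Dle|Dgt] := leP (D h x) (Q%:R ^+ 2)^-1; last first.
    have Q2r : 0 < Q%:R ^+ 2 :> R by rewrite exprn_gt0.
    by move: Dgt; rewrite -(ltr_pM2l Q2r) divff ?gt_eqF//; lra.
  pose A : {set T} := [set k | point h x k \in E]%SET.
  have fA k : f x k = (k \in A)%:R by rewrite inE.
  have dA : d <= avg (fun k : T => (k \in A)%:R : R).
    by rewrite (eq_avg (G := f x)).
  have lip : avg (fun k : T => `|(k + gunit Nt ord0 \in A)%:R - (k \in A)%:R| : R) <= (Q%:R ^+ 2)^-1.
    apply: le_trans Dle; apply: le_avg => k.
    have step : (k + gunit Nt ord0 \in A) = (ttrans (shift0 h) (point h x k) \in E).
      rewrite inE; have k0 := ltn_ord (k ord0 ord0); have /andP[x0 xh] := xc ord0.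
      have gE l : (k + gunit Nt ord0) ord0 l = if l == ord0 then k ord0 l + inord 1 else k ord0 l.
        by rewrite -[gunit Nt ord0]mulr1z gunit_stepE mulr1z.
      have [kN|Nk] := ltnP (k ord0 ord0) Nt.
        congr (_ \in E); apply: eq_from_tnth => l.
        rewrite [RHS]tnth_mktuple !tnth_point gE /shift0; case: eqP => [->|_]; last by rewrite addr0.
        have := @Zp_step_nat Nt (k ord0 ord0) 1; rewrite mulr1n addn1 => /(_ kN) ->.
        by rewrite -natr1 mulrDr mulr1 addrA.
      (* On the last layer the cyclic step wraps to a first coordinate below [h], where [E] has no
         point, and the true translation leaves the grid box: both sides are false. *)
      have kE : (k ord0 ord0 : nat) = Nt by apply/eqP; rewrite eqn_leq Nk -ltnS k0.
      transitivity false.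
        apply/negP; rewrite in_setE => /Eh; rewrite tnth_point gE eqxx.
        have -> : (k ord0 ord0 + inord 1 : 'I_Nt.+1) = 0.
          apply/val_inj => /=; rewrite kE.
          case: (posnP Nt) => [->|N0]; first by rewrite modn1.
          by rewrite inordK// addn1 modnn.
        by rewrite mulr0 addr0 leNgt xh.
      apply/esym/negP; rewrite in_setE => /EG /(_ ord0).
      rewrite tnth_mktuple tnth_point /shift0 eqxx kE -natr1 mulrDr mulr1 => /andP[_].
      by rewrite -addrA ltNge lerDr x0.
    rewrite step /A inE.
    case: (boolP (point h x k \in F h)) => [_|].
      by do 2 case: (_ \in E); rewrite ?subrr ?subr0 ?sub0r ?normrN ?normr0 ?normr1.
    move/negP; rewrite in_setE /F /sdiff /= => nF.
    have -> : (ttrans (shift0 h) (point h x k) \in E) = (point h x k \in E).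
      apply/idP/idP; rewrite !in_setE => hE; apply: contrapT => nE; apply: nF.
        by left.
      by right.
    by rewrite subrr normr0.
  have [j jQ hj] := multi_scale Q0 K0 (fun i => gunit Nt (ie i)) (gunit Nt iu) p0 Q16 QK d0 dA cE c01 Qc lip.
  (* Every star counted by [multi_scale] has its rounded endpoint in [E]. Since it is no pattern,
     the exact endpoint is outside [E], so the rounded one lies in the symmetric difference [F] for
     its offset. *)
  have : c / 4 <= err x.
    apply: (le_trans hj); rewrite /err (bigD1 (Ordinal jQ))//=.
    rewrite -[X in X <= _]addr0; apply: lerD; last first.
      by apply: sumr_ge0 => l _; apply: avg_ge0 => a; apply: avg_ge0 => w; exact: D0.
    apply: le_avg => a; apply: le_avg => w.
    set z : T := gunit Nt iu *~ tval w + gunit Nt ord0 *~ height R a (tval w).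
    rewrite /D -(avg_shift z (fun k => (point h x k \in F (offset a (tval w)))%:R)); apply: le_avg => k.
    have /andP[s0 s1] := star01 R (fun i => gunit Nt (ie i)) A a k.
    case: (boolP (point h x (k + z) \in F (offset a (tval w)))) => [_|].
      have b01 (b : bool) : 0 <= (b%:R : R) <= 1 by case: b; rewrite ?lexx ?ler01.
      have /andP[l0 l1] := b01 (long_legs a); have /andP[b0 b1] := b01 (k + z \in A).
      rewrite [leRHS](_ : _ = 1)//; apply: mulr_ile1 => //; first exact: mulr_ge0.
      exact: mulr_ile1.
    move/negP; rewrite in_setE /F /sdiff /= => nF.
    case: (boolP (long_legs a)) => [la|_]; last by rewrite !mul0r.
    rewrite mul1r; case: (boolP (k + z \in A)); last by rewrite mulr0.
    rewrite inE in_setE mulr1 => kz.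
    rewrite /star; case: (boolP (k \in A)); last by rewrite mul0r.
    rewrite inE in_setE mul1r => kA.
    case: (boolP [forall i, k + gunit Nt (ie i) *~ leg a i \in A]) => [/forallP all|].
      exfalso; apply: nopat; exists x, k, j, a, w; split => //.
        by move=> i; have := all i; rewrite inE in_setE.
      by apply: contrapT => nE; apply: nF; right.
    rewrite negb_forall => /existsP[i /negbTE hi].
    by rewrite (bigD1 i)//= hi mul0r.
  move=> cx; have := ler_wpM2l (ltW c4) cx.
  rewrite (_ : 4 / c * (c / 4) = 1); last by field; rewrite gt_eqF.
  lra.
have hcount G : measurable G -> has_integral mu (@cell R n.+1 h)
    (fun x => avg (fun k : T => (point h x k \in G)%:R)) (@grid_mass R n.+1 Nt h mu G).
  by move=> mG; exact: has_integral_count.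
have hD s : has_integral mu (@cell R n.+1 h) (D s) (@grid_mass R n.+1 Nt h mu (F s)) by exact: hcount.
have mC := @measurable_cell R n.+1 h.
pose gm s := @grid_mass R n.+1 Nt h mu (F s).
have hfun := has_integralD mC (has_integral_cst mC cfin d)
  (has_integralD mC (has_integralZ mC (Q%:R ^+ 2) (hD h))
    (has_integralZ mC (4 / c) (has_integral_sum mC cfin (index_enum 'I_Q) (fun j : 'I_Q =>
      has_integral_avg mC cfin (fun a : {ffun 'I_p -> 'I_(side p Q K j) * 'I_(side p Q K j)} =>
        has_integral_avg mC cfin (fun w :
  ('I_(depth p Q K j) * 'I_(width p Q K j)) * ('I_(depth p Q K j) * 'I_(width p Q K j)) =>
          hD (offset a (tval w)))))))).
have hf : has_integral mu (@cell R n.+1 h) (fun x => avg (f x)) (@grid_mass R n.+1 Nt h mu E).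
  exact: hcount.
have := le_has_integral mC hf hfun pointwise.
have Tr : 0 < #|{: T}|%:R :> R by rewrite ltr0n.
rewrite (grid_mass_box h0 mE Efin EG).
have gmle s : 0 <= s <= h -> gm s <= omega / #|{: T}|%:R.
  move=> sh; apply: le_trans (grid_mass_le Nt h0 (mF s) (Ffin s)) _.
  by rewrite ler_wpM2r ?invr_ge0// Hom.
have om0 : 0 <= omega / #|{: T}|%:R.
  have h1 : 0 <= h <= h by rewrite lexx (ltW h0).
  by rewrite divr_ge0// (le_trans _ (Hom h h1))// fine_ge0.
apply/negP; rewrite -ltNge.
set S := \sum_(j <- _) _.
have Sle : S <= Q%:R * (omega / #|{: T}|%:R).
  apply: (@le_trans _ _ (\sum_(j < Q) (omega / #|{: T}|%:R))); last first.
    by rewrite sumr_const card_ord [X in _ <= X]mulr_natl.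
  apply: ler_sum => j _; apply: avg_le_cst => // a; apply: avg_le_cst => // w.
  by apply: gmle; exact: offset_itv.
have h1 : gm h <= omega / #|{: T}|%:R by apply: gmle; rewrite lexx (ltW h0).
have h2 : Q%:R ^+ 2 * gm h <= Q%:R ^+ 2 * (omega / #|{: T}|%:R).
  by rewrite ler_wpM2l// exprn_ge0.
have h3 : 4 / c * S <= 4 / c * (Q%:R * (omega / #|{: T}|%:R)).
  by rewrite ler_wpM2l// divr_ge0// ltW.
rewrite ltr_pdivlMr//.
apply: (@le_lt_trans _ _ ((d * fine (mu (@cell R n.+1 h)) +
   (Q%:R ^+ 2 * (omega / #|{: T}|%:R) + 4 / c * (Q%:R * (omega / #|{: T}|%:R)))) * #|{: T}|%:R)).
  by rewrite ler_wpM2r ?(ltW Tr)//; rewrite /gm in h2; lra.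
apply: le_lt_trans main; rewrite le_eqVlt; apply/orP; left; apply/eqP.
by field; rewrite !gt_eqF.
Qed.
End Pattern.

(** * Right-angled stars *)

Section Geometry.
Variable R : realType.

Definition star_vertices (n p : nat) (x0 : 'rV[R]_n) (d : 'I_p -> 'rV[R]_n)
    (i : 'I_p.+1) : 'rV[R]_n :=
  if unlift ord0 i is Some l then x0 + d l else x0.

Lemma star_verticesB n p (x0 : 'rV[R]_n) (d : 'I_p -> 'rV[R]_n) l :
  star_vertices x0 d (lift ord0 l) - star_vertices x0 d ord0 = d l.
Proof. by rewrite /star_vertices liftK unlift_none addrC addKr. Qed.

Lemma row_free_orthogonal n p (d : 'I_p -> 'rV[R]_n) :
  (forall i, dot (d i) (d i) != 0) ->
  (forall i j, i != j -> dot (d i) (d j) = 0) ->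
  row_free (\matrix_(i < p) d i).
Proof.
move=> d0 dij; set D := \matrix_i _; apply/row_freeP.
exists (D^T *m diag_mx (\row_j (dot (d j) (d j))^-1)).
apply/matrixP => i j; rewrite mulmxA mul_mx_diag !mxE.
have -> : \sum_k D i k * D^T k j = dot (d i) (d j).
  by apply: eq_bigr => k _; rewrite !mxE.
by case: eqVneq => [->|/dij ->]; rewrite ?divff// mul0r.
Qed.

Lemma right_angled_star n p (x0 : 'rV[R]_n) (d : 'I_p -> 'rV[R]_n) :
  (forall i, dot (d i) (d i) != 0) ->
  (forall i j, i != j -> dot (d i) (d j) = 0) ->
  right_angled_simplex (star_vertices x0 d) ord0 /\
  right_angled_volume (star_vertices x0 d) ord0 = (\prod_i enorm (d i)) / p`!%:R.
Proof.
move=> d0 dij; split; last first.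
  rewrite /right_angled_volume; congr (_ / _).
  rewrite big_mkcond big_ord_recl eqxx /= mul1r; apply: eq_bigr => i _.
  by rewrite star_verticesB.
split.
  rewrite /simplex (_ : (\matrix_i _) = \matrix_i d i); first exact: row_free_orthogonal.
  by apply/matrixP => i j; rewrite !mxE -[in RHS](star_verticesB x0 d) !mxE.
move=> i j; case: (unliftP ord0 i) => [i' ->|->]; last by rewrite eqxx.
case: (unliftP ord0 j) => [j' ->|->]; last by rewrite eqxx.
by move=> _ _; rewrite (inj_eq lift_inj) !star_verticesB; exact: dij.
Qed.

Lemma dot_delta n (a b : R) (i j : 'I_n) :
  dot (a *: delta_mx ord0 i) (b *: delta_mx ord0 j) = if i == j then a * b else 0.
Proof.
rewrite /dot (bigD1 i)//= big1 ?addr0 => [|l li]; rewrite !mxE !eqxx/=.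
  by rewrite mulr1; case: eqP => _; rewrite ?mulr1 ?mulr0.
by rewrite (negbTE li) mulr0 mul0r.
Qed.

Lemma dotDl n (u v w : 'rV[R]_n) : dot (u + v) w = dot u w + dot v w.
Proof. by rewrite /dot -big_split; apply: eq_bigr => i _; rewrite mxE mulrDl. Qed.

Lemma dotC n (u v : 'rV[R]_n) : dot u v = dot v u.
Proof. by apply: eq_bigr => i _; rewrite mulrC. Qed.

Section Edges.
Variables (n p : nat) (ie : 'I_p -> 'I_n) (iu iv : 'I_n) (b : 'I_p -> R) (s t r : R).
Hypotheses (ie_inj : injective ie) (ieu : forall i, ie i != iu)
  (iev : forall i, ie i != iv) (iuv : iu != iv).
Hypotheses (b0 : forall i, b i != 0) (r0 : 0 < r) (str : s ^+ 2 + t ^+ 2 = r ^+ 2).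

Definition edge (i : 'I_p.+1) : 'rV[R]_n :=
  if unlift ord_max i is Some l then b l *: delta_mx ord0 (ie l)
  else s *: delta_mx ord0 iu + t *: delta_mx ord0 iv.

Definition edge_len (i : 'I_p.+1) : R :=
  if unlift ord_max i is Some l then `|b l| else r.

Lemma dot_edge i : dot (edge i) (edge i) = edge_len i ^+ 2.
Proof.
rewrite /edge /edge_len; case: unliftP => [l _|_].
  by rewrite dot_delta eqxx real_normK ?num_real.
rewrite dotDl ![dot _ (_ + _)]dotC !dotDl !dot_delta !eqxx.
by rewrite (negbTE iuv) eq_sym (negbTE iuv) addr0 add0r -!expr2.
Qed.

Lemma edge_len_gt0 i : 0 < edge_len i.
Proof. by rewrite /edge_len; case: unliftP => [l _|_//]; rewrite normr_gt0. Qed.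

Lemma enorm_edge i : enorm (edge i) = edge_len i.
Proof. by rewrite /enorm dot_edge sqrtr_sqr gtr0_norm// edge_len_gt0. Qed.

Lemma edge_orthogonal i j : i != j -> dot (edge i) (edge j) = 0.
Proof.
rewrite /edge; case: (unliftP ord_max i) => [k ->|->]; case: (unliftP ord_max j) => [l ->|->].
- by rewrite (inj_eq lift_inj) dot_delta (inj_eq ie_inj) => /negbTE ->.
- by move=> _; rewrite dotC dotDl !dot_delta ![_ == ie k]eq_sym (negbTE (ieu k)) (negbTE (iev k)) addr0.
- by move=> _; rewrite dotDl !dot_delta ![_ == ie l]eq_sym (negbTE (ieu l)) (negbTE (iev l)) addr0.
- by rewrite eqxx.
Qed.

Lemma prod_edge_len : \prod_i edge_len i = (\prod_i `|b i|) * r.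
Proof.
rewrite big_ord_recr /= {2}/edge_len unlift_none; congr (_ * _).
apply: eq_bigr => i _; rewrite /edge_len.
have -> : widen_ord (leqnSn p) i = lift ord_max i.
  by apply/val_inj; rewrite /= /bump leqNgt ltn_ord.
by rewrite liftK.
Qed.
End Edges.
End Geometry.

(** * From a grid pattern to edges of controlled length *)

Section Realize.
Variable R : realType.
Local Notation mR := (measurableTypeR R).

(** A bound for all legs in units of [K] meshes, uniform over the scales. As every leg is at least
    [K] meshes long, it also bounds their ratios. *)
Definition aspect (p Q : nat) : nat :=
  (8 * scale_base p Q ^ (p * Q + Q) * ratio_base p Q ^ 4 * Q ^ p.+1)%N.

Lemma aspect_bounds p Q K j : (16 <= Q)%N -> (0 < K)%N -> (j < Q)%N ->
  [/\ (side p Q K j <= K * aspect p Q)%N,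
      (depth p Q K j + width p Q K j <= K * aspect p Q)%N,
      (8 * depth p Q K j * Q ^ p <= K * aspect p Q)%N,
      (K <= K * scale_base p Q ^ j)%N &
      (K <= 8 * depth p Q K j)%N && (depth p Q K j + width p Q K j <= 8 * depth p Q K j)%N].
Proof.
move=> Q16 K0 jQ; have Q0 : (0 < Q)%N by apply: leq_trans Q16.
have N0 := ratio_base_gt0 p Q0; have M0 := scale_base_gt0 p Q0.
have WD : (width p Q K j <= depth p Q K j)%N.
  by rewrite /width /depth leq_mul2l leq_pexp2l ?orbT.
rewrite /aspect; move: WD; rewrite /side /width /depth /fine_len.
move: (scale_base p Q) (ratio_base p Q) M0 N0 => M N M0 N0 WD.
have MX e f : (e <= f)%N -> (M ^ e <= M ^ f)%N by move=> ef; rewrite leq_pexp2l.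
have D_le : (K * M ^ (p * (Q - j.+1)) * N ^ 4 <= K * (M ^ (p * Q + Q) * N ^ 4))%N.
  rewrite -mulnA leq_mul2l leq_mul2r MX ?orbT//.
  by apply: leq_trans (leq_addr _ _); rewrite leq_mul2l leq_subr orbT.
have QQ : (0 < Q ^ p)%N by rewrite expn_gt0 Q0.
have MQ : (0 < M ^ (p * Q + Q))%N by rewrite expn_gt0 M0.
have N4 : (0 < N ^ 4)%N by rewrite expn_gt0 N0.
have D8 : (8 * (K * M ^ (p * (Q - j.+1)) * N ^ 4) * Q ^ p <=
   K * (8 * M ^ (p * Q + Q) * N ^ 4 * Q ^ p.+1))%N.
  apply: (@leq_trans (8 * (K * (M ^ (p * Q + Q) * N ^ 4)) * Q ^ p.+1)).
    by apply: leq_mul; [rewrite leq_mul2l D_le orbT|rewrite leq_pexp2l].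
  by rewrite !mulnA [(8 * K)%N]mulnC.
have D2 : (K * M ^ (p * (Q - j.+1)) * N ^ 4 + K * M ^ (p * (Q - j.+1)) * N ^ 2
   <= 8 * (K * M ^ (p * (Q - j.+1)) * N ^ 4))%N.
  apply: (@leq_trans (2 * (K * M ^ (p * (Q - j.+1)) * N ^ 4))); last by rewrite leq_mul2r orbT.
  by rewrite mul2n -addnn leq_add2l.
split => //.
- rewrite -mulnA leq_mul2l; apply/orP; right; rewrite mulnC.
  apply: leq_mul; last by rewrite -[X in (X <= _)%N]expn1 leq_pexp2l.
  apply: (@leq_trans (M ^ (p * Q + Q))); last by rewrite mulnAC leq_pmull// muln_gt0 N4.
  by apply: MX; apply: leq_trans (ltnW jQ) _; rewrite leq_addl.
- by apply: (leq_trans D2); apply: leq_trans D8; rewrite leq_pmulr.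
- by rewrite leq_pmulr// expn_gt0 M0.
- by rewrite D2 andbT mulnC -!mulnA leq_pmulr// !muln_gt0 !expn_gt0 M0 N0.
Qed.

Variables (n Nt p Q K : nat) (h mg hi : R).
Hypotheses (h0 : 0 < h) (Q16 : (16 <= Q)%N) (K0 : (0 < K)%N).
Hypotheses (mgh : (K * aspect p Q)%:R * h <= mg) (himg : hi + mg <= h * Nt.+1%:R).
Variables (ie : 'I_p -> 'I_n.+1) (iu : 'I_n.+1).
Hypothesis iuv : iu != ord0.

(** The margin [mg] covers every displacement, so no step wraps around. The product of the lengths
    is constant because [radius] divides [total_vol] by the other legs. *)
Lemma pattern_realize (E : set (n.+1.-tuple mR)) :
  (forall t, E t -> forall l, mg <= (tnth t l : R) < hi) ->
  pattern_in Nt Q K h ie iu E ->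
  exists (x0 : 'rV[R]_n.+1) (b : 'I_p -> R) (s t r : R),
    [/\ (forall i, b i != 0) /\ 0 < r, s ^+ 2 + t ^+ 2 = r ^+ 2,
        exists2 y, E y & row_of_tuple y = x0,
        forall i, exists2 y, E y & row_of_tuple y = x0 + edge ie iu ord0 b s t i &
        (forall i, K%:R * h <= edge_len b r i <= (K * aspect p Q)%:R * h) /\
        \prod_i edge_len b r i = h ^+ p.+1 * (total_vol p Q K)%:R].
Proof.
move=> Ebox [x [k [j [a [w [xc [jQ la] Ek El Et]]]]]].
have Q0 : (0 < Q)%N by apply: leq_trans Q16.
have [B1 B2 B3 B4 /andP[B5 B6]] := aspect_bounds p Q16 K0 jQ.
have /andP[r1 r2] := radius_bounds R Q0 K0 jQ la.
have K0r : 0 < K%:R :> R by rewrite ltr0n.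
have Rad0 : 0 < radius R a.
  by apply: lt_le_trans r1; rewrite -(natrM _ 8) ltr0n (leq_trans K0).
set t := tval w; set Y := arc (radius R a) t%:~R.
have tB : `|t|%:~R <= (depth p Q K j + width p Q K j)%:R :> R.
  rewrite pmulrn ler_int; exact: normr_tval.
have tr : `|t%:~R| <= radius R a :> R.
  by apply: le_trans r1; rewrite -intr_norm -(natrM _ 8) (le_trans tB)// ler_nat.
have Y2 := sqr_arc tr; rewrite -/Y in Y2.
have Y0 : 0 <= Y by exact: sqrtr_ge0.
have YR : Y <= radius R a.
  rewrite -ler_sqr ?nnegrE ?(ltW Rad0)// Y2 lerBlDr lerDl; exact: sqr_ge0.
have hgtR : `|height R a t|%:~R <= (K * aspect p Q)%:R :> R.
  rewrite ger0_norm ?floor_ge0//; apply: le_trans (floor_le _) _.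
  apply: le_trans YR _; apply: le_trans r2 _.
  by rewrite -natrX -!natrM ler_nat.
have legR i : `|leg a i|%:~R <= (K * aspect p Q)%:R :> R.
  by rewrite pmulrn ler_int -abszE lez_nat; exact: leq_trans (leg_le Q0 K0 a i) B1.
have leglo i : (K <= `|leg a i|)%N by apply: (leq_trans B4); exact: (forallP la).
pose x0 : 'rV[R]_n.+1 := row_of_tuple (point h x k).
have scale (c : int) : `|c|%:~R <= (K * aspect p Q)%:R :> R -> `|c|%:~R * h <= mg.
  by move=> cB; apply: le_trans mgh; rewrite ler_wpM2r// ltW.
exists x0, (fun i => h * (leg a i)%:~R), (h * t%:~R), (h * Y), (h * radius R a).
have b0 i : h * (leg a i)%:~R != 0.
  apply: mulf_neq0; first by rewrite gt_eqF.
  by rewrite intr_eq0 -absz_eq0 -lt0n; exact: leq_trans K0 (leglo i).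
split.
- by split => //; rewrite mulr_gt0.
- by move: (Y) (radius R a) (t%:~R : R) Y2 => y r' t' y2; rewrite !exprMn y2; ring.
- by exists (point h x k).
- move=> i; rewrite /edge; case: unliftP => [l _|_].
    exists (point h x (k + gunit Nt (ie l) *~ leg a l)); first exact: El.
    apply/rowP => q; rewrite !mxE.
    rewrite (point_step h0 xc (Ebox _ Ek (ie l)) (scale _ (legR l)) himg).
    by rewrite eqxx /=; case: eqP => _; rewrite ?mulr1 ?mulr0.
  exists (ttrans (shift0 (offset h a t))
    (point h x (k + (gunit Nt iu *~ t + gunit Nt ord0 *~ height R a t)))); first exact: Et.
  apply/rowP => q; rewrite !mxE tnth_mktuple.
  have stepu := point_step h0 xc (Ebox _ Ek iu) (scale t (le_trans tB _)) himg.
  have {}stepu l : (tnth (point h x (k + gunit Nt iu *~ t)) l : R) =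
      tnth (point h x k) l + (if l == iu then h * t%:~R else 0).
    by apply: stepu; rewrite ler_nat.
  have box0 : mg <= (tnth (point h x (k + gunit Nt iu *~ t)) ord0 : R) < hi.
    by rewrite stepu eq_sym (negbTE iuv) addr0; exact: Ebox.
  have := point_step h0 xc box0 (scale _ hgtR) himg q.
  rewrite -addrA => ->; rewrite stepu /shift0 /offset eqxx /=.
  case: (eqVneq q iu) => [->|qu]; rewrite ?(negbTE iuv) ?mulr1 ?mulr0 ?addr0//.
  case: (eqVneq q ord0) => [->|q0]; rewrite ?mulr1 ?mulr0 ?addr0 ?add0r//.
  by rewrite -/t -/Y; ring.
- split.
    move=> i; rewrite /edge_len; case: unliftP => [l _|_].
      have -> : `|h * (leg a l)%:~R| = `|leg a l|%:~R * h.
        by rewrite normrM (gtr0_norm h0) mulrC intr_norm.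
      apply/andP; split; (apply: ler_wpM2r; first exact: ltW); last exact: legR.
      by rewrite pmulrn ler_int -abszE lez_nat leglo.
    rewrite [h * _]mulrC; apply/andP; split; (apply: ler_wpM2r; first exact: ltW).
      by apply: le_trans r1; rewrite -(natrM _ 8) ler_nat.
    by apply: le_trans r2 _; rewrite -natrX -!natrM ler_nat.
  rewrite prod_edge_len; under eq_bigr do rewrite normrM (gtr0_norm h0) -intr_norm.
  rewrite big_split prodr_const card_ord /= /radius.
  have P0 : \prod_i `|leg a i|%:~R != 0 :> R.
    by apply/prodf_neq0 => i _; rewrite intr_eq0 normr_eq0 -absz_eq0 -lt0n; exact: leq_trans K0 (leglo i).
  by rewrite exprSr; field.
Qed.
End Realize.

(** * Density and choice of constants *)

Section Density.
Variable R : realType.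
Local Notation mR := (measurableTypeR R).
Variables (n : nat) (mu : {sigma_finite_measure set (n.-tuple mR) -> \bar R}).
Hypotheses (muE : mu = @lebesgue_tuple R n :> (set _ -> \bar R))
  (mubox : forall a r, 0 <= r -> mu (tbox a r) = (r ^+ n)%:E).

Lemma preimage_cube (x : 'rV[R]_n) r :
  @row_of_tuple R n @^-1` cube x r = tbox (x ord0) r.
Proof.
apply/seteqP; split => t /=.
  move=> [y /= yr /rowP yE] i; have := yE i; rewrite !mxE => <-.
  by have := yr i; rewrite lerDl lerD2l.
move=> ht; exists (row_of_tuple t - x); last by rewrite addrC subrK.
by move=> i; have := ht i; rewrite !mxE; lra.
Qed.

Lemma vol_le_box (A : set 'rV[R]_n) x r : 0 <= r -> (vol (A `&` cube x r) <= (r ^+ n)%:E)%E.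
Proof.
move=> r0; rewrite /vol -muE -(mubox (x ord0) r0).
rewrite -(measurable_mu_extE mu (measurable_tbox _ _)).
by apply: le_mu_ext; rewrite preimage_setI preimage_cube; exact: subIsetr.
Qed.

(** [B] is the Borel part of the completed set, and the rest is covered by a null Borel set.
    Vertices can then be sought in [B] without loss of density. *)
Lemma lebesgue_measurable_core (A : set 'rV[R]_n) : lebesgue_measurable A ->
  exists B : set (n.-tuple mR), [/\ measurable B,
    forall t, B t -> A (row_of_tuple t) &
    forall x r, (vol (A `&` cube x r) <= mu (B `&` tbox (x ord0) r))%E].
Proof.
rewrite /lebesgue_measurable -muE => -[B mB [N [Z [mZ Z0 NZ]] BN]].
exists B; split => //.
  by move=> t Bt; have : (B `|` N) t by [left]; rewrite BN.
move=> x r; rewrite /vol -muE preimage_setI preimage_cube -BN.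
have mBb : measurable (B `&` tbox (x ord0) r).
  by apply: measurableI => //; exact: measurable_tbox.
apply: (@le_trans _ _ (mu_ext mu ((B `&` tbox (x ord0) r) `|` Z))).
  by apply: le_mu_ext => t [[Bt|Nt] bt]; [left|right; exact: NZ].
rewrite measurable_mu_extE; last exact: measurableU.
have hle : (mu (B `&` tbox (x ord0) r) + mu Z <= mu (B `&` tbox (x ord0) r))%E.
  by rewrite [mu Z]Z0 adde0.
exact: (le_trans (measureU2 mu mBb mZ) hle).
Qed.

Local Notation dens A r := (ereal_sup
       [set (vol (A `&` cube x r) * (r ^- n)%:E)%E | x in [set: 'rV[R]_n]]).

Lemma upper_Banach_density_le1 (A : set 'rV[R]_n) : (upper_Banach_density A <= 1)%E.
Proof.
rewrite /upper_Banach_density limf_esupE.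
apply: (@le_trans _ _ (ereal_sup ((fun r => dens A r) @` [set r | 0 < r]))).
  apply: ereal_inf_lbound; exists [set r | 0 < r] => //.
  exact: nbhs_pinfty_gt.
apply: ge_ereal_sup => _ [r /= r0 <-]; apply: ge_ereal_sup => _ [x _ <-].
apply: (@le_trans _ _ ((r ^+ n)%:E * (r ^- n)%:E)%E).
  by apply: lee_wpmul2r; [rewrite lee_fin invr_ge0 exprn_ge0// ltW|exact/vol_le_box/ltW].
by rewrite -EFinM divff// gt_eqF// exprn_gt0.
Qed.

Lemma upper_Banach_density_witness (A : set 'rV[R]_n) (d r0 : R) :
  (d%:E < upper_Banach_density A)%E ->
  exists r x, r0 < r /\ (d%:E < vol (A `&` cube x r) * (r ^- n)%:E)%E.
Proof.
move=> dlt; have : (d%:E < ereal_sup ((fun r => dens A r) @` [set r | (r0 < r)%R]))%E.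
  apply: lt_le_trans dlt _; rewrite /upper_Banach_density limf_esupE.
  apply: ereal_inf_lbound; exists [set r | r0 < r] => //; apply: nbhs_pinfty_gt; exact: num_real.
move=> /ereal_sup_gt[_ [r /= rr0 <-]] /ereal_sup_gt[_ [x _ <-]] h.
by exists r, x.
Qed.
End Density.

Section Constants.
Variable R : realType.

Lemma aspect_le p Q : (16 <= Q)%N -> (aspect p Q <= Q ^ (11 * (p.+2 ^ 2 * Q)))%N.
Proof.
move=> Q16; have Q0 : (0 < Q)%N by apply: leq_trans Q16.
rewrite /aspect /scale_base /ratio_base addn2 -!expnM.
(* With 8 bounded by [Q], the exponents of [Q] sum to at most [6 * y + 5 * y] for
   [y = (p + 2) ^ 2 * Q]. *)
set a := (p.+2 * (6 * (p * Q + Q)))%N; set b := (p.+2 * 4)%N.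
apply: (@leq_trans (Q ^ 1 * Q ^ a * Q ^ b * Q ^ p.+1)).
  by rewrite !leq_mul2r expn1 [(8 <= Q)%N](leq_trans _ Q16) ?orbT.
rewrite -!expnD; apply: leq_pexp2l => //; rewrite /a /b.
have : (p.+2 <= p.+2 ^ 2)%N by rewrite -[X in (X <= _)%N]expn1 leq_pexp2l.
have : (p.+2 ^ 2 <= p.+2 ^ 2 * Q)%N by rewrite leq_pmulr.
have : (p.+2 * (p * Q + Q) <= p.+2 ^ 2 * Q)%N.
  by rewrite -mulSnr mulnA leq_mul2r expnS expn1 leq_mul2l leqnSn !orbT.
rewrite [(p.+2 * (6 * _))%N]mulnCA.
move: (p.+2 * (p * Q + Q))%N (p.+2 ^ 2 * Q)%N (p.+2 ^ 2)%N => x y z.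
lia.
Qed.

Definition star_density (p : nat) (d : R) : R := d / 2 * (d / (2 * p.+1%:R)) ^+ p.+1.

Lemma scale_count (p : nat) : exists2 X : R, 0 < X &
  forall e, 0 < e <= 1 -> 0 < star_density p (e / 2) <= 1 /\
    exists Q, [/\ (16 <= Q)%N, p.+1%:R / Q%:R <= star_density p (e / 2) ^+ 2 / 512 &
      Q%:R <= X * e ^- (2 * p.+2)].
Proof.
(* [star_density p (e / 2)] equals [g * e ^ (p + 2)], so the condition asks for
   [Q >= Y * e ^ (- 2 (p + 2))]. The summand 17 pays for rounding up and for [16 <= Q]. *)
have q0 : 0 < p.+1%:R :> R by rewrite ltr0n.
pose g : R := 4^-1 * (4 * p.+1%:R)^-1 ^+ p.+1.
have g0 : 0 < g by rewrite mulr_gt0// exprn_gt0// invr_gt0 mulr_gt0.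
have [k kE k0] : exists2 k : R, k = 512 & 0 < k by exists 512; rewrite ?ltr0n.
rewrite -kE; pose Y : R := k * p.+1%:R / g ^+ 2.
have Y0 : 0 < Y by exact: divr_gt0 (mulr_gt0 k0 q0) (exprn_gt0 2 g0).
exists (Y + 17); first by lra.
move=> e /andP[e0 e1].
have cE : star_density p (e / 2) = g * e ^+ p.+2.
  rewrite /star_density /g [e ^+ p.+2]exprS (_ : e / 2 / (2 * p.+1%:R) = (4 * p.+1%:R)^-1 * e) ?exprMn; last first.
    by field; rewrite ?gt_eqF.
  by move: (_^-1 ^+ p.+1) (e ^+ p.+1) => u v; field.
have ep0 : 0 < e ^+ p.+2 by rewrite exprn_gt0.
split.
  have q1 : 1 <= p.+1%:R :> R by rewrite ler1n.
  have g1 : g <= 1.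
    apply: mulr_ile1; rewrite ?exprn_ge0 ?invr_ge0 ?mulr_ge0//; first by lra.
    by apply: exprn_ile1; rewrite ?invr_ge0 ?mulr_ge0// invf_le1 ?mulr_gt0//; lra.
  rewrite cE mulr_gt0//=; apply: mulr_ile1; rewrite ?(ltW g0) ?(ltW ep0)//.
  by apply: exprn_ile1 => //; exact: ltW.
set W : R := e ^- (2 * p.+2).
have W1 : 1 <= W by rewrite /W -exprVn exprn_ege1// invf_ge1.
pose Q := (Num.truncn (Y * W) + 17)%N.
have YW0 : 0 <= Y * W by rewrite mulr_ge0 ?(ltW Y0)// (le_trans ler01).
have /andP[Q1 Q2] := Num.Theory.truncn_itv YW0.
have Qr : (Q%:R : R) = (Num.truncn (Y * W))%:R + 17 by rewrite natrD.
have Qlt : Y * W < Q%:R by apply: lt_trans Q2 _; rewrite Qr -natr1; lra.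
exists Q; split; first by rewrite (leq_trans _ (leq_addl _ _)).
  rewrite ler_pdivrMr; last by rewrite ltr0n /Q addn_gt0 orbT.
  apply: le_trans (ler_wpM2l _ (ltW Qlt)); last by rewrite divr_ge0 ?sqr_ge0 ?(ltW k0).
  rewrite cE /Y /W le_eqVlt; apply/orP; left; apply/eqP.
  rewrite mulnC exprM; field; rewrite !gt_eqF//.
rewrite Qr mulrDl; apply: lerD => //; by rewrite ler_peMr.
Qed.

(** From [Q <= exp Q] the bound of [aspect_le] has logarithm at most [11 * (p + 2) ^ 2 * Q ^ 2]. As
    [e <= 1], the exponent [4 * (p + 2)] may be raised to [9 * (p + 1) ^ 2], which is larger for
    [p >= 1]. *)
Lemma aspect_le_expR p Q (X e : R) : (16 <= Q)%N -> 0 < e <= 1 -> 0 < X ->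
  (0 < p)%N -> Q%:R <= X * e ^- (2 * p.+2) ->
  (aspect p Q)%:R <= expR ((11 * p.+2%:R ^+ 2 * X ^+ 2) * e ^- (9 * p.+1 ^ 2)).
Proof.
move=> Q16 /andP[e0 e1] X0 p0 QX.
apply: (@le_trans _ _ (Q%:R ^+ (11 * (p.+2 ^ 2 * Q)))).
  by rewrite -natrX ler_nat aspect_le.
have Qe : Q%:R <= expR Q%:R :> R by apply: le_trans (expR_ge1Dx _); rewrite lerDr.
apply: (@le_trans _ _ (expR Q%:R ^+ (11 * (p.+2 ^ 2 * Q)))).
  by apply: lerXn2r => //; rewrite nnegrE ?expR_ge0.
rewrite -expRM_natl ler_expR.
have -> : (11 * (p.+2 ^ 2 * Q))%:R * Q%:R = 11 * p.+2%:R ^+ 2 * Q%:R ^+ 2 :> R.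
  by rewrite !natrM; ring.
rewrite -[leRHS]mulrA ler_wpM2l ?mulr_ge0 ?exprn_ge0//.
apply: (@le_trans _ _ ((X * e ^- (2 * p.+2)) ^+ 2)).
  by rewrite lerXn2r ?nnegrE// mulr_ge0 ?invr_ge0 ?exprn_ge0// ltW.
rewrite exprMn ler_wpM2l ?sqr_ge0// -!exprVn -exprM.
apply: ler_weXn2l; first by rewrite invf_ge1.
rewrite expnS expn1; lia.
Qed.
End Constants.

(** * Choice of the mesh *)

Section BoxPattern.
Variable R : realType.
Local Notation mR := (measurableTypeR R).
Variables (n p Q : nat).
Hypotheses (p0 : (0 < p)%N) (Q16 : (16 <= Q)%N).
Variables (ie : 'I_p -> 'I_n.+1) (iu : 'I_n.+1).

Lemma box_pattern (E : set (n.+1.-tuple mR)) (d mg r h1 : R) :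
  0 <= d -> 0 < star_density p d <= 1 ->
  p.+1%:R / Q%:R <= star_density p d ^+ 2 / 512 ->
  0 < mg -> 0 <= r -> 0 < h1 ->
  measurable E -> E `<=` tbox (fun=> mg) r ->
  ((d * (r + 2 * mg + 3) ^+ n.+1)%:E < @lebesgue_tuple R n.+1 E)%E ->
  exists K Nt, [/\ (0 < K)%N, r + 2 * mg + 2 <= h1 / K%:R * Nt.+1%:R &
    pattern_in Nt Q K (h1 / K%:R) ie iu E].
Proof.
move=> d0 c01 Qc mg0 r0 h10 mE EB big.
have [mu [muE mubox mutr]] := lebesgue_tupleP R n.+1.
rewrite -muE in big.
have Efin : (mu E < +oo)%E.
  apply: (@le_lt_trans _ _ (mu (tbox (fun=> mg) r))); last by rewrite mubox// ltry.
  by apply: le_measure => //; rewrite inE//; exact: measurable_tbox.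
have fineE F : (mu F < +oo)%E -> (fine (mu F))%:E = mu F.
  by move=> Ffin; rewrite fineK// ge0_fin_numE.
rewrite -(fineE _ Efin) lte_fin in big.
set c := star_density p d in c01 Qc; have /andP[c0 c1] := c01.
set S := r + 2 * mg + 3 in big.
have Q0 : 0 < Q%:R :> R by rewrite ltr0n; apply: leq_trans Q16.
have C0 : 0 < Q%:R ^+ 2 + 4 / c * Q%:R by rewrite addr_gt0 ?exprn_gt0// mulr_gt0// divr_gt0.
set C := _ + _ in C0.
(* [C] is the factor of [omega] in [sampled_pattern]; this choice uses up half of the gap in
   [big]. *)
pose omega := (fine (mu E) - d * S ^+ n.+1) / (2 * C).
have om0 : 0 < omega by rewrite divr_gt0 ?mulr_gt0// subr_gt0.
have [del del0 hdel] := tuple_translation_cts mE EB om0.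
(* [K > z] makes the mesh smaller than [del], 1 and [mg]; [del] depends on [E], so [K] can only be
   chosen here. *)
pose z := h1 / del + h1 + h1 / mg.
have [z1 z2 z3] : [/\ h1 / del <= z, h1 <= z & h1 / mg <= z].
  have a1 : 0 < h1 / del by rewrite divr_gt0.
  have a2 : 0 < h1 / mg by rewrite divr_gt0.
  by rewrite /z; split; lra.
pose K := (Q + 4 + (Num.truncn z).+1)%N.
have zK : z < K%:R.
  apply: lt_le_trans (Num.Theory.truncnS_gt z) _; rewrite ler_nat; exact: leq_addl.
have K0 : (0 < K)%N by rewrite /K addnS.
have Kr : 0 < K%:R :> R by rewrite ltr0n.
pose h := h1 / K%:R; have h0 : 0 < h by rewrite divr_gt0.
have hlt a : 0 < a -> h1 / a <= z -> h < a.
  move=> a0 az; rewrite ltr_pdivrMr// mulrC -ltr_pdivrMr//; exact: le_lt_trans az zK.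
have hdl : h < del by exact: hlt.
have h_1 : h < 1 by apply: hlt; rewrite ?divr1.
have hmg : h < mg by exact: hlt.
have S0 : 0 < S by rewrite /S; lra.
have Sh0 : 0 <= S / h by rewrite divr_ge0// ltW.
have /andP[T1 T2] := Num.Theory.truncn_itv Sh0.
have T0 : (0 < Num.truncn (S / h))%N.
  by rewrite Num.Theory.truncn_gt0 ler_pdivlMr// mul1r /S; lra.
(* The grid has side at most [S] and more than [S - h]; the surplus 3 in [S] absorbs this
   rounding. *)
pose Nt := (Num.truncn (S / h)).-1.
have NtE : Nt.+1 = Num.truncn (S / h) by rewrite prednK.
rewrite -NtE in T1 T2.
have N1 : h * Nt.+1%:R <= S by rewrite mulrC -ler_pdivlMr.
have N2 : S < h * Nt.+1%:R + h.
  by move: T2; rewrite ltr_pdivrMr// -natr1; lra.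
exists K, Nt; rewrite -/h; split => //; first by rewrite /S in N2; lra.
have [cellfin cellle] : (mu (@cell R n.+1 h) < +oo)%E /\ fine (mu (@cell R n.+1 h)) <= h ^+ n.+1.
  have cb : (mu (@cell R n.+1 h) <= (h ^+ n.+1)%:E)%E.
    rewrite -(mubox (fun=> 0) h (ltW h0)); apply: le_measure; rewrite ?inE.
    - exact: measurable_cell.
    - exact: measurable_tbox.
    - by move=> t th i; have /andP[a b] := th i; rewrite add0r a ltW.
  have cf : (mu (@cell R n.+1 h) < +oo)%E by apply: le_lt_trans cb (ltry _).
  by split => //; rewrite -lee_fin fineE.
have cE : c = d / 2 * (d / (2 * p.+1%:R)) ^+ p.+1 by [].
have QK : (Q + 4 <= K)%N by exact: leq_addr.
apply: (@sampled_pattern R n Nt p Q K h h0 p0 Q16 QK ie iu mu E d c omega) => //.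
- move=> t /EB tb i; have /andP[a b] := tb i.
  by rewrite (le_trans (ltW mg0) a)/= (le_lt_trans b)//; rewrite /S in N2; lra.
- by move=> t /EB /(_ ord0) /andP[a _]; exact: le_trans (ltW hmg) a.
- move=> s /andP[s0 sh].
  have := hdel s; rewrite ger0_norm// -muE => /(_ (le_lt_trans sh hdl)) b.
  by rewrite -lee_fin fineE//; exact: le_lt_trans b (ltry _).
apply: (@le_lt_trans _ _ (d * S ^+ n.+1 + C * omega)).
  apply: lerD; last by [].
  rewrite card_mx card_ord mul1n natrX -mulrA ler_wpM2l//.
  apply: (@le_trans _ _ ((h * Nt.+1%:R) ^+ n.+1)).
    by rewrite exprMn ler_wpM2r// exprn_ge0.
  by apply: lerXn2r => //; rewrite nnegrE ?(ltW S0)// mulr_ge0// ltW.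
rewrite /omega (_ : C * _ = (fine (mu E) - d * S ^+ n.+1) / 2); last by field; rewrite gt_eqF.
lra.
Qed.
End BoxPattern.

(** * A box in which the set is dense *)

Section DenseBox.
Variable R : realType.
Local Notation mR := (measurableTypeR R).

Lemma bernoulli_le (n : nat) (x : R) : 0 <= x <= 1 -> 1 - n%:R * x <= (1 - x) ^+ n.
Proof.
move=> /andP[x0 x1]; elim: n => [|n IH]; first by rewrite mul0r subr0 expr0.
rewrite exprSr; apply: le_trans (ler_wpM2r _ IH); last by rewrite subr_ge0.
have : 0 <= n%:R * x ^+ 2 by rewrite mulr_ge0// exprn_ge0.
by rewrite -natr1 expr2; nra.
Qed.

(** Some cube of side [r > 3 * n * b], with [b = 2 * mg + 3], has density above [3 / 4] of the upper
    density. Widening it by [b] keeps at least [2 / 3] of that by Bernoulli's inequality, and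
    [3 / 4 * 2 / 3 = 1 / 2]. *)
Lemma dense_box (n : nat) (A : set 'rV[R]_n) (mg : R) :
  lebesgue_measurable A -> (0 < upper_Banach_density A)%E -> 0 <= mg ->
  exists r (z : 'rV[R]_n) (E : set (n.-tuple mR)),
    [/\ 0 <= r, measurable E, E `<=` tbox (fun=> mg) r,
        forall t, E t -> A (row_of_tuple t + z) &
        ((fine (upper_Banach_density A) / 2 * (r + 2 * mg + 3) ^+ n)%:E <
          @lebesgue_tuple R n E)%E].
Proof.
move=> mA dens0 mg0; have [mu [muE mubox mutr]] := lebesgue_tupleP R n.
have dens1 := upper_Banach_density_le1 muE mubox A.
have densE : (fine (upper_Banach_density A))%:E = upper_Banach_density A.
  by rewrite fineK// ge0_fin_numE ?ltW// (le_lt_trans dens1)// ltry.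
set e := fine (upper_Banach_density A) in densE *.
have [e0 e1] : 0 < e /\ e <= 1 by rewrite -lte_fin -lee_fin densE.
set b := 2 * mg + 3; have b0 : 0 < b by rewrite /b; lra.
have e34 : ((3 / 4 * e)%:E < upper_Banach_density A)%E by rewrite -densE lte_fin; lra.
have [r [x [rb hx]]] := upper_Banach_density_witness (3 * n%:R * b) e34.
have nb0 : 0 <= n%:R * b by rewrite mulr_ge0// ltW.
have r0 : 0 < r by apply: le_lt_trans rb; rewrite -mulrA mulr_ge0.
have [B [mB BA volB]] := lebesgue_measurable_core muE mA.
pose F := B `&` tbox (x ord0) r.
have mF : measurable F by apply: measurableI => //; exact: measurable_tbox.
pose z := (\row_i (x ord0 i - mg) : 'rV[R]_n).
exists r, z, (ttrans (fun i => x ord0 i - mg) @^-1` F); split; first exact: ltW.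
- by rewrite -[X in measurable X]setTI; exact: measurable_ttrans.
- by move=> t [_ /= tb] i; have := tb i; rewrite tnth_mktuple /=; lra.
- move=> t [/= /BA tA _]; congr (A _) : tA.
  by apply/rowP => i; rewrite !mxE tnth_mktuple.
rewrite -muE mutr//.
have Ffin : (mu F < +oo)%E.
  apply: (@le_lt_trans _ _ (mu (tbox (x ord0) r))); last by rewrite mubox ?ltW// ltry.
  by apply: le_measure; rewrite ?inE//; [exact: measurable_tbox|exact: subIsetr].
have FE : (fine (mu F))%:E = mu F by rewrite fineK// ge0_fin_numE.
rewrite -FE lte_fin.
have rn : 0 < r ^+ n by rewrite exprn_gt0.
have : ((3 / 4 * e)%:E < mu F * (r ^- n)%:E)%E.
  apply: (lt_le_trans hx); apply: lee_wpmul2r; first by rewrite lee_fin invr_ge0 ltW.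
  exact: volB.
rewrite -FE -EFinM lte_fin ltr_pdivlMr//; apply: le_lt_trans.
rewrite -addrA -/b; set S := r + b.
have S0 : 0 < S by rewrite addr_gt0.
have bS : 0 <= b / S <= 1.
  by rewrite divr_ge0 ?(ltW b0) ?(ltW S0)//= ler_pdivrMr// mul1r /S lerDr ltW.
have := bernoulli_le n bS.
rewrite (_ : 1 - b / S = r / S); last by rewrite /S; field; rewrite gt_eqF.
rewrite expr_div_n ler_pdivlMr ?exprn_gt0// => hb.
have h3 : n%:R * (b / S) <= 3^-1.
  by rewrite mulrA ler_pdivrMr// /S; lra.
have Sn : 0 <= S ^+ n by rewrite exprn_ge0// ltW.
have : (2 / 3) * S ^+ n <= r ^+ n.
  by apply: le_trans hb; apply: ler_wpM2r => //; lra.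
have e34' : 0 <= 3 / 4 * e by lra.
by move=> /(ler_wpM2l e34'); lra.
Qed.
End DenseBox.

(** * Assembly of the simplex *)

Section DenseSimplex.
Variable R : realType.

Lemma dense_simplex (p n Q : nat) (A : set 'rV[R]_n.+1) (V : R) :
  (0 < p)%N -> (p.+1 <= n)%N -> (16 <= Q)%N ->
  lebesgue_measurable A -> (0 < upper_Banach_density A)%E ->
  0 < star_density p (fine (upper_Banach_density A) / 2) <= 1 ->
  p.+1%:R / Q%:R <= star_density p (fine (upper_Banach_density A) / 2) ^+ 2 / 512 ->
  0 < V ->
  exists v : 'I_p.+2 -> 'rV[R]_n.+1,
    [/\ right_angled_simplex v ord0, right_angled_volume v ord0 = V,
        forall i, A (v i) &
        forall i j, i != ord0 -> j != ord0 ->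
          enorm (v i - v ord0) / enorm (v j - v ord0) <= (aspect p Q)%:R].
Proof.
move=> p0 pn Q16 mA dens0 c01 Qc V0.
have Q0 : (0 < Q)%N by apply: leq_trans Q16.
pose ie (i : 'I_p) : 'I_n.+1 := inord i.+2.
pose iu : 'I_n.+1 := inord 1.
have ieE i : ie i = i.+2 :> nat by rewrite /ie inordK// !ltnS; apply: leq_trans pn; rewrite ltnS ltn_ord.
have iuE : iu = 1%N :> nat by rewrite /iu inordK// ltnS; exact: leq_trans pn.
have ie_inj : injective ie by move=> i j ij; apply/val_inj; have := ieE i; rewrite ij ieE => -[] /esym.
have ieu i : ie i != iu by rewrite -val_eqE /= ieE iuE.
have iev i : ie i != ord0 by rewrite -val_eqE /= ieE.
have iuv : iu != ord0 by rewrite -val_eqE /= iuE.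
(* [total_vol] without its factor [K ^ p.+1]: at mesh [h1 / K] the product of the lengths is
   [h1 ^ p.+1 * W] whatever [K] is, which determines [h1]. *)
pose W := (8 * Q ^ p * ratio_base p Q ^ 4 * scale_base p Q ^ (p * Q.-1))%N.
have N0 := ratio_base_gt0 p Q0; have M0 := scale_base_gt0 p Q0.
have W0 : 0 < W%:R :> R by rewrite ltr0n !muln_gt0 !expn_gt0 ?Q0 ?N0 ?M0.
have f0 : 0 < p.+1`!%:R :> R by rewrite ltr0n fact_gt0.
pose T := p.+1`!%:R * V / W%:R; have T0 : 0 < T by rewrite divr_gt0// mulr_gt0.
pose h1 := T `^ (p.+1%:R^-1); have h10 : 0 < h1 by exact: powR_gt0.
have h1T : h1 ^+ p.+1 = T.
  by rewrite -powR_mulrn ?powR_ge0// -powRrM mulVf ?pnatr_eq0// powRr1// ltW.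
have asp0 : 0 < (aspect p Q)%:R :> R by rewrite ltr0n !muln_gt0 !expn_gt0 ?Q0 ?N0 ?M0.
(* The largest displacement in actual length, free of [K]: the box and [E] can be fixed before
   [K]. *)
pose mg := h1 * (aspect p Q)%:R; have mg0 : 0 < mg by rewrite mulr_gt0.
have [r [z [E [r0 mE EB EA big]]]] := dense_box mA dens0 (ltW mg0).
have e0 : 0 <= fine (upper_Banach_density A) / 2 by rewrite divr_ge0// fine_ge0// ltW.
have [K [Nt [K0 Nth pat]]] := box_pattern p0 Q16 ie iu e0 c01 Qc mg0 r0 h10 mE EB big.
have Kr : 0 < K%:R :> R by rewrite ltr0n.
have h0 : 0 < h1 / K%:R by rewrite divr_gt0.
have mgh : (K * aspect p Q)%:R * (h1 / K%:R) <= mg.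
  by rewrite natrM /mg le_eqVlt; apply/orP; left; apply/eqP; field; rewrite gt_eqF.
have himg : (mg + r + 1) + mg <= h1 / K%:R * Nt.+1%:R by apply: le_trans Nth; lra.
have Ebox t : E t -> forall l, mg <= (tnth t l : R) < mg + r + 1.
  by move=> /EB tb l; have /andP[a b] := tb l; rewrite a/=; lra.
have [x0 [b [s [t [rho [[b0 rho0] str [y0 Ey0 y0E] leg [lens vol_]]]]]]] :=
  pattern_realize h0 Q16 K0 mgh himg iuv Ebox pat.
pose d := edge ie iu ord0 b s t.
have dd i : dot (d i) (d i) = edge_len b rho i ^+ 2 by exact: dot_edge.
have dE i : enorm (d i) = edge_len b rho i by exact: enorm_edge.
have l0 i : 0 < edge_len b rho i by exact: edge_len_gt0.
have [sim volE] : right_angled_simplex (star_vertices (x0 + z) d) ord0 /\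
   right_angled_volume (star_vertices (x0 + z) d) ord0 = (\prod_i enorm (d i)) / p.+1`!%:R.
  apply: right_angled_star => [i|i j ij]; first by rewrite dd gt_eqF// exprn_gt0.
  exact: edge_orthogonal.
exists (star_vertices (x0 + z) d); split => //.
- rewrite volE (eq_bigr _ (fun i _ => dE i)) vol_.
  have -> : total_vol p Q K = (K ^ p.+1 * W)%N by rewrite /total_vol /W !mulnA [(8 * _)%N]mulnC.
  rewrite expr_div_n h1T natrM natrX /T.
  by move: (K%:R ^+ p.+1) (exprn_gt0 p.+1 Kr) => k k0; field; rewrite !gt_eqF.
- move=> i; rewrite /star_vertices; case: unliftP => [l _|_].
    by have [y Ey yE] := leg l; rewrite addrAC -yE; exact: EA.
  by rewrite -y0E; exact: EA.
move=> i j; case: (unliftP ord0 i) => [i' ->|->]; last by rewrite eqxx.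
case: (unliftP ord0 j) => [j' ->|->]; last by rewrite eqxx.
move=> _ _; rewrite !star_verticesB !dE ler_pdivrMr//.
have /andP[_ le1] := lens i'; have /andP[ge1 _] := lens j'.
apply: (le_trans le1); rewrite natrM mulrAC mulrC.
by apply: ler_wpM2l => //; exact: ltW.
Qed.
End DenseSimplex.

Theorem corollary2 (R : realType) (m : nat) (hm : (2 <= m)%N) :
  exists C : R, 0 < C /\
    forall n : nat, (m + 1 <= n)%N ->
    forall A : set 'rV[R]_n, lebesgue_measurable A ->
    (0 < upper_Banach_density A)%E ->
    forall V : R, 0 < V ->
    exists (v : 'I_m.+1 -> 'rV[R]_n) (k : 'I_m.+1),
      [/\ right_angled_simplex v k,
          right_angled_volume v k = V,
          forall i : 'I_m.+1, A (v i) &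
          forall i j : 'I_m.+1, i != k -> j != k ->
            enorm (v i - v k) / enorm (v j - v k)
              <= expR (C * fine (upper_Banach_density A) ^- (9 * m ^ 2)%N)].
Proof.
case: m hm => // p p0; have [X X0 count] := scale_count R p.
exists (11 * p.+2%:R ^+ 2 * X ^+ 2).
split; first by rewrite !mulr_gt0 ?exprn_gt0.
move=> [|n]; first by rewrite addn1.
rewrite addn1 ltnS => pn A mA dens0 V V0.
have e01 : 0 < fine (upper_Banach_density A) <= 1.
  have [mu [muE mubox _]] := lebesgue_tupleP R n.+1.
  have dens1 := upper_Banach_density_le1 muE mubox A.
  by rewrite -lte_fin -lee_fin fineK ?dens0 ?dens1// ge0_fin_numE ?ltW// (le_lt_trans dens1)// ltry.
have [c01 [Q [Q16 Qc QX]]] := count _ e01.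
have [v [simv volv Av ratio]] := dense_simplex p0 pn Q16 mA dens0 c01 Qc V0.
exists v, ord0; split => // i j i0 j0.
exact: (le_trans (ratio i j i0 j0) (aspect_le_expR Q16 e01 X0 p0 QX)).
Qed.
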